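(* Let $I\subset\mathbb R$ be an open interval, $x_0\in I$, and let $\tilde f:I\to\mathbb H^3_1$ and $\tilde\nu:I\to\mathbb S^2_1$ be smooth maps satisfying $\langle\tilde f^{-1}\tilde f',\tilde\nu\rangle=0$. Let $\rho\in\mathbb R\setminus\{0,\pm1\}$, and put $$w=\tfrac12\big[\tilde\nu,\tilde f^{-1}\tilde f'\big],\qquad N_1=\frac{\rho+1}{2\rho}\Big(\tilde\nu'+(\rho-1)w\Big),\qquad \mu=\frac{\rho-1}{\rho+1}.$$ Assume that $\tilde\nu'$ and $w$ are linearly independent at every point of $I$. Let $\hat F$ be the extended frame produced by the DPW construction (described in the context) from the Cauchy data $N_0=\tilde\nu$ and $N_1$. Then, on a neighbourhood $\Omega$ of the diagonal in $I\times I$, $$f=\tilde f(x_0)\,\hat F|_{\lambda=\mu}\,\hat F|_{\lambda=1}^{-1}$$ is a timelike immersion into $\mathbb H^3_1$ of constant extrinsic curvature $K+1=\rho^2$, with Gauss map $\nu=\mathrm{Ad}_{\hat F|_{\lambda=1}}e_3$ and asymptotic coordinates $(x,y)$, and $$f(x,x)=\tilde f(x),\qquad \nu(x,x)=\tilde\nu(x)\qquad(x\in I).$$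
   Context: Ambient space. On the space $\mathfrak{gl}(2,\mathbb R)$ of real $2\times2$ matrices let $\langle X,Y\rangle=-\tfrac12\operatorname{tr}(X\bar Y)$, where $\bar Y=(\operatorname{tr}Y)\mathrm{Id}-Y$; then $\langle X,X\rangle=-\det X$. Anti-de Sitter 3-space is $\mathbb H^3_1=\{X:\langle X,X\rangle=-1\}=SL(2,\mathbb R)$ with the induced Lorentzian metric. On $\mathfrak{sl}(2,\mathbb R)$, $\langle X,Y\rangle=\tfrac12\operatorname{tr}(XY)$; put $\mathbb S^2_1=\{X\in\mathfrak{sl}(2,\mathbb R):\langle X,X\rangle=1\}$, $e_3=\begin{pmatrix}-1&0\\0&1\end{pmatrix}$, $\mathrm{Ad}_FX=FXF^{-1}$, $\mathfrak k=\mathbb Re_3$. Surfaces. An immersion $f$ into $\mathbb H^3_1$ is timelike if the induced metric $I_f$ is Lorentzian; it has Gauss map $\nu$ if $N=f\nu$ is a unit normal ($\langle N,N\rangle=1$, $N$ orthogonal to $f,f_x,f_y$). The second fundamental form $II$ has coefficients $L=\langle f_{xx},N\rangle$, $M=\langle f_{xy},N\rangle$, $\mathcal N=\langle f_{yy},N\rangle$; $(x,y)$ are asymptotic if $L=\mathcal N=0$ (and $II$ is Lorentzian). The Gaussian curvature $K$ is given by $K+1=\det II/\det I_f$, and $K+1$ is the extrinsic curvature. Loop groups. Let $G_\sigma$ be the group of smooth loops $\gamma(\lambda)$ in $SL(2,\mathbb C)$ with $\overline{\gamma(\bar\lambda)}=\gamma(\lambda)$ and $\gamma(-\lambda)=\mathrm{Ad}_{e_3}\gamma(\lambda)$;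 $G_\sigma^+$ the loops extending holomorphically to the unit disc $\mathbb D$; $G^-_{\sigma,*}$ the loops extending holomorphically to $\mathbb P^1\setminus\mathbb D$ and equal to $\mathrm{Id}$ at $\infty$. The big cell $G^-_{\sigma,*}\cdot G^+_\sigma$ is open and dense, and its elements factor uniquely. DPW construction from Cauchy data $N_0:I\to\mathbb S^2_1$, $N_1:I\to\mathfrak{sl}(2,\mathbb R)$ with $\langle N_1,N_0\rangle=0$. Choose any smooth $F:I\to SL(2,\mathbb R)$ with $\mathrm{Ad}_Fe_3=N_0$ and put $\beta_1=-\tfrac14[e_3,\mathrm{Ad}_F^{-1}N_1]$, $\gamma_{-1}=-\tfrac14[e_3,\mathrm{Ad}_F^{-1}(N_0'-N_1)]$, $\hat\alpha^\lambda=(F^{-1}F')_{\mathfrak k}+\lambda\beta_1+\lambda^{-1}\gamma_{-1}$, where $(\cdot)_{\mathfrak k}$ is the $e_3$-component. Solve $X^{-1}dX=\hat\alpha^\lambda(x)\,dx$, $Y^{-1}dY=\hat\alpha^\lambda(y)\,dy$ with $X(x_0)=Y(x_0)=F(x_0)$ for all $\lambda$. On an open neighbourhood of the diagonal of $I\times I$ on which $X(x)^{-1}Y(y)$ lies in the big cell, factor $X(x)^{-1}Y(y)=H_-(x,y)H_+(x,y)$ with $H_-\in G^-_{\sigma,*}$, $H_+\in G^+_\sigma$, and set $\hat F(x,y)=X(x)H_-(x,y)=Y(y)H_+(x,y)^{-1}$. Its Maurer–Cartan form is defined for all $\lambda\ne0$ (a Laurent polynomial in $\lambda$, with $\lambda$-degrees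 $\{0,1\}$ in $dx$ and $\{-1,0\}$ in $dy$), so $\hat F$ is evaluated at all real $\lambda\ne0$. *)

(* Defs.v *)
From mathcomp Require Import all_boot all_order all_algebra complex.
From mathcomp Require Import all_classical all_reals all_analysis.

Set Implicit Arguments.
Unset Strict Implicit.
Unset Printing Implicit Defensive.

Import Order.TTheory GRing.Theory Num.Theory numFieldNormedType.Exports.

Local Open Scope classical_set_scope.
Local Open Scope ring_scope.

Definition mx2 (K : nzRingType) (a b c d : K) : 'M[K]_2 :=
  \matrix_(i, j) if i == ord0 then (if j == ord0 then a else b)
                 else (if j == ord0 then c else d).

Definition e3 (K : nzRingType) : 'M[K]_2 := mx2 (-1) 0 0 1.

Definition bracket (K : nzRingType) (X Y : 'M[K]_2) : 'M[K]_2 :=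
  X *m Y - Y *m X.

Definition Ad (K : fieldType) (F X : 'M[K]_2) : 'M[K]_2 :=
  F *m X *m invmx F.

Definition inner (R : realType) (X Y : 'M[R]_2) : R :=
  - 2^-1 * \tr (X *m ((\tr Y)%:M - Y)).

Definition AdS3 (R : realType) : set 'M[R]_2 := [set X | inner X X = -1].

Definition sl2 (R : realType) : set 'M[R]_2 := [set X | \tr X = 0].

Definition S21 (R : realType) : set 'M[R]_2 :=
  [set X | sl2 X /\ inner X X = 1].

(* e3 is a unit vector, so this is the component along the line R e3. *)
Definition proj_k (R : realType) (X : 'M[R]_2) : 'M[R]_2 :=
  inner X (e3 R) *: e3 R.

Definition smooth1 (R : realType) (I : set R) (f : R -> 'M[R]_2) : Prop :=
  forall (n : nat) (x : R), I x -> derivable (derive1n n f) x 1.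

Definition ex (R : realType) : R * R := (1, 0).
Definition ey (R : realType) : R * R := (0, 1).

(* f is C^n on the open set Omega: all partial derivatives up to order n exist
   and are continuous. *)
Fixpoint Ck2 (R : realType) (Omega : set (R * R)) (n : nat)
    (f : R * R -> 'M[R]_2) : Prop :=
  (forall p, Omega p -> {for p, continuous f}) /\
  match n with
  | 0 => True
  | m.+1 =>
    [/\ forall p, Omega p -> derivable f p (ex R) /\ derivable f p (ey R),
        Ck2 Omega m ('D_(ex R) f) & Ck2 Omega m ('D_(ey R) f)]
  end.

Definition smooth2 (R : realType) (Omega : set (R * R))
    (f : R * R -> 'M[R]_2) : Prop :=
  forall n, Ck2 Omega n f.

(* Signature (1,1). *)
Definition lorentzian (R : realType) (g : 'M[R]_2) : Prop :=
  exists2 P : 'M[R]_2, P \in unitmx & P^T *m g *m P = mx2 1 0 0 (-1).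

Definition first_form (R : realType) (f : R * R -> 'M[R]_2) (p : R * R) :
    'M[R]_2 :=
  let fx := 'D_(ex R) f p in
  let fy := 'D_(ey R) f p in
  mx2 (inner fx fx) (inner fx fy) (inner fx fy) (inner fy fy).

Definition timelike_immersion (R : realType) (Omega : set (R * R))
    (f : R * R -> 'M[R]_2) : Prop :=
  smooth2 Omega f /\
  forall p, Omega p ->
    [/\ AdS3 (f p),
        free [:: 'D_(ex R) f p; 'D_(ey R) f p]
      & lorentzian (first_form f p)].

Definition gauss_map (R : realType) (Omega : set (R * R))
    (f nu : R * R -> 'M[R]_2) : Prop :=
  forall p, Omega p ->
    let N := f p *m nu p in
    [/\ inner N N = 1, inner N (f p) = 0,
        inner N ('D_(ex R) f p) = 0 & inner N ('D_(ey R) f p) = 0].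

Definition IIxx (R : realType) (f nu : R * R -> 'M[R]_2) (p : R * R) : R :=
  inner ('D_(ex R) ('D_(ex R) f) p) (f p *m nu p).
Definition IIxy (R : realType) (f nu : R * R -> 'M[R]_2) (p : R * R) : R :=
  inner ('D_(ey R) ('D_(ex R) f) p) (f p *m nu p).
Definition IIyy (R : realType) (f nu : R * R -> 'M[R]_2) (p : R * R) : R :=
  inner ('D_(ey R) ('D_(ey R) f) p) (f p *m nu p).

Definition second_form (R : realType) (f nu : R * R -> 'M[R]_2) (p : R * R) :
    'M[R]_2 :=
  mx2 (IIxx f nu p) (IIxy f nu p) (IIxy f nu p) (IIyy f nu p).

Definition asymptotic_coordinates (R : realType) (Omega : set (R * R))
    (f nu : R * R -> 'M[R]_2) : Prop :=
  forall p, Omega p ->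
    [/\ IIxx f nu p = 0, IIyy f nu p = 0 & lorentzian (second_form f nu p)].

Definition gauss_curvature (R : realType) (f nu : R * R -> 'M[R]_2)
    (p : R * R) : R :=
  \det (second_form f nu p) / \det (first_form f p) - 1.

Definition toC (R : realType) (X : 'M[R]_2) : 'M[R[i]]_2 :=
  map_mx (real_complex R) X.

Definition mxRe (R : realType) (X : 'M[R[i]]_2) : 'M[R]_2 :=
  map_mx (@complex.Re R) X.

Definition mxIm (R : realType) (X : 'M[R[i]]_2) : 'M[R]_2 :=
  map_mx (@complex.Im R) X.

(* Only the values of g on the unit circle matter here; elements of the
   subgroups below also carry their holomorphic extension. *)
Definition loop_group (R : realType) (g : R[i] -> 'M[R[i]]_2) : Prop :=
  [/\ smooth1 setT (fun t => mxRe (g (cos t +i* sin t)%C)),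
      smooth1 setT (fun t => mxIm (g (cos t +i* sin t)%C))
    & forall l : R[i], `|l| = 1 ->
        [/\ \det (g l) = 1,
            map_mx (@conjc R) (g (conjc l)) = g l
          & g (- l) = Ad (e3 R[i]) (g l)]].

(* R[i]^o is R[i] as a normed module over itself, so that derivability in
   direction 1 is complex differentiability. *)
Definition holomorphic_on_disc (R : realType) (g : R[i] -> 'M[R[i]]_2) : Prop :=
  forall i j : 'I_2,
    {within [set z : R[i]^o | `|z| <= 1],
      continuous (fun z : R[i]^o => g z i j : R[i]^o)} /\
    (forall z : R[i]^o, `|z| < 1 ->
      derivable (fun z : R[i]^o => g z i j : R[i]^o) z 1).

Definition loop_group_plus (R : realType) (g : R[i] -> 'M[R[i]]_2) : Prop :=
  loop_group g /\ holomorphic_on_disc g.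

(* The exterior of the disc is read in the chart z = 1/l at infinity, where g
   is given the value Id. *)
Definition loop_group_minus (R : realType) (g : R[i] -> 'M[R[i]]_2) : Prop :=
  loop_group g /\
  holomorphic_on_disc (fun z => if z == 0 then 1%:M else g z^-1).

Definition adapted_frame (R : realType) (I : set R) (N0 F : R -> 'M[R]_2) :
    Prop :=
  smooth1 I F /\
  forall x, I x -> \det (F x) = 1 /\ Ad (F x) (e3 R) = N0 x.

Definition dpw_beta (R : realType) (N1 F : R -> 'M[R]_2) (x : R) : 'M[R]_2 :=
  - 4^-1 *: bracket (e3 R) (Ad (invmx (F x)) (N1 x)).

Definition dpw_gamma (R : realType) (N0 N1 F : R -> 'M[R]_2) (x : R) :
    'M[R]_2 :=
  - 4^-1 *: bracket (e3 R) (Ad (invmx (F x)) (derive1 N0 x - N1 x)).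

Definition dpw_potential (R : realType) (N0 N1 F : R -> 'M[R]_2)
    (l : R[i]) (x : R) : 'M[R[i]]_2 :=
  toC (proj_k (invmx (F x) *m derive1 F x)) + l *: toC (dpw_beta N1 F x)
  + l^-1 *: toC (dpw_gamma N0 N1 F x).

(* X^-1 dX = potential on I, written X' = X * potential, and X = F at x0, for
   every complex l <> 0. *)
Definition dpw_solution (R : realType) (I : set R) (x0 : R)
    (N0 N1 F : R -> 'M[R]_2) (X : R -> R[i] -> 'M[R[i]]_2) : Prop :=
  forall l : R[i], l != 0 ->
    X x0 l = toC (F x0) /\
    forall x, I x ->
      let X' := X x l *m dpw_potential N0 N1 F l x in
      is_derive x 1 (fun t => mxRe (X t l)) (mxRe X') /\
      is_derive x 1 (fun t => mxIm (X t l)) (mxIm X').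

Definition birkhoff_factorization (R : realType) (Omega : set (R * R))
    (X Y : R -> R[i] -> 'M[R[i]]_2)
    (Hm Hp : R * R -> R[i] -> 'M[R[i]]_2) : Prop :=
  forall p, Omega p ->
    [/\ loop_group_minus (Hm p), loop_group_plus (Hp p)
      & forall l : R[i], `|l| = 1 ->
          invmx (X p.1 l) *m Y p.2 l = Hm p l *m Hp p l].

(* The loop X H_- = Y H_+^-1, extended from the unit circle to all l <> 0:
   X and Y are defined for every l <> 0, while H_- lives outside and H_+ inside
   the disc. The two branches agree on the circle by the factorization. *)
Definition extended_frame (R : realType) (X Y : R -> R[i] -> 'M[R[i]]_2)
    (Hm Hp : R * R -> R[i] -> 'M[R[i]]_2) (p : R * R) (l : R[i]) :
    'M[R[i]]_2 :=
  if 1 <= `|l| then X p.1 l *m Hm p l else Y p.2 l *m invmx (Hp p l).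

(* Main.v *)
Require Import Defs.
From mathcomp Require Import all_boot all_order all_algebra complex.
From mathcomp Require Import all_classical all_reals all_analysis.
From mathcomp Require Import ring lra.
Import Order.TTheory GRing.Theory Num.Theory numFieldNormedType.Exports.
Set Implicit Arguments.
Unset Strict Implicit.
Unset Printing Implicit Defensive.
Local Open Scope classical_set_scope.
Local Open Scope ring_scope.

(* Near the diagonal the Birkhoff factorization is explicit. In the frame F the potential is s0 e3 + l b(x) + l^-1 g(x) with b, g
   off-diagonal. Near the diagonal let u solve the sinh-Gordon type problem
     u_xy = 2 (b2 g1 e^u - b1 g2 e^-u),   u = 0 and u_x = 2 s0 on the diagonal,
   and put S = (u_x / 2) e3 and c = offdiag (g1(y) e^u, g2(y) e^-u), so that
   (S + l b) dx + l^-1 c dy is flat for every l. Then H_- is the entire series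
   in l^-1 solving (H_-)_y = l^-1 H_- c, H_+ is an entire series in l solving
   (H_+)_x = - (S + l b) H_+, both equal Id on the diagonal, and X H_- H_+ does
   not depend on x, whence X(x) H_- H_+ = Y(y). The frame X H_- has
   Maurer-Cartan form (S + l b) dx + l^-1 c dy, from which the fundamental
   forms of f are computed; the two null directions are independent near the
   diagonal because b1 g2 - b2 g1 <> 0 amounts to the independence of nu' and w.
   On the diagonal uniqueness for linear equations gives X(1) = F and
   X(mu) = ft(x0)^-1 ft F: the choice of N1 makes
   (mu - 1) b + (mu^-1 - 1) g = F^-1 (ft^-1 ft') F. *)

(** * Differentiation and oriented integration in one real variable, with explicit remainders *)

Section OneVariable.
Context {R : realType}.
Implicit Types (a b c x y : R) (f g : R -> R).

(** What has to be produced is a factorization that is smooth in [(x, y)] and valid for all [l] at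
    once. The only nonlinear unknown is the scalar [u], and [l] does not occur in its equation; the
    remaining equations are linear and, up to a gauge, [l] only counts the order of an iterated
    integral in them. The Picard iterates are therefore the Taylor coefficients of [H_-] and [H_+],
    and their factorial decay makes both series entire, hence loops with a holomorphic extension.
    The data for [u] on the diagonal make [S = s0 e3] and [c = g] there, so that the flat form
    restricts to the potential. Existence is obtained on small squares only, but the iterates are
    given by formulas that do not mention the square: all squares define the same functions and
    nothing has to be glued. The value of [mu] comes from the curvature: the determinants of both
    fundamental forms contain the factor [(b1 c2 - b2 c1)^2], and their quotient leaves
    [((1 + mu) / (1 - mu))^2], which is [rho^2]. *)

Lemma near_itv a b x (P : R -> Prop) : a < x < b ->
  (forall y, a < y < b -> P y) -> \forall y \near x, P y.
Proof.
move=> /andP[ax xb] h; near=> y; apply: h; apply/andP; split; near: y.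
- exact: lt_nbhsr.
- exact: lt_nbhsl.
Unshelve. all: by end_near. Qed.

Lemma is_derive_itv_ext a b x f g d : a < x < b ->
  (forall y, a < y < b -> f y = g y) -> is_derive x 1 f d -> is_derive x 1 g d.
Proof. by move=> xab fg; apply: near_eq_is_derive; exact: near_itv xab fg. Qed.

Lemma is_derive_continuous x f d : is_derive x 1 f d -> {for x, continuous f}.
Proof. by move=> h; apply/differentiable_continuous/derivable1_diffP. Qed.

(** The bound on the distance from [c] to [x] is the extra information: it turns a Lipschitz
    derivative into a quadratic remainder. The two points come in either order and may coincide. *)
Lemma mean_value a b f g x y :
  (forall t, a < t < b -> is_derive t 1 f (g t)) -> a < x < b -> a < y < b ->
  exists c, [/\ a < c < b, `|c - x| <= `|y - x| & f y - f x = g c * (y - x)].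
Proof.
wlog: x y / x <= y => [hw fg xab yab|xy fg /andP[ax xb] /andP[ay yb]].
  have [xy|yx] := leP x y; first exact: hw.
  have [c [cab h1 h2]] := hw _ _ (ltW yx) fg yab xab.
  have [d [dab /andP[h3 h4] h5]] : exists d, [/\ a < d < b, y <= d <= x
      & f x - f y = g d * (x - y)].
    have h t : t \in `]y, x[ -> is_derive t 1 f (g t).
      rewrite in_itv/= => /andP[yt tx]; apply: fg.
      by move: xab yab => /andP[? ?] /andP[? ?]; apply/andP; split; lra.
    have [|d + e] := MVT yx h.
      apply: continuous_in_subspaceT => t; rewrite inE/= in_itv/= => /andP[yt tx].
      apply: is_derive_continuous; apply: fg.
      by move: xab yab => /andP[? ?] /andP[? ?]; apply/andP; split; lra.
    rewrite in_itv/= => /andP[? ?]; exists d; split => //.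
      by move: xab yab => /andP[? ?] /andP[? ?]; apply/andP; split; lra.
    by apply/andP; split; lra.
  exists d; split => //; last by lra.
  by rewrite !ler0_norm; lra.
move: xy; rewrite le_eqVlt => /predU1P[<-|xy].
  by exists x; rewrite ax xb !subrr mulr0.
have h t : t \in `]x, y[ -> is_derive t 1 f (g t).
  by rewrite in_itv/= => /andP[xt ty]; apply: fg; apply/andP; split; lra.
have [|d + e] := MVT xy h.
  apply: continuous_in_subspaceT => t; rewrite inE/= in_itv/= => /andP[xt ty].
  by apply: is_derive_continuous; apply: fg; apply/andP; split; lra.
rewrite in_itv/= => /andP[? ?]; exists d; split => //.
  by apply/andP; split; lra.
by rewrite !ger0_norm; lra.
Qed.

Lemma mean_value_le a b f g M x y :
  (forall t, a < t < b -> is_derive t 1 f (g t)) ->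
  (forall t, a < t < b -> `|g t| <= M) -> a < x < b -> a < y < b ->
  `|f y - f x| <= M * `|y - x|.
Proof.
move=> fg gM xab yab; have [c [cab _ ->]] := mean_value fg xab yab.
by rewrite normrM ler_wpM2r// gM.
Qed.

Lemma derive0_const a b f x y : (forall t, a < t < b -> is_derive t 1 f 0) ->
  a < x < b -> a < y < b -> f y = f x.
Proof.
move=> f0 xab yab; have [c [_ _]] := mean_value (g := cst 0) f0 xab yab.
by rewrite mul0r => /eqP; rewrite subr_eq0 => /eqP.
Qed.

(** At the mean value point [g c] differs from [g x] by at most [L * |y - x|], because [c] is no
    farther from [x] than [y] is. *)
Lemma quadratic_remainder a b f g L x y :
  (forall t, a < t < b -> is_derive t 1 f (g t)) ->
  (forall s t, a < s < b -> a < t < b -> `|g t - g s| <= L * `|t - s|) ->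
  a < x < b -> a < y < b -> `|f y - f x - (y - x) * g x| <= L * (y - x) ^+ 2.
Proof.
move=> fg gL xab yab; have [c [cab cx ->]] := mean_value fg xab yab.
have -> : g c * (y - x) - (y - x) * g x = (g c - g x) * (y - x) by ring.
rewrite normrM -real_normK ?num_real// expr2 mulrA ler_wpM2r//.
apply: le_trans (gL _ _ xab cab) _.
(* If [L] is negative, the Lipschitz bound forces [y = x]. *)
have [h|h] := leP 0 L; first exact: ler_wpM2l.
have := le_trans (normr_ge0 _) (gL _ _ xab yab).
rewrite nmulr_rge0// => h'.
have : `|c - x| <= 0 by apply: le_trans cx h'.
rewrite normr_le0 => /eqP ->; rewrite normr0 mulr0.
have -> : `|y - x| = 0 by apply/eqP; rewrite eq_le h' normr_ge0.
by rewrite mulr0.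
Qed.

(** Derivatives of series and of integrals with a parameter are obtained through this criterion: a
    quadratic remainder bound can be summed and integrated along with its constant, which replaces
    any exchange of limits. *)
Lemma is_derive_quadratic a b f d C x : a < x < b ->
  (forall y, a < y < b -> `|f y - f x - (y - x) * d| <= C * (y - x) ^+ 2) ->
  is_derive x 1 f d.
Proof.
move=> xab h.
have cv : h^-1 *: (f (h *: 1 + x) - f x) @[h --> 0^'] --> d.
  apply/cvgrPdist_le => e e0.
  have C0 : 0 < `|C| + 1 by apply: ltr_wpDl.
  near=> k.
  have k0 : k != 0 by near: k; exact: nbhs_dnbhs_neq.
  have kab : a < k + x < b.
    near: k; apply: nbhs_dnbhs.
    have : \forall k \near (0:R), a < k + x < b.
      move/andP : xab => [ax xb].
      have h0 : a - x < 0 < b - x by apply/andP; split; lra.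
      by apply: (near_itv h0) => k /andP[? ?]; apply/andP; split; lra.
    exact.
  have ke : `|k| <= e / (`|C| + 1).
    by near: k; apply: dnbhs0_le; rewrite divr_gt0.
  have := h _ kab; rewrite addrK [k *: 1]mulr1 => hk.
  have -> : d - k^-1 *: (f (k + x) - f x) = - (k^-1 * (f (k + x) - f x - k * d)).
    by rewrite /GRing.scale/=; field.
  rewrite normrN normrM normfV ler_pdivrMl ?normr_gt0//.
  apply: (le_trans hk); rewrite -real_normK ?num_real// expr2 mulrC -mulrA ler_wpM2l//.
  apply: le_trans (_ : (`|C| + 1) * `|k| <= _).
    by rewrite mulrC ler_wpM2r//; apply: (le_trans (ler_norm _)); lra.
  by rewrite mulrC -ler_pdivlMr.
by apply: DeriveDef; [apply/cvg_ex; exists d|exact/cvg_lim].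
Unshelve. all: by end_near. Qed.

(* The oriented integral, total so that iterates have a formula independent of the interval. *)
Definition itg g c x : R :=
  if c <= x then Rintegral (@lebesgue_measure R) `[c, x] g
  else - Rintegral (@lebesgue_measure R) `[x, c] g.

Lemma itg_id g c : itg g c c = 0.
Proof. by rewrite /itg lexx set_itv1 Rintegral_set1. Qed.

Lemma integrable_itv a b g c d : (forall x, a < x < b -> {for x, continuous g}) ->
  a < c -> d < b -> (@lebesgue_measure R).-integrable `[c, d] (EFin \o g).
Proof.
move=> cg ac db; apply: continuous_compact_integrable; first exact: segment_compact.
apply: continuous_in_subspaceT => t; rewrite inE/= in_itv/= => /andP[? ?].
by apply: cg; apply/andP; split; lra.
Qed.

Lemma Rintegral_split a b g c d e : (forall x, a < x < b -> {for x, continuous g}) ->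
  a < c -> e < b -> c <= d <= e -> Rintegral (@lebesgue_measure R) `[c, e] g =
  Rintegral (@lebesgue_measure R) `[c, d] g + Rintegral (@lebesgue_measure R) `[d, e] g.
Proof.
move=> cg ac eb /andP[cd de].
have := @Rintegral_itvB R g (BLeft c) (BRight e) d.
move=> /(_ (integrable_itv cg ac eb)).
rewrite !bnd_simp => /(_ cd de) h.
apply/eqP; rewrite addrC -subr_eq h; apply/eqP.
rewrite Rintegral_itv_obnd_cbnd//.
apply: integrableS (integrable_itv cg ac eb) => // t /=.
by rewrite !in_itv/= => /andP[dt ->]; rewrite andbT; apply: le_trans (ltW dt).
Qed.

Lemma is_derive_itg a b g c x : (forall x, a < x < b -> {for x, continuous g}) ->
  a < c < b -> a < x < b -> is_derive x 1 (itg g c) (g x).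
Proof.
move=> cg /andP[ac cb] /andP[ax xb].
(* The point [a'] lies to the left of both [c] and [x]: near [x] the oriented integral is then an
   integral from [a'] minus a constant, whichever side of [c] the variable is on. *)
pose a' := (a + Num.min c x) / 2; pose b' := (x + b) / 2.
have a'1 : [/\ a < a', a' < c & a' < x].
  by rewrite /a'; case: (leP c x) => ?; split; lra.
have [aa' a'c a'x] := a'1.
have b'1 : x < b' < b by rewrite /b'; apply/andP; split; lra.
have /andP[xb' b'b] := b'1.
have a'xb' : a' < x < b' by rewrite a'x xb'.
have E y : a' < y < b' -> itg g c y =
    Rintegral (@lebesgue_measure R) `[a', y] g -
    Rintegral (@lebesgue_measure R) `[a', c] g.
  move=> /andP[a'y yb']; rewrite /itg; case: (leP c y) => cy.
  - rewrite (@Rintegral_split a b g a' c y)//; [ring|lra|].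
    by apply/andP; split; lra.
  - rewrite (@Rintegral_split a b g a' y c)//; [ring|].
    by apply/andP; split; lra.
apply: (@is_derive_itv_ext a' b' _ (fun y => Rintegral (@lebesgue_measure R) `[a', y] g -
    Rintegral (@lebesgue_measure R) `[a', c] g)) => //.
  by move=> y /E.
have ig : (@lebesgue_measure R).-integrable `[a', b'] (EFin \o g).
  exact: integrable_itv cg _ _.
have cx : {for x, continuous g} by apply: cg; apply/andP; split; lra.
have [d1 d2] := continuous_FTC1_closed xb' ig a'x cx.
rewrite -[g x]subr0; apply: is_deriveB.
by rewrite -d2 derive1E; exact: derivableP.
Qed.

End OneVariable.

(** * Functions on a square whose derivatives are uniformly bounded and Lipschitz *)

Section TwoVariables.
Context {R : realType}.
Variables a b : R.
Implicit Types (f g : R -> R -> R) (x y : R).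

Definition bound2 f (M : R) := forall x y, a < x < b -> a < y < b -> `|f x y| <= M.

Definition lipx f (M : R) := forall x x' y, a < x < b -> a < x' < b -> a < y < b ->
  `|f x' y - f x y| <= M * `|x' - x|.

Definition lipy f (M : R) := forall x y y', a < x < b -> a < y < b -> a < y' < b ->
  `|f x y' - f x y| <= M * `|y' - y|.

Definition lip2 f := exists M, [/\ 0 <= M, bound2 f M, lipx f M & lipy f M].

Definition partialx f (fx : R -> R -> R) := forall x y, a < x < b -> a < y < b ->
  is_derive x 1 (f^~ y) (fx x y).

Definition partialy f (fy : R -> R -> R) := forall x y, a < x < b -> a < y < b ->
  is_derive y 1 (f x) (fy x y).

(* Uniform bounds on the open square replace compactness: they make integrals from the
   diagonal differentiable in both variables. *)
Fixpoint CL n f : Prop := lip2 f /\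
  if n is m.+1 then exists fx fy, [/\ CL m fx, CL m fy, partialx f fx & partialy f fy]
  else True.

Definition swap f x y := f y x.

Definition J1 f x y := itg (f^~ y) y x.

Definition J2 f x y := itg (f x) x y.

Lemma CL_lip n f : CL n f -> lip2 f. Proof. by case: n => [|n] []. Qed.

Lemma CLS n f : CL n.+1 f -> CL n f.
Proof.
elim: n f => [|n IH] f [lf [fx [fy [hx hy dx dy]]]]; first by split.
by split => //; exists fx, fy; split => //; exact: IH.
Qed.

Lemma CL_le m n f : (m <= n)%N -> CL n f -> CL m f.
Proof.
elim: n => [|n IH]; first by rewrite leqn0 => /eqP ->.
by rewrite leq_eqVlt => /predU1P[->//|]; rewrite ltnS => mn /CLS; exact: IH.
Qed.

Definition eq2 f g := forall x y, a < x < b -> a < y < b -> f x y = g x y.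

Lemma lip2_ext f g : eq2 f g -> lip2 f -> lip2 g.
Proof.
move=> fg [M [M0 h1 h2 h3]]; exists M; split => //.
- by move=> x y xab yab; rewrite -fg//; exact: h1.
- by move=> x x' y xab xab' yab; rewrite -!fg//; exact: h2.
- by move=> x x' y xab xab' yab; rewrite -!fg//; exact: h3.
Qed.

Lemma CL_ext n f g : eq2 f g -> CL n f -> CL n g.
Proof.
move=> fg; case: n => [|n] [lf h]; first by split => //; exact: lip2_ext lf.
split; first exact: lip2_ext lf.
have [fx [fy [hx hy dx dy]]] := h; exists fx, fy; split => // x y xab yab.
- by apply: (is_derive_itv_ext xab) (dx _ _ xab yab) => t tab; exact: fg.
- by apply: (is_derive_itv_ext yab) (dy _ _ xab yab) => t tab; exact: fg.
Qed.

Lemma lip2_swap f : lip2 f -> lip2 (swap f).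
Proof.
move=> [M [M0 h1 h2 h3]]; exists M; split => //.
- by move=> x y xab yab; exact: h1.
- by move=> x x' y xab xab' yab; exact: h3.
- by move=> x x' y xab xab' yab; exact: h2.
Qed.

Lemma CL_swap n f : CL n f -> CL n (swap f).
Proof.
elim: n f => [|n IH] f [lf h]; first by split => //; exact: lip2_swap.
split; first exact: lip2_swap.
have [fx [fy [hx hy dx dy]]] := h; exists (swap fy), (swap fx).
split; [exact: IH|exact: IH|by move=> x y xab yab; exact: dy|].
by move=> x y xab yab; exact: dx.
Qed.

Lemma partialx_lip f fx M : partialx f fx -> bound2 fx M -> lipx f M.
Proof.
move=> dx Mx x x' y xab xab' yab.
by apply: (mean_value_le (a := a) (b := b) (f := f^~ y) (g := fx^~ y)) => // t tab;
  [exact: dx|exact: Mx].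
Qed.

Lemma partialy_lip f fy M : partialy f fy -> bound2 fy M -> lipy f M.
Proof.
move=> dy My x y y' xab yab yab'.
by apply: (mean_value_le (a := a) (b := b) (f := f x) (g := fy x)) => // t tab;
  [exact: dy|exact: My].
Qed.

(** By the mean value theorem, bounds on the partials are Lipschitz constants for [f]. This is the
    step by which regularity is raised. *)
Lemma CL_partials n f fx fy M : bound2 f M -> partialx f fx -> partialy f fy ->
  CL n fx -> CL n fy -> CL n.+1 f.
Proof.
move=> fM dx dy hx hy; split; last by exists fx, fy.
have [Mx [Mx0 bx _ _]] := CL_lip hx; have [My [My0 bby _ _]] := CL_lip hy.
exists (`|M| + Mx + My); split.
- by rewrite !addr_ge0.
- move=> x y xab yab; apply: (le_trans (fM _ _ xab yab)).
  by have := ler_norm M; lra.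
- move=> x x' y xab xab' yab; apply: (le_trans (partialx_lip dx bx xab xab' yab)).
  by rewrite ler_wpM2r//; have := normr_ge0 M; lra.
- move=> x x' y xab xab' yab; apply: (le_trans (partialy_lip dy bby xab xab' yab)).
  by rewrite ler_wpM2r//; have := normr_ge0 M; lra.
Qed.

Lemma CL_cst n c : CL n (fun _ _ => c).
Proof.
elim: n c => [|n IH] c.
  split => //; exists `|c|; split => //.
    by move=> x x' y _ _ _; rewrite subrr normr0 mulr_ge0.
  by move=> x x' y _ _ _; rewrite subrr normr0 mulr_ge0.
by apply: (@CL_partials n _ (fun _ _ => 0) (fun _ _ => 0) `|c|) => // x y _ _;
  exact: is_derive_cst.
Qed.

Lemma lip2D f g : lip2 f -> lip2 g -> lip2 (fun x y => f x y + g x y).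
Proof.
move=> [M [M0 h1 h2 h3]] [N [N0 k1 k2 k3]]; exists (M + N); split.
- exact: addr_ge0.
- move=> x y xab yab; apply: (le_trans (ler_normD _ _)).
  by apply: lerD; [exact: h1|exact: k1].
- move=> x x' y xab xab' yab; rewrite opprD addrACA mulrDl.
  by apply: (le_trans (ler_normD _ _)); apply: lerD; [exact: h2|exact: k2].
- move=> x x' y xab xab' yab; rewrite opprD addrACA mulrDl.
  by apply: (le_trans (ler_normD _ _)); apply: lerD; [exact: h3|exact: k3].
Qed.

Lemma CLD n f g : CL n f -> CL n g -> CL n (fun x y => f x y + g x y).
Proof.
elim: n f g => [|n IH] f g [lf hf] [lg hg]; split => //; try exact: lip2D.
have [fx [fy [fx1 fy1 fx2 fy2]]] := hf; have [gx [gy [gx1 gy1 gx2 gy2]]] := hg.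
exists (fun x y => fx x y + gx x y), (fun x y => fy x y + gy x y).
split; [exact: IH|exact: IH| |] => x y xab yab.
- exact: is_deriveD (fx2 _ _ xab yab) (gx2 _ _ xab yab).
- exact: is_deriveD (fy2 _ _ xab yab) (gy2 _ _ xab yab).
Qed.

Lemma lip2M f g : lip2 f -> lip2 g -> lip2 (fun x y => f x y * g x y).
Proof.
move=> [M [M0 h1 h2 h3]] [N [N0 k1 k2 k3]].
have key (p p' q q' d : R) : `|p'| <= M -> `|q| <= N -> `|p' - p| <= M * d ->
    `|q' - q| <= N * d -> 0 <= d -> `|p' * q' - p * q| <= (M * N + M * N) * d.
  move=> p1 q1 pp qq d0.
  have -> : p' * q' - p * q = p' * (q' - q) + (p' - p) * q by ring.
  apply: (le_trans (ler_normD _ _)); rewrite !normrM mulrDl; apply: lerD.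
    by rewrite -mulrA; apply: ler_pM.
  by rewrite -mulrA [N * d]mulrC mulrA; apply: ler_pM.
exists (M * N + M * N); split.
- by rewrite addr_ge0 ?mulr_ge0.
- move=> x y xab yab; rewrite normrM -[leLHS]addr0 lerD ?mulr_ge0//.
  by apply: ler_pM => //; [exact: h1|exact: k1].
- by move=> x x' y xab xab' yab; apply: key => //; [exact: h1|exact: k1|exact: h2|exact: k2].
- by move=> x x' y xab xab' yab; apply: key => //; [exact: h1|exact: k1|exact: h3|exact: k3].
Qed.

Lemma CLM n f g : CL n f -> CL n g -> CL n (fun x y => f x y * g x y).
Proof.
elim: n f g => [|n IH] f g hf hg.
  by split => //; apply: lip2M; apply: CL_lip; eassumption.
split; first by apply: lip2M; apply: CL_lip; eassumption.
have [lf [fx [fy [fx1 fy1 fx2 fy2]]]] := hf; have [lg [gx [gy [gx1 gy1 gx2 gy2]]]] := hg.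
exists (fun x y => f x y * gx x y + g x y * fx x y),
  (fun x y => f x y * gy x y + g x y * fy x y).
split.
- by apply: CLD; apply: IH => //; exact: CLS.
- by apply: CLD; apply: IH => //; exact: CLS.
- by move=> x y xab yab; exact: is_deriveM (fx2 _ _ xab yab) (gx2 _ _ xab yab).
- by move=> x y xab yab; exact: is_deriveM (fy2 _ _ xab yab) (gy2 _ _ xab yab).
Qed.

Lemma CLZ n c f : CL n f -> CL n (fun x y => c * f x y).
Proof. by move=> hf; apply: CLM => //; exact: CL_cst. Qed.

Lemma CLN n f : CL n f -> CL n (fun x y => - f x y).
Proof. by move=> /(CLZ (-1)); apply: CL_ext => x y _ _; rewrite mulN1r. Qed.

Lemma CLB n f g : CL n f -> CL n g -> CL n (fun x y => f x y - g x y).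
Proof. by move=> hf hg; apply: CLD => //; exact: CLN. Qed.

(** The margin 1 places [p] and [q] inside an open interval, where the mean value bound applies. *)
Lemma expR_mean (M p q : R) : `|p| <= M -> `|q| <= M ->
  `|expR p - expR q| <= expR (M + 1) * `|p - q|.
Proof.
move=> + + ; rewrite ler_norml => /andP[? ?]; rewrite ler_norml => /andP[? ?].
have hp : - (M + 1) < p < M + 1 by apply/andP; split; lra.
have hq : - (M + 1) < q < M + 1 by apply/andP; split; lra.
apply: (mean_value_le _ _ hq hp) => t /andP[_ ?].
by rewrite ger0_norm ?expR_ge0// ler_expR ltW.
Qed.

Lemma is_derive_comp_expR (h : R -> R) x d : is_derive x 1 h d ->
  is_derive x 1 (fun t => expR (h t)) (expR (h x) * d).
Proof. by move=> hd; exact: (@is_derive1_comp R expR h x (expR (h x)) d). Qed.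

Lemma CL_expR n f : CL n f -> CL n (fun x y => expR (f x y)).
Proof.
have h0 g : lip2 g -> lip2 (fun x y => expR (g x y)).
  move=> [M [M0 h1 h2 h3]]; have E0 := expR_ge0 (M + 1).
  exists (expR (M + 1) + expR (M + 1) * M).
  have EM : 0 <= expR (M + 1) * M by exact: mulr_ge0.
  split.
  - exact: addr_ge0.
  - move=> x y xab yab; rewrite ger0_norm ?expR_ge0//.
    apply: (@le_trans _ _ (expR (M + 1))); last by lra.
    rewrite ler_expR; apply: (le_trans (ler_norm _)).
    by apply: (le_trans (h1 _ _ xab yab)); lra.
  - move=> x x' y xab xab' yab; apply: (le_trans (expR_mean (h1 _ _ _ _) (h1 _ _ _ _))) => //.
    apply: (@le_trans _ _ (expR (M + 1) * M * `|x' - x|)); last by rewrite ler_wpM2r//; lra.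
    by rewrite -mulrA ler_wpM2l//; exact: h2.
  - move=> x y y' xab yab yab'; apply: (le_trans (expR_mean (h1 _ _ _ _) (h1 _ _ _ _))) => //.
    apply: (@le_trans _ _ (expR (M + 1) * M * `|y' - y|)); last by rewrite ler_wpM2r//; lra.
    by rewrite -mulrA ler_wpM2l//; exact: h3.
elim: n f => [|n IH] f hf; first by split => //; exact: h0 (CL_lip hf).
split; first exact: h0 (CL_lip hf).
have [lf [fx [fy [fx1 fy1 fx2 fy2]]]] := hf.
exists (fun x y => expR (f x y) * fx x y), (fun x y => expR (f x y) * fy x y).
split; [by apply: CLM => //; exact: IH (CLS hf)..| |] => x y xab yab.
- exact: is_derive_comp_expR (fx2 _ _ xab yab).
- exact: is_derive_comp_expR (fy2 _ _ xab yab).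
Qed.

Lemma lip2_diag f : lip2 f -> lip2 (fun x y => f y y).
Proof.
move=> [M [M0 h1 h2 h3]]; exists (M + M); split.
- exact: addr_ge0.
- by move=> x y xab yab; apply: (le_trans (h1 _ _ yab yab)); lra.
- by move=> x x' y _ _ _; rewrite subrr normr0 mulr_ge0// addr_ge0.
- move=> x y y' xab yab yab'.
  have -> : f y' y' - f y y = (f y' y' - f y y') + (f y y' - f y y) by ring.
  rewrite mulrDl; apply: (le_trans (ler_normD _ _)).
  by apply: lerD; [exact: h2|exact: h3].
Qed.

(** The increment is split into a step in [x] at height [t] and a step in [y]; the Lipschitz bound
    of [fx] in [y] brings the first derivative back to height [y]. This stands in for joint
    differentiability. *)
Lemma is_derive_diag f fx fy y : partialx f fx -> partialy f fy -> lip2 fx -> lip2 fy ->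
  a < y < b -> is_derive y 1 (fun t => f t t) (fx y y + fy y y).
Proof.
move=> dx dy [M [M0 h1 h2 h3]] [N [N0 k1 k2 k3]] yab.
apply: (@is_derive_quadratic _ a b _ _ (M + M + N)) => // t tab.
have -> : f t t - f y y - (t - y) * (fx y y + fy y y) =
  (f t t - f y t - (t - y) * fx y t) + (t - y) * (fx y t - fx y y)
  + (f y t - f y y - (t - y) * fy y y) by ring.
rewrite [(M + M + N) * _]mulrDl [(M + M) * _]mulrDl.
apply: (le_trans (ler_normD _ _)); apply: lerD.
  apply: (le_trans (ler_normD _ _)); apply: lerD.
    apply: (quadratic_remainder (f := f^~ t) (g := fx^~ t) (a := a) (b := b)) => //.
      by move=> s sab; exact: dx.
    by move=> s s' sab sab'; exact: h2.
  rewrite normrM -[_ ^+ 2]real_normK ?num_real// expr2 mulrC mulrA.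
  by rewrite ler_wpM2r//; exact: h3.
apply: (quadratic_remainder (f := f y) (g := fy y) (a := a) (b := b)) => //.
  by move=> s sab; exact: dy.
by move=> s s' sab sab'; exact: k3.
Qed.

Lemma CL_diag n f : CL n f -> CL n (fun x y => f y y).
Proof.
elim: n f => [|n IH] f [lf h]; first by split => //; exact: lip2_diag.
split; first exact: lip2_diag.
have [fx [fy [fx1 fy1 fx2 fy2]]] := h.
exists (fun _ _ => 0), (fun x y => fx y y + fy y y); split.
- exact: CL_cst.
- by apply: CLD; exact: IH.
- by move=> x y _ _; exact: is_derive_cst.
- by move=> x y _ yab; apply: is_derive_diag => //; [exact: CL_lip fx1|exact: CL_lip fy1].
Qed.

Lemma lipschitz_continuous (h : R -> R) M x :
  (forall s t, a < s < b -> a < t < b -> `|h t - h s| <= M * `|t - s|) ->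
  a < x < b -> {for x, continuous h}.
Proof.
move=> hM xab; apply/cvgrPdist_le => e e0.
have M0 : 0 < `|M| + 1 by apply: ltr_wpDl.
have d0 : 0 < e / (`|M| + 1) by rewrite divr_gt0.
have : \forall t \near x, a < t < b by apply: (near_itv xab).
move=> h1; near=> t.
have tab : a < t < b by near: t.
apply: le_trans (_ : M * `|x - t| <= _); first exact: hM.
apply: le_trans (_ : (`|M| + 1) * `|x - t| <= _).
  by rewrite ler_wpM2r//; apply: (le_trans (ler_norm _)); lra.
rewrite mulrC -ler_pdivlMr//.
Unshelve. all: by end_near. Qed.

Lemma lip2_contx f x y : lip2 f -> a < x < b -> a < y < b -> {for x, continuous (f^~ y)}.
Proof.
move=> [M [_ _ h _]] xab yab; apply: (@lipschitz_continuous _ M) => // s t sab tab.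
exact: h.
Qed.

Lemma partialx_J1 f : lip2 f -> partialx (J1 f) f.
Proof.
move=> lf x y xab yab; apply: (@is_derive_itg _ a b (f^~ y)) => // t tab.
exact: lip2_contx.
Qed.

Lemma J1_diag f x : J1 f x x = 0. Proof. exact: itg_id. Qed.

Lemma J1_bound f M : lip2 f -> 0 <= M -> bound2 f M -> bound2 (J1 f) (M * (b - a)).
Proof.
move=> lf M0 fM x y xab yab; rewrite -[J1 f x y]subr0 -(J1_diag f y).
apply: le_trans (_ : M * `|x - y| <= _).
  apply: (mean_value_le (a := a) (b := b) (f := (J1 f)^~ y) (g := f^~ y)) => // t tab.
    exact: partialx_J1.
  exact: fM.
rewrite ler_wpM2l// ler_norml.
by move/andP: xab => [? ?]; move/andP: yab => [? ?]; apply/andP; split; lra.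
Qed.

Lemma itg_diff (g h : R -> R) (e : R) y x :
  (forall t, a < t < b -> {for t, continuous g}) ->
  (forall t, a < t < b -> {for t, continuous h}) ->
  (forall t, a < t < b -> `|g t - h t| <= e) -> a < x < b -> a < y < b ->
  `|itg g y x - itg h y x| <= e * `|x - y|.
Proof.
move=> cg ch gh xab yab.
have := @mean_value_le R a b (fun t => itg g y t - itg h y t) (fun t => g t - h t) e y x.
rewrite !itg_id subrr subr0; apply => // t tab.
by apply: is_deriveB; [exact: (is_derive_itg cg)|exact: (is_derive_itg ch)].
Qed.

Lemma itg_base (g : R -> R) y y' x : (forall t, a < t < b -> {for t, continuous g}) ->
  a < x < b -> a < y < b -> a < y' < b -> itg g y' x = itg g y x - itg g y y'.
Proof.
move=> cg xab yab yab'.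
have : itg g y x - itg g y' x = itg g y y' - itg g y' y'.
  apply: (@derive0_const R a b (fun t => itg g y t - itg g y' t)) => // t tab.
  rewrite -[0](subrr (g t)).
  by apply: is_deriveB; exact: (is_derive_itg cg).
rewrite itg_id; lra.
Qed.

Lemma dist_itv x y : a < x < b -> a < y < b -> `|x - y| <= b - a.
Proof.
move=> /andP[? ?] /andP[? ?]; rewrite ler_norml.
by apply/andP; split; lra.
Qed.

(** Moving [y] changes the integrand, at a cost [L * (b - a)], and the base point of the integral,
    at a cost [M]. *)
Lemma J1_lipy f M L : lip2 f -> 0 <= L -> bound2 f M -> lipy f L ->
  lipy (J1 f) (L * (b - a) + M).
Proof.
move=> lf L0 fM fL x y y' xab yab yab'.
have cf z : a < z < b -> forall t, a < t < b -> {for t, continuous (f^~ z)}.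
  by move=> zab t tab; exact: lip2_contx.
rewrite /J1 (@itg_base _ y y' x (cf _ yab'))//.
have -> (p q r : R) : p - q - r = (p - r) - q by ring.
rewrite mulrDl; apply: (le_trans (ler_normB _ _)); apply: lerD.
  apply: (@le_trans _ _ (L * `|y' - y| * `|x - y|)).
    apply: itg_diff => //; [exact: cf|exact: cf|].
    by move=> t tab; exact: fL.
  by rewrite mulrAC ler_wpM2r// ler_wpM2l// dist_itv.
have := @itg_diff (f^~ y') (cst 0) M y y' (cf _ yab').
have -> : itg (cst 0) y y' = 0 :> R.
  have := @derive0_const R a b (itg (cst 0) y) y y'; rewrite itg_id; apply => // t tab.
  by apply: (@is_derive_itg _ a b (cst 0)) => // ? _; exact: cst_continuous.
rewrite subr0; apply => //; first by move=> ? _; exact: cst_continuous.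
by move=> t tab; rewrite subr0; exact: fM.
Qed.

Lemma J1_lip2 f : lip2 f -> lip2 (J1 f).
Proof.
move=> lf; have [M [M0 h1 h2 h3]] := lf.
have [ab|ba] := ltP a b; last first.
  by exists 0; split => // x *; exfalso; lra.
have hab : 0 <= M * (b - a) by rewrite mulr_ge0// subr_ge0 ltW.
exists (M * (b - a) + M); split.
- exact: addr_ge0.
- move=> x y xab yab; apply: (le_trans (J1_bound lf M0 h1 xab yab)); lra.
- move=> x x' y xab xab' yab.
  apply: (le_trans (partialx_lip (partialx_J1 lf) h1 xab xab' yab)).
  by rewrite ler_wpM2r//; lra.
- exact: J1_lipy.
Qed.

(** Leibniz rule with a moving lower limit. The remainder has three quadratic parts: that of the
    integrand, integrated over a length at most [b - a]; that of the short integral from [y] to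
    [y']; and the change of height in the value of [f] at [y]. *)
Lemma partialy_J1 f fy : partialy f fy -> lip2 f -> lip2 fy ->
  partialy (J1 f) (fun x y => - f y y + J1 fy x y).
Proof.
move=> dy lf lfy x y xab yab.
have [M [M0 h1 h2 h3]] := lf; have [N [N0 k1 k2 k3]] := lfy.
have cf z : a < z < b -> forall t, a < t < b -> {for t, continuous (f^~ z)}.
  by move=> zab t tab; exact: lip2_contx.
have cfy t : a < t < b -> {for t, continuous (fy^~ y)}.
  by move=> tab; exact: lip2_contx.
apply: (@is_derive_quadratic _ a b _ _ (N * (b - a) + (M + M))) => // y' yab'.
rewrite /J1 (@itg_base _ y y' x (cf _ yab'))//.
have -> (p q r u v h : R) : p - q - r - h * (- u + v) =
  (p - r - h * v) - (q - h * f y y') - h * (f y y' - u) by ring.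
have yy : `|y' - y| * `|y' - y| = (y' - y) ^+ 2.
  by rewrite -expr2 real_normK ?num_real.
rewrite [(N * (b - a) + (M + M)) * _]mulrDl [(M + M) * _]mulrDl addrA.
apply: (le_trans (ler_normB _ _)); apply: lerD; last first.
  by rewrite normrM -yy mulrA [in leRHS]mulrC; apply: ler_wpM2l => //; exact: h3.
apply: (le_trans (ler_normB _ _)); apply: lerD.
  apply: (@le_trans _ _ (N * (y' - y) ^+ 2 * `|x - y|)); last first.
    by rewrite mulrAC ler_wpM2r ?sqr_ge0// ler_wpM2l// dist_itv.
  have := @mean_value_le R a b
    (fun t => itg (f^~ y') y t - itg (f^~ y) y t - (y' - y) * itg (fy^~ y) y t)
    (fun t => f t y' - f t y - (y' - y) * fy t y) (N * (y' - y) ^+ 2) y x.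
  rewrite !itg_id mulr0 !subr0; apply => // t tab.
    apply: is_deriveB; last first.
      by apply: (@is_deriveZ _ _ _ _ (y' - y)); exact: (is_derive_itg cfy).
    by apply: is_deriveB; apply: (@is_derive_itg _ a b) => //; exact: cf.
  apply: (quadratic_remainder (f := f t) (g := fy t) (a := a) (b := b)) => //.
    by move=> s sab; exact: dy.
  by move=> s s' sab sab'; exact: k3.
have := @quadratic_remainder R a b (itg (f^~ y') y) (f^~ y') M y y'.
rewrite itg_id subr0; apply => //.
  by move=> t tab; apply: (@is_derive_itg _ a b) => //; exact: cf.
by move=> s t sab tab; exact: h2.
Qed.

(** The partials of [J1 f] are [f] itself and a diagonal value plus an integral of the same kind, so
    the class is closed and solutions of integral equations can be bootstrapped. *)
Lemma CL_J1 n f : CL n f -> CL n (J1 f).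
Proof.
elim: n f => [|n IH] f [lf h]; first by split => //; exact: J1_lip2.
split; first exact: J1_lip2.
have [fx [fy [fx1 fy1 fx2 fy2]]] := h.
exists f, (fun x y => - f y y + J1 fy x y); split.
- exact: CLS.
- by apply: CLD; [apply/CLN/CL_diag/CLS|exact: IH].
- exact: partialx_J1.
- by apply: partialy_J1 => //; exact: CL_lip fy1.
Qed.

Lemma J2E f : J2 f = swap (J1 (swap f)). Proof. by []. Qed.

Lemma partialy_J2 f : lip2 f -> partialy (J2 f) f.
Proof. by move=> lf x y xab yab; exact: (partialx_J1 (lip2_swap lf)). Qed.

Lemma partialx_J2 f fx : partialx f fx -> lip2 f -> lip2 fx ->
  partialx (J2 f) (fun x y => - f x x + J2 fx x y).
Proof.
move=> dx lf lfx x y xab yab.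
apply: (@partialy_J1 (swap f) (swap fx)) => //; [|exact: lip2_swap..].
by move=> s t sab tab; exact: dx.
Qed.

Lemma CL_J2 n f : CL n f -> CL n (J2 f).
Proof. by move=> h; rewrite J2E; apply/CL_swap/CL_J1/CL_swap. Qed.

Lemma J2_diag f x : J2 f x x = 0. Proof. exact: itg_id. Qed.

End TwoVariables.

(** * Series dominated by a geometric series, and coefficient sequences of entire functions *)

Section RapidSeries.
Context {R : realType}.
Implicit Types (a c : nat -> R) (C : R).

Definition tsum a : R := limn (series a).

(** One fixed ratio is enough for convergence: the bounds at all radii in [fast] are used here at
    radius 2. *)
Definition halving C a := forall n, `|a n| <= C * 2^-1 ^+ n.

Lemma half_lt1 : `|2^-1 : R| < 1. Proof. by rewrite ger0_norm; lra. Qed.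

Lemma halving_cvg_norm C a : halving C a -> cvgn [normed series a].
Proof.
move=> aC; apply: (@series_le_cvg R _ (fun n => C * 2^-1 ^+ n)) => //.
- by move=> n /=.
- by move=> n; exact: le_trans (normr_ge0 _) (aC n).
- exact: (@is_cvg_geometric_series R C 2^-1 half_lt1).
Qed.

Lemma halving_cvg C a : halving C a -> cvgn (series a).
Proof. by move=> /halving_cvg_norm/normed_cvg. Qed.

Lemma tsum_bound C a : halving C a -> `|tsum a| <= 2 * C.
Proof.
move=> aC; apply: (le_trans (lim_series_norm (halving_cvg_norm aC))).
have -> : 2 * C = limn (series (geometric C 2^-1)).
  have /cvg_lim -> := @cvg_geometric_series R C 2^-1 half_lt1 => //.
  by field.
apply: lim_series_le => //; first exact: halving_cvg_norm aC.
exact: (@is_cvg_geometric_series R C 2^-1 half_lt1).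
Qed.

Lemma tsumD C C' a c : halving C a -> halving C' c ->
  tsum (fun n => a n + c n) = tsum a + tsum c.
Proof. by move=> /halving_cvg ha /halving_cvg hc; rewrite /tsum -lim_seriesD. Qed.

Lemma tsumZ C k a : halving C a -> tsum (fun n => k * a n) = k * tsum a.
Proof. by move=> /halving_cvg ha; rewrite /tsum -[RHS]lim_seriesZ. Qed.

Lemma tsumB C C' a c : halving C a -> halving C' c ->
  tsum (fun n => a n - c n) = tsum a - tsum c.
Proof. by move=> /halving_cvg ha /halving_cvg hc; rewrite /tsum -lim_seriesB. Qed.

Lemma tsumS C a : halving C a -> tsum a = a 0%N + tsum (fun n => a n.+1).
Proof.
move=> ha; have hS : halving (C / 2) (fun n => a n.+1).
  by move=> n; have := ha n.+1; rewrite exprS mulrA.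
have /cvgP/= := halving_cvg hS; rewrite /tsum => cS.
have : series a \o S @ \oo --> a 0%N + limn (series (fun n => a n.+1)).
  rewrite (_ : _ \o _ = (fun n => a 0%N + series (fun n => a n.+1) n)).
    by apply: cvgD; [exact: cvg_cst|exact: halving_cvg hS].
  by apply/funext => n /=; rewrite seriesEnat/= big_nat_recl.
by move=> h; apply/cvg_lim => //; rewrite -cvg_shiftS.
Qed.

Lemma tsum0 : tsum (fun=> 0) = 0.
Proof.
rewrite /tsum (_ : series _ = cst 0) ?lim_cst//.
by apply/funext => n; rewrite seriesEnat/= big1.
Qed.

(** The distance to the limit is the sum of the increments from rank [k] on, again dominated with
    ratio one half. *)
Lemma limn_geometric_close (v : nat -> R) C :
  (forall k, `|v k.+1 - v k| <= C * 2^-1 ^+ k) ->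
  forall k, `|limn v - v k| <= 2 * (C * 2^-1 ^+ k).
Proof.
move=> vC k; pose w j := v (j + k)%N.
have hw : halving (C * 2^-1 ^+ k) (telescope w).
  move=> j; rewrite /telescope/= /w addSn; apply: le_trans (vC _) _.
  by rewrite exprD mulrCA [in leRHS]mulrC.
have wE : w = fun n => series (telescope w) n + w 0%N.
  by apply/funext => n; rewrite telescopeK/= subrK.
have cw : w @ \oo --> tsum (telescope w) + w 0%N.
  rewrite {1}wE; apply: cvgD; last exact: cvg_cst.
  exact: halving_cvg hw.
have -> : limn v = tsum (telescope w) + w 0%N.
  by apply/cvg_lim => //; rewrite -(cvg_shiftn k).
by rewrite addrK; exact: tsum_bound.
Qed.

Lemma le_limn_geometric (v : nat -> R) C M :
  (forall k, `|v k.+1 - v k| <= C * 2^-1 ^+ k) -> (forall k, `|v k| <= M) ->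
  `|limn v| <= M.
Proof.
move=> vC vM; apply/ler_addgt0Pr => e e0.
have : \forall k \near \oo, 2 * C * 2^-1 ^+ k <= e.
  have := @cvg_geometric R (2 * C) 2^-1 half_lt1.
  move=> /cvgrPdist_le/(_ e e0); apply: filterS => k.
  by rewrite sub0r normrN; apply: le_trans; exact: ler_norm.
move=> [k _ /(_ k (leqnn k)) h].
have -> : limn v = v k + (limn v - v k) by ring.
apply: (le_trans (ler_normD _ _)); apply: lerD => //.
by apply: (le_trans (limn_geometric_close vC k)); rewrite mulrA.
Qed.

(** The remainders are summed: constants [C / 2^n] for the terms give the constant [2 * C] for the
    sum, and this is a derivative by [is_derive_quadratic]. *)
Lemma is_derive_tsum (p q x C : R) (f : nat -> R -> R) (g : nat -> R) D E :
  p < x < q -> (forall y, p < y < q -> halving D (f^~ y)) -> halving E g ->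
  (forall n y, p < y < q ->
    `|f n y - f n x - (y - x) * g n| <= C * 2^-1 ^+ n * (y - x) ^+ 2) ->
  is_derive x 1 (fun y => tsum (f^~ y)) (tsum g).
Proof.
move=> xpq fD gE h; apply: (@is_derive_quadratic _ p q _ _ (2 * C)) => // y ypq.
have hyx : halving (D + D) (fun n => f n y - f n x).
  by move=> n; apply: (le_trans (ler_normB _ _)); rewrite mulrDl lerD// fD.
have hg : halving (`|y - x| * E) (fun n => (y - x) * g n).
  by move=> n; rewrite normrM -mulrA ler_wpM2l.
rewrite -(tsumB (fD _ ypq) (fD _ xpq)) -(tsumZ _ gE) -(tsumB hyx hg) -mulrA.
by apply: tsum_bound => n; rewrite mulrAC; exact: h.
Qed.

(* The coefficient sequences of entire functions. *)
Definition fast a := forall r, 0 <= r -> exists C, forall n, `|a n| * r ^+ n <= C.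

Lemma fast_halving a : fast a -> exists C, halving C a.
Proof.
move=> /(_ 2 ltac:(lra))[C h]; exists C => n.
by rewrite exprVn ler_pdivlMr ?exprn_gt0.
Qed.

Lemma fast_le a c : fast a -> (forall n, `|c n| <= `|a n|) -> fast c.
Proof.
move=> fa ca r r0; have [C h] := fa r r0; exists C => n.
by apply: le_trans (h n); rewrite ler_wpM2r// exprn_ge0.
Qed.

Lemma fastD a c : fast a -> fast c -> fast (fun n => a n + c n).
Proof.
move=> fa fc r r0; have [C h] := fa r r0; have [D k] := fc r r0; exists (C + D) => n.
apply: le_trans (lerD (h n) (k n)); rewrite -mulrDl ler_wpM2r ?exprn_ge0//.
exact: ler_normD.
Qed.

Lemma fastZ k a : fast a -> fast (fun n => k * a n).
Proof.
move=> fa r r0; have [C h] := fa r r0; exists (`|k| * C) => n.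
by rewrite normrM -mulrA ler_wpM2l.
Qed.

Lemma fast_geometric a z : fast a -> fast (fun n => a n * z ^+ n).
Proof.
move=> fa r r0; have [C h] := fa (`|z| * r) (mulr_ge0 (normr_ge0 _) r0); exists C => n.
by rewrite normrM normrX -mulrA -exprMn.
Qed.

(** The factor [n] is absorbed by [n <= 2^n], that is, by doubling the radius. *)
Lemma fast_natr a : fast a -> fast (fun n => n%:R * a n).
Proof.
move=> fa; apply: (@fast_le (fun n => a n * 2 ^+ n)); first exact: fast_geometric.
move=> n; rewrite !normrM mulrC ler_wpM2l// normr_nat ger0_norm ?exprn_ge0//.
by rewrite -natrX ler_nat ltnW// ltn_expl.
Qed.

Lemma fastS a : fast a -> fast (fun n => a n.+1).
Proof.
move=> fa r r0; have [C h] := fa (r + 1) (addr_ge0 r0 ler01); exists C => n.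
apply: le_trans (h n.+1); rewrite ler_wpM2l//.
apply: (@le_trans _ _ ((r + 1) ^+ n)); first by rewrite lerXn2r ?nnegrE; lra.
by rewrite exprS ler_peMl ?exprn_ge0; lra.
Qed.

Lemma fast_pred a : fast a -> fast (fun n => a n.-1).
Proof.
move=> fa r r0; have [C h] := fa r r0; exists (`|a 0%N| + r * C) => n.
have C0 : 0 <= C by apply: le_trans (h 0%N); rewrite mulr_ge0// exprn_ge0.
case: n => [|n]/=; first by rewrite expr0 mulr1 lerDl mulr_ge0.
rewrite exprS mulrCA -[leLHS]add0r lerD// ler_wpM2l//.
Qed.

Lemma fast_exp z : fast (fun n => z ^+ n / n`!%:R).
Proof.
move=> r r0.
have [M [Mr h]] := cvg_series_bounded (@is_cvg_series_exp_coeff R (z * r)).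
exists (M + 1) => n; have := h (M + 1) ltac:(by rewrite ltrDl) n I.
rewrite /exp_coeff/= => h'; apply: le_trans h'.
by rewrite exprMn !normrM [`|r ^+ n|]ger0_norm ?exprn_ge0// mulrAC.
Qed.

End RapidSeries.

Lemma le_halving {R : realType} (p C : R) : 0 <= C ->
  (forall k, p <= C * 2^-1 ^+ k) -> p <= 0.
Proof.
move=> C0 h; apply/ler_addgt0Pr => e e0; rewrite add0r.
have := @cvg_geometric R C 2^-1 half_lt1.
move=> /cvgrPdist_le/(_ e e0)[k _ /(_ k (leqnn k))].
rewrite sub0r normrN/= => h'; apply: le_trans h'.
by apply: le_trans (h k) _; exact: ler_norm.
Qed.

(** * The sinh-Gordon problem with data on the diagonal, solved by contraction *)

Section SinhGordon.
Context {R : realType}.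
Variables s0 b1 b2 g1 g2 : R -> R.
Implicit Types (u v : R -> R -> R).

Definition sg_rhs u x y := b2 x * g1 y * expR (u x y) - b1 x * g2 y * expR (- u x y).

(** For a solution this is [u_x / 2], the coefficient of [e3] in the frame. Integrating from the
    diagonal builds in [u_x = 2 s0] there, and the second integration in [sg_step] builds in
    [u = 0]. *)
Definition sg_velocity u x y := s0 x + J2 (sg_rhs u) x y.

Definition sg_step u x y := 2 * J1 (sg_velocity u) x y.

Definition sg_iter k : R -> R -> R := iter k sg_step (fun _ _ => 0).

Lemma sg_iterS k : sg_iter k.+1 = sg_step (sg_iter k). Proof. by []. Qed.

(* [u_xy = 2 (b2 g1 e^u - b1 g2 e^-u)] with [u = 0] and [u_x = 2 s0] on the diagonal. *)
Definition sg_sol x y : R := limn (fun k => sg_iter k x y).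

Section Square.
Variables (a b M : R).

Definition smooth_data (f : R -> R) := forall n, CL a b n (fun x y => f x).

Hypotheses (ds0 : smooth_data s0) (db1 : smooth_data b1) (db2 : smooth_data b2)
  (dg1 : smooth_data g1) (dg2 : smooth_data g2).

Definition bound1 (f : R -> R) := forall x, a < x < b -> `|f x| <= M.

Hypotheses (M0 : 0 <= M) (bs0 : bound1 s0) (bb1 : bound1 b1) (bb2 : bound1 b2)
  (bg1 : bound1 g1) (bg2 : bound1 g2).

(** A bound for the right-hand side when [|u| <= 1], and also its Lipschitz constant in [u]: the
    exponent 2 is the one that [expR_mean] gives on [[-1, 1]]. *)
Let H := 2 * (M * M * expR 2).

(** The last inequality keeps the iterates in the ball [|u| <= 1] and, with sides at most 1, makes
    the step contract by one half. *)
Hypotheses (ab : a < b) (ab1 : b - a <= 1) (small : 4 * (b - a) * (M + H) <= 1).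

Let H0 : 0 <= H. Proof. by rewrite !mulr_ge0// expR_ge0. Qed.

Lemma sg_rhs_CL n u : CL a b n u -> CL a b n (sg_rhs u).
Proof.
move=> hu; have swap_data f : smooth_data f -> CL a b n (fun x y => f y).
  by move=> df; exact: CL_swap (df n).
by apply: CLB; (apply: CLM; [apply: CLM; [exact: db2 || exact: db1|exact: swap_data]
  |apply: CL_expR => //; exact: CLN]).
Qed.

Lemma sg_velocity_CL n u : CL a b n u -> CL a b n (sg_velocity u).
Proof. by move=> hu; apply: CLD; [exact: ds0|apply/CL_J2/sg_rhs_CL]. Qed.

Lemma sg_step_CL n u : CL a b n u -> CL a b n (sg_step u).
Proof. by move=> hu; apply: CLZ; apply/CL_J1/sg_velocity_CL. Qed.

Lemma sg_rhs_bound u : bound2 a b u 1 -> bound2 a b (sg_rhs u) H.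
Proof.
move=> hu x y xab yab; have := hu _ _ xab yab; rewrite ler_norml => /andP[? ?].
have key (p q v : R) : `|p| <= M -> `|q| <= M -> v <= 1 -> `|p * q * expR v| <= M * M * expR 2.
  move=> pM qM v1; rewrite !normrM (ger0_norm (expR_ge0 _)).
  by rewrite ler_pM ?ler_pM// ler_expR; lra.
rewrite /H mulr_natl mulr2n; apply: (le_trans (ler_normB _ _)); apply: lerD.
  by apply: key; [exact: bb2|exact: bg1|].
by apply: key; [exact: bb1|exact: bg2|lra].
Qed.

Lemma sg_rhs_contract u v (d : R) x y : bound2 a b u 1 -> bound2 a b v 1 ->
  a < x < b -> a < y < b -> `|u x y - v x y| <= d ->
  `|sg_rhs u x y - sg_rhs v x y| <= H * d.
Proof.
move=> hu hv xab yab uv.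
have key (p q w z : R) : `|p| <= M -> `|q| <= M -> `|w| <= 1 -> `|z| <= 1 -> `|w - z| <= d ->
    `|p * q * expR w - p * q * expR z| <= M * M * expR 2 * d.
  move=> pM qM w1 z1 wz; rewrite -mulrBr !normrM -[_ * expR 2 * d]mulrA ler_pM ?ler_pM//.
  apply: (le_trans (expR_mean w1 z1)).
  by rewrite (_ : 1 + 1 = 2 :> R)// ler_wpM2l ?expR_ge0.
rewrite /H mulr_natl mulr2n mulrDl /sg_rhs.
have -> (p q r s : R) : p - q - (r - s) = (p - r) - (q - s) by ring.
apply: (le_trans (ler_normB _ _)); apply: lerD.
  by apply: key; [exact: bb2|exact: bg1|exact: hu|exact: hv|].
apply: key; [exact: bb1|exact: bg2|by rewrite normrN hu|by rewrite normrN hv|].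
by rewrite -opprD normrN.
Qed.

Lemma CL0_lip u : lip2 a b u -> CL a b 0 u. Proof. by split. Qed.

Lemma sg_rhs_lip u : lip2 a b u -> lip2 a b (sg_rhs u).
Proof. by move=> /CL0_lip/sg_rhs_CL[]. Qed.

Lemma sg_velocity_lip u : lip2 a b u -> lip2 a b (sg_velocity u).
Proof. by move=> /CL0_lip/sg_velocity_CL[]. Qed.

Lemma sg_velocity_bound u : lip2 a b u -> bound2 a b u 1 ->
  bound2 a b (sg_velocity u) (M + H).
Proof.
move=> lu hu x y xab yab; apply: (le_trans (ler_normD _ _)); apply: lerD; first exact: bs0.
have hs : bound2 a b (swap (sg_rhs u)) H by move=> s t sab tab; exact: sg_rhs_bound.
have := J1_bound (lip2_swap (sg_rhs_lip lu)) H0 hs yab xab.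
by move=> h; apply: (le_trans h); rewrite ler_piMr.
Qed.

Lemma sg_step_bound u : lip2 a b u -> bound2 a b u 1 -> bound2 a b (sg_step u) 1.
Proof.
move=> lu hu x y xab yab; rewrite normrM ger0_norm//.
have MH : 0 <= M + H by exact: addr_ge0.
have := J1_bound (sg_velocity_lip lu) MH (sg_velocity_bound lu hu) xab yab.
move=> h; apply: (@le_trans _ _ (2 * ((M + H) * (b - a)))); first by rewrite ler_wpM2l.
apply: (le_trans _ small).
have : 0 <= (M + H) * (b - a) by rewrite mulr_ge0// subr_ge0 ltW.
by move: H => H'; lra.
Qed.

Lemma sg_step_lipx u : lip2 a b u -> bound2 a b u 1 ->
  lipx a b (sg_step u) (2 * (M + H)).
Proof.
move=> lu hu; apply: (@partialx_lip _ _ _ _ (fun x y => 2 * sg_velocity u x y)).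
  move=> x y xab yab; apply: (@is_deriveZ _ _ _ _ 2).
  exact: partialx_J1 (sg_velocity_lip lu) _ _ xab yab.
by move=> x y xab yab; rewrite normrM ger0_norm// ler_wpM2l//; exact: sg_velocity_bound.
Qed.

Lemma partialy_sg_velocity u : lip2 a b u ->
  partialy a b (sg_velocity u) (sg_rhs u).
Proof.
move=> lu x y xab yab; rewrite -[sg_rhs u x y]add0r.
have dJ := partialy_J2 (sg_rhs_lip lu) xab yab.
exact: (@is_deriveD _ _ _ (cst (s0 x)) (J2 (sg_rhs u) x)).
Qed.

Lemma sg_step_lipy u : lip2 a b u -> bound2 a b u 1 ->
  lipy a b (sg_step u) (2 * (H * (b - a) + (M + H))).
Proof.
move=> lu hu x y y' xab yab yab'; rewrite -mulrBr normrM ger0_norm// -mulrA ler_wpM2l//.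
apply: (J1_lipy (sg_velocity_lip lu) H0) => //; first exact: sg_velocity_bound.
exact: (partialy_lip (partialy_sg_velocity lu)) (sg_rhs_bound hu).
Qed.

(** The inner integral runs over a length at most 1 and keeps the factor [H]; the outer one gains
    [b - a]. Since [H * (b - a) <= 1 / 4], the factor 2 of the step leaves one half. *)
Lemma sg_step_contract u v (d : R) : lip2 a b u -> lip2 a b v ->
  bound2 a b u 1 -> bound2 a b v 1 -> 0 <= d ->
  bound2 a b (fun x y => u x y - v x y) d ->
  bound2 a b (fun x y => sg_step u x y - sg_step v x y) (d / 2).
Proof.
move=> lu lv hu hv d0 uv x y xab yab; rewrite -mulrBr normrM ger0_norm//.
have cx w z : lip2 a b w -> a < z < b -> forall t, a < t < b -> {for t, continuous (w^~ z)}.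
  by move=> lw zab t tab; exact: (lip2_contx lw tab zab).
have Hd : 0 <= H * d by exact: mulr_ge0.
have vel s t : a < s < b -> a < t < b ->
    `|sg_velocity u s t - sg_velocity v s t| <= H * d.
  move=> sab tab; rewrite opprD addrACA subrr add0r.
  apply: (@le_trans _ _ (H * d * `|t - s|)); last first.
    by rewrite ler_piMr//; apply: le_trans (dist_itv _ _) ab1.
  apply: (@itg_diff _ a b) => //.
  - by apply: (cx (swap (sg_rhs u))) => //; apply/lip2_swap/sg_rhs_lip.
  - by apply: (cx (swap (sg_rhs v))) => //; apply/lip2_swap/sg_rhs_lip.
  - by move=> r rab; apply: sg_rhs_contract => //; exact: uv.
apply: (@le_trans _ _ (2 * (H * d * (b - a)))).
  rewrite ler_wpM2l//; apply: (@le_trans _ _ (H * d * `|x - y|)).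
    apply: (@itg_diff _ a b) => //.
    - by apply: (cx (sg_velocity u)) => //; exact: sg_velocity_lip.
    - by apply: (cx (sg_velocity v)) => //; exact: sg_velocity_lip.
    - by move=> r rab; exact: vel.
  by rewrite ler_wpM2l// dist_itv.
have : H * (b - a) * d <= 1 / 4 * d.
  rewrite ler_wpM2r// ler_pdivlMr//; apply: le_trans small.
  have : 0 <= 4 * (b - a) * M by rewrite !mulr_ge0// subr_ge0 ltW.
  by move: H => H'; lra.
by move: H => H'; lra.
Qed.

Lemma sg_iter_CL n k : CL a b n (sg_iter k).
Proof. by elim: k => [|k IH]; [exact: CL_cst|exact: sg_step_CL]. Qed.

Lemma sg_iter_lip k : lip2 a b (sg_iter k).
Proof. exact: CL_lip (sg_iter_CL 0 k). Qed.

Lemma sg_iter_bound k : bound2 a b (sg_iter k) 1.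
Proof.
elim: k => [|k IH]; first by move=> x y _ _; rewrite /= normr0.
by apply: sg_step_bound => //; exact: sg_iter_lip.
Qed.

Lemma sg_iter_close k : bound2 a b (fun x y => sg_iter k.+1 x y - sg_iter k x y) (2^-1 ^+ k).
Proof.
elim: k => [|k IH].
  by move=> x y xab yab; rewrite subr0 expr0; exact: (sg_iter_bound 1).
rewrite exprSr; apply: (sg_step_contract (sg_iter_lip k.+1) (sg_iter_lip k)
  (sg_iter_bound k.+1) (sg_iter_bound k) _ IH).
by rewrite exprn_ge0.
Qed.

Lemma sg_sol_close k : bound2 a b (fun x y => sg_sol x y - sg_iter k x y) (2 * 2^-1 ^+ k).
Proof.
move=> x y xab yab.
have := @limn_geometric_close R (fun k => sg_iter k x y) 1.
by move=> /(_ _ k); rewrite mul1r; apply => j; rewrite mul1r; exact: sg_iter_close.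
Qed.

Lemma sg_sol_bound : bound2 a b sg_sol 1.
Proof.
move=> x y xab yab; apply: (@le_limn_geometric R _ 1).
  by move=> k; rewrite mul1r; exact: sg_iter_close.
by move=> k; exact: sg_iter_bound.
Qed.

(** A Lipschitz bound common to all iterates survives the pointwise limit. It is common because it
    depends on the previous iterate only through [|u| <= 1]. *)
Lemma sg_sol_lip : lip2 a b sg_sol.
Proof.
pose L := 2 * (H * (b - a) + (M + H)).
have HM : 0 <= M + H by exact: addr_ge0.
have Hab : 0 <= H * (b - a) by rewrite mulr_ge0// subr_ge0 ltW.
have ML : 2 * (M + H) <= L by rewrite ler_wpM2l//; lra.
have L0 : 0 <= L by apply: le_trans ML; rewrite mulr_ge0.
have lim_lip (d : R) x y x' y' : a < x < b -> a < y < b -> a < x' < b -> a < y' < b ->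
    0 <= d -> (forall k, `|sg_iter k x' y' - sg_iter k x y| <= L * d) ->
    `|sg_sol x' y' - sg_sol x y| <= L * d.
  (* At each of the two points the iterate is off by at most [2 * 2^-1 ^+ k], whence the constant
     4. *)
  move=> xab yab xab' yab' d0 h; rewrite -subr_le0; apply: (@le_halving _ _ 4) => // k.
  have := sg_sol_close k xab yab; have := sg_sol_close k xab' yab'; have := h k.
  rewrite lerBlDr !ler_norml => /andP[? ?] /andP[? ?] /andP[? ?].
  by apply/andP; split; lra.
have iter_lipx k : lipx a b (sg_iter k) L.
  move=> x x' y xab xab' yab; case: k => [|k].
    by rewrite subrr normr0 mulr_ge0.
  apply: (@le_trans _ _ (2 * (M + H) * `|x' - x|)); last by rewrite ler_wpM2r.
  by apply: sg_step_lipx => //; [exact: sg_iter_lip|exact: sg_iter_bound].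
have iter_lipy k : lipy a b (sg_iter k) L.
  move=> x y y' xab yab yab'; case: k => [|k].
    by rewrite subrr normr0 mulr_ge0.
  by apply: sg_step_lipy => //; [exact: sg_iter_lip|exact: sg_iter_bound].
exists (1 + L); split.
- exact: addr_ge0.
- by move=> x y xab yab; apply: (le_trans (sg_sol_bound xab yab)); lra.
- move=> x x' y xab xab' yab.
  apply: (@le_trans _ _ (L * `|x' - x|)); last by rewrite ler_wpM2r//; lra.
  by apply: lim_lip => // k; exact: iter_lipx.
- move=> x y y' xab yab yab'.
  apply: (@le_trans _ _ (L * `|y' - y|)); last by rewrite ler_wpM2r//; lra.
  by apply: lim_lip => // k; exact: iter_lipy.
Qed.

Lemma sg_sol_fixed : eq2 a b (sg_step sg_sol) sg_sol.
Proof.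
move=> x y xab yab; apply/eqP; rewrite -subr_eq0 -normr_le0.
(* The error is half of [2 * 2^-1 ^+ k], by contraction, plus [2 * 2^-1 ^+ k.+1] from the next
   iterate. *)
apply: (@le_halving _ _ 2) => // k.
have h1 := sg_sol_close k.+1 xab yab.
have h2 := sg_step_contract sg_sol_lip (sg_iter_lip k) sg_sol_bound (sg_iter_bound k)
  _ (sg_sol_close k) xab yab.
have /h2 : 0 <= 2 * 2^-1 ^+ k :> R by rewrite mulr_ge0// exprn_ge0.
move: h1; rewrite exprS sg_iterS.
generalize (sg_step sg_sol x y) (sg_step (sg_iter k) x y) (sg_sol x y) (2^-1 ^+ k : R).
move=> p q r e; rewrite !ler_norml => /andP[? ?] /andP[? ?].
by apply/andP; split; lra.
Qed.

Lemma partialx_sg_sol : partialx a b sg_sol (fun x y => 2 * sg_velocity sg_sol x y).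
Proof.
move=> x y xab yab; apply: (@is_derive_itv_ext _ a b _ ((sg_step sg_sol)^~ y)) => //.
  by move=> t tab; exact: sg_sol_fixed.
apply: (@is_deriveZ _ _ _ _ 2).
exact: partialx_J1 (sg_velocity_lip sg_sol_lip) _ _ xab yab.
Qed.

Lemma partialy_sg_sol : partialy a b sg_sol
  (fun x y => 2 * (- sg_velocity sg_sol y y + J1 (sg_rhs sg_sol) x y)).
Proof.
move=> x y xab yab; apply: (@is_derive_itv_ext _ a b _ (sg_step sg_sol x)) => //.
  by move=> t tab; exact: sg_sol_fixed.
apply: (@is_deriveZ _ _ _ _ 2).
exact: (partialy_J1 (partialy_sg_velocity sg_sol_lip) (sg_velocity_lip sg_sol_lip)
  (sg_rhs_lip sg_sol_lip) xab yab).
Qed.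

(** Bootstrap: the fixed point equation expresses both partials through [u] by operations that
    preserve the class, so each class gives the next. *)
Lemma sg_sol_CL n : CL a b n sg_sol.
Proof.
elim: n => [|n IH]; first exact/CL0_lip/sg_sol_lip.
apply: (CL_partials sg_sol_bound partialx_sg_sol partialy_sg_sol).
  exact/CLZ/sg_velocity_CL.
apply: CLZ; apply: CLD; first exact/CLN/CL_diag/sg_velocity_CL.
exact/CL_J1/sg_rhs_CL.
Qed.

Lemma sg_sol_velocity_CL n : CL a b n (sg_velocity sg_sol).
Proof. exact/sg_velocity_CL/sg_sol_CL. Qed.

Lemma partialy_sg_sol_velocity : partialy a b (sg_velocity sg_sol) (sg_rhs sg_sol).
Proof. exact: partialy_sg_velocity sg_sol_lip. Qed.

Lemma sg_sol_diag x : a < x < b -> sg_sol x x = 0.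
Proof. by move=> xab; rewrite -sg_sol_fixed// /sg_step J1_diag mulr0. Qed.

End Square.

Lemma sg_velocity_diag u x : sg_velocity u x x = s0 x.
Proof. by rewrite /sg_velocity J2_diag addr0. Qed.

End SinhGordon.

Lemma mulmx2E (K : pzSemiRingType) (A B : 'M[K]_2) i j :
  (A *m B) i j = A i 0 * B 0 j + A i 1 * B 1 j.
Proof. by rewrite mxE big_ord_recl big_ord1; congr (_ + A i _ * B _ j); apply/val_inj. Qed.

Lemma mx2P (K : Type) (A B : 'M[K]_2) :
  A 0 0 = B 0 0 -> A 0 1 = B 0 1 -> A 1 0 = B 1 0 -> A 1 1 = B 1 1 -> A = B.
Proof.
move=> h1 h2 h3 h4; apply/matrixP => i j.
have E (k : 'I_2) : k = 0 \/ k = 1.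
  by case: k => [[|[|]]//= h]; [left|right]; apply/val_inj.
by have [->|->] := E i; have [->|->] := E j.
Qed.

(** * Picard series of a linear matrix equation, with estimates *)

Section LinearSeries.
Context {R : realType}.
Implicit Types (a b : R).

Lemma is_derive_shiftX (t0 x : R) n :
  is_derive x 1 (fun t => (t - t0) ^+ n.+1) (n.+1%:R * (x - t0) ^+ n).
Proof.
have d : is_derive x 1 (fun t : R => t - t0) 1.
  by rewrite -[X in is_derive _ _ _ X]subr0;
    exact: (is_deriveB (is_derive_id _ _) (is_derive_cst _ _ _)).
have := is_deriveX n.+1 d; rewrite [_ *: 1]mulr1 => h.
by rewrite (_ : (fun t => _) = (fun t => t - t0) ^+ n.+1)//; apply/funext => t; rewrite exprfctE.
Qed.

(** The Cauchy mean value theorem against [(t - t0) ^+ n.+1] treats both sides of [t0] at once and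
    produces the factor [1 / n.+1] that accumulates to a factorial. *)
Lemma power_bound a b t0 (f g : R -> R) c n t :
  (forall s, a < s < b -> is_derive s 1 f (g s)) -> f t0 = 0 ->
  (forall s, a < s < b -> `|g s| <= c * `|s - t0| ^+ n) ->
  a < t0 < b -> a < t < b -> `|f t| <= c * `|t - t0| ^+ n.+1 / n.+1%:R.
Proof.
move=> fg f0 gc t0ab tab.
have [->|tt0] := eqVneq t t0; first by rewrite f0 subrr !normr0 exprS !mul0r mulr0 mul0r.
pose p := Num.min t t0; pose q := Num.max t t0.
have pq : p < q by rewrite /p /q; case: (ltgtP t t0) tt0.
have itv s : s \in `]p, q[ -> a < s < b /\ s - t0 != 0.
  rewrite in_itv/= /p /q; move: t0ab tab => /andP[? ?] /andP[? ?].
  by case: (leP t t0) => ? /andP[? ?]; (split; [apply/andP; split; lra|]);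
    rewrite subr_eq0; [rewrite lt_eqF|rewrite gt_eqF].
have cont (h dh : R -> R) : (forall s, a < s < b -> is_derive s 1 h (dh s)) ->
    {within `[p, q], continuous h}.
  move=> hh; apply: continuous_in_subspaceT => s.
  rewrite inE/= in_itv/= => /andP[ps sq]; apply: (is_derive_continuous (hh s _)).
  move: t0ab tab ps sq; rewrite /p /q => /andP[? ?] /andP[? ?].
  by case: (leP t t0) => ? ? ?; apply/andP; split; lra.
have dX s : a < s < b -> is_derive s 1 (fun t => (t - t0) ^+ n.+1) (n.+1%:R * (s - t0) ^+ n).
  by move=> _; exact: is_derive_shiftX.
have [s spq e] := @cauchy_MVT R f g _ _ p q pq (cont _ _ fg) (cont _ _ dX)
  (fun s h => fg s (itv s h).1) (fun s h => dX s (itv s h).1)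
  (fun s h => mulf_neq0 (lt0r_neq0 (ltr0Sn _ _)) (expf_neq0 n (itv s h).2)).
have [sab st0] := itv s spq.
have X0 : (t - t0) ^+ n.+1 != 0 by rewrite expf_neq0// subr_eq0.
have {}e : f t = (t - t0) ^+ n.+1 * (g s / (n.+1%:R * (s - t0) ^+ n)).
  rewrite e /p /q; case: (leP t t0) => _; rewrite f0 subrr expr0n/=.
    by rewrite !sub0r invrN mulrNN mulrC divfK.
  by rewrite !subr0 mulrC divfK.
rewrite e !normrM normfV normrM !normrX normr_nat.
have sn0 : 0 < `|s - t0| ^+ n by rewrite exprn_gt0// normr_gt0.
have -> : `|t - t0| ^+ n.+1 * (`|g s| / (n.+1%:R * `|s - t0| ^+ n)) =
    `|g s| / `|s - t0| ^+ n * (`|t - t0| ^+ n.+1 / n.+1%:R).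
  by rewrite invfM; ring.
rewrite -[leRHS]mulrA ler_wpM2r ?divr_ge0 ?exprn_ge0//.
by rewrite ler_pdivrMr// gc.
Qed.

Section Series.
Variables (C : R -> 'M[R]_2) (a b t0 K : R).
Hypotheses (t0ab : a < t0 < b) (K0 : 0 <= K).
Hypothesis C_bound : forall t i j, a < t < b -> `|C t i j| <= K.
Hypothesis C_lip : forall s t i j, a < s < b -> a < t < b ->
  `|C t i j - C s i j| <= K * `|t - s|.

(** The Peano-Baker series of [V' = V C] with [V t0 = 1]: term [n] is the coefficient of [z^n] in
    the solution of [V' = z V C]. *)
Fixpoint picard n : R -> 'M[R]_2 :=
  if n is m.+1 then fun t => \matrix_(i, j) itg (fun s => (picard m s *m C s) i j) t0 t
  else fun=> 1%:M.

Definition dpicard n t : 'M[R]_2 := if n is m.+1 then picard m t *m C t else 0.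

Lemma C_continuous t i j : a < t < b -> {for t, continuous (fun s => C s i j)}.
Proof.
by move=> tab; apply: (@lipschitz_continuous _ a b _ K) => // r s rab sab; exact: C_lip.
Qed.

Lemma is_derive_picard n t i j : a < t < b ->
  is_derive t 1 (fun s => picard n s i j) (dpicard n t i j).
Proof.
elim: n t i j => [|n IH] t i j tab.
  by rewrite /= !mxE; exact: is_derive_cst.
have h : is_derive t 1 (itg (fun s => (picard n s *m C s) i j) t0) ((picard n t *m C t) i j).
  apply: (@is_derive_itg _ a b (fun s => (picard n s *m C s) i j)) => // s sab.
  rewrite (_ : (fun s => _) = (fun s => picard n s i 0 * C s 0 j + picard n s i 1 * C s 1 j)).
    have cp k : {for s, continuous (fun s => picard n s i k)}.
      exact: is_derive_continuous (IH _ _ _ sab).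
    by apply: cvgD; apply: cvgM; (exact: cp || exact: C_continuous).
  by apply/funext => r; rewrite mulmx2E.
by apply: (is_derive_itv_ext tab _ h) => s _; rewrite /= mxE.
Qed.

Lemma picard_base n : picard n t0 = if n == 0%N then 1%:M else 0.
Proof. by case: n => [|n]//=; apply/matrixP => i j; rewrite !mxE itg_id. Qed.

Lemma mulmx2_bound (A B : 'M[R]_2) p q i j : 0 <= p -> (forall i j, `|A i j| <= p) ->
  (forall i j, `|B i j| <= q) -> `|(A *m B) i j| <= 2 * p * q.
Proof.
move=> p0 Ap Bq; rewrite mulmx2E; apply: (le_trans (ler_normD _ _)).
rewrite -mulrA mulr_natl mulr2n !normrM; apply: lerD; exact: ler_pM.
Qed.

(** The 2 in [2 * K] counts the two products in an entry of a 2 by 2 product; [power_bound] supplies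
    the factorial. *)
Lemma picard_bound_pow n t i j : a < t < b ->
  `|picard n t i j| <= (2 * K * `|t - t0|) ^+ n / n`!%:R.
Proof.
elim: n t i j => [|n IH] t i j tab.
  by rewrite /= mxE expr0 divr1; case: eqP => _; rewrite ?normr1 ?normr0.
have := @power_bound a b t0 (fun t => picard n.+1 t i j)
  (fun t => dpicard n.+1 t i j) ((2 * K) ^+ n.+1 / n`!%:R) n t.
move=> /(_ _ _ _ t0ab tab) h; apply: le_trans (h _ _ _) _.
- by move=> s sab; exact: is_derive_picard.
- by rewrite picard_base mxE.
- move=> s sab; have p0 : 0 <= (2 * K * `|s - t0|) ^+ n / n`!%:R.
    by rewrite divr_ge0// exprn_ge0// !mulr_ge0.
  apply: (le_trans (mulmx2_bound i j p0 _ _)) => [k l|k l|]; [exact: IH|exact: C_bound|].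
  by rewrite le_eqVlt; apply/orP; left; apply/eqP; rewrite [(2 * K * _) ^+ _]exprMn exprS; ring.
rewrite le_eqVlt; apply/orP; left; apply/eqP.
by rewrite [(2 * K * _) ^+ _]exprMn factS natrM invfM; ring.
Qed.

Definition picard_majorant n : R := (2 * K * (b - a)) ^+ n / n`!%:R.

Lemma fast_picard_majorant : fast picard_majorant.
Proof. exact: fast_exp. Qed.

Lemma picard_majorant_ge0 n : 0 <= picard_majorant n.
Proof.
rewrite divr_ge0// exprn_ge0// !mulr_ge0// subr_ge0.
by move: t0ab => /andP[? ?]; lra.
Qed.

Lemma picard_bound n t i j : a < t < b -> `|picard n t i j| <= picard_majorant n.
Proof.
move=> tab; apply: (le_trans (picard_bound_pow n i j tab)).
rewrite ler_wpM2r ?invr_ge0// lerXn2r ?nnegrE ?mulr_ge0//.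
  by rewrite subr_ge0; move: t0ab => /andP[? ?]; lra.
by rewrite ler_wpM2l ?mulr_ge0// dist_itv.
Qed.

Definition dpicard_majorant n : R := 2 * picard_majorant n.-1 * K.

Lemma dpicard_majorant_ge0 n : 0 <= dpicard_majorant n.
Proof. by apply: mulr_ge0 => //; apply: mulr_ge0 => //; exact: picard_majorant_ge0. Qed.

Lemma fast_dpicard_majorant : fast dpicard_majorant.
Proof.
have /(fastZ (2 * K)) := fast_pred fast_picard_majorant.
by move=> /fast_le; apply=> n; rewrite /dpicard_majorant mulrAC.
Qed.

Lemma dpicard_bound n t i j : a < t < b -> `|dpicard n t i j| <= dpicard_majorant n.
Proof.
move=> tab; case: n => [|n] /=; first by rewrite mxE normr0 dpicard_majorant_ge0.
apply: mulmx2_bound; first exact: picard_majorant_ge0.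
  by move=> k l; exact: picard_bound.
by move=> k l; exact: C_bound.
Qed.

Lemma picard_lip n s t i j : a < s < b -> a < t < b ->
  `|picard n t i j - picard n s i j| <= dpicard_majorant n * `|t - s|.
Proof.
move=> sab tab; apply: (mean_value_le (a := a) (b := b)
  (f := fun t => picard n t i j) (g := fun t => dpicard n t i j)) => // r rab.
  exact: is_derive_picard.
exact: dpicard_bound.
Qed.

Definition picard_remainder n : R :=
  2 * (dpicard_majorant n.-1 * K + picard_majorant n.-1 * K).

Lemma fast_picard_remainder : fast picard_remainder.
Proof.
apply: (@fast_le _ (fun n => 2 * K * (dpicard_majorant n.-1 + picard_majorant n.-1))).
  exact/fastZ/fastD/(fast_pred fast_picard_majorant)/(fast_pred fast_dpicard_majorant).
by move=> n; rewrite /picard_remainder -mulrDl mulrA mulrAC.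
Qed.

(** The derivative of term [n] is Lipschitz with a constant that is again rapidly decreasing in [n],
    so the series can be differentiated term by term. *)
Lemma picard_quadratic n s t i j : a < s < b -> a < t < b ->
  `|picard n t i j - picard n s i j - (t - s) * dpicard n s i j|
  <= picard_remainder n * (t - s) ^+ 2.
Proof.
move=> sab tab; apply: (quadratic_remainder (a := a) (b := b)
  (f := fun t => picard n t i j) (g := fun t => dpicard n t i j)) => // r.
  by move=> rab; exact: is_derive_picard.
move=> q rab qab; case: n => [|n] /=.
  rewrite !mxE subrr normr0 !mulr_ge0// addr_ge0// mulr_ge0//.
    exact: dpicard_majorant_ge0.
  exact: picard_majorant_ge0.
rewrite !mulmx2E.
have -> (x y z w : R) : x + y - (z + w) = (x - z) + (y - w) by ring.
have key k : `|picard n q i k * C q k j - picard n r i k * C r k j| <=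
    (dpicard_majorant n * K + picard_majorant n * K) * `|q - r|.
  have -> (x y z w : R) : x * y - z * w = (x - z) * y + z * (y - w) by ring.
  apply: (le_trans (ler_normD _ _)); rewrite !normrM mulrDl; apply: lerD.
    rewrite mulrAC; apply: ler_pM => //; first exact: picard_lip.
    exact: C_bound.
  by rewrite -mulrA; apply: ler_pM => //; [exact: picard_bound|exact: C_lip].
apply: (le_trans (ler_normD _ _)).
by rewrite /picard_remainder/= -mulrA mulr_natl mulr2n; apply: lerD; exact: key.
Qed.

End Series.

End LinearSeries.

(** * Complex-valued functions of a real variable and their derivatives *)

Section ComplexDerivative.
Context {R : realType}.
Implicit Types (x y z : R[i]) (f g : R -> R[i]) (t : R).
Local Notation Re := complex.Re.
Local Notation Im := complex.Im.

Lemma cReM x y : Re (x * y) = Re x * Re y - Im x * Im y.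
Proof. by case: x; case: y. Qed.

Lemma cImM x y : Im (x * y) = Re x * Im y + Im x * Re y.
Proof. by case: x; case: y. Qed.

Lemma cReD x y : Re (x + y) = Re x + Re y. Proof. by case: x; case: y. Qed.

Lemma cImD x y : Im (x + y) = Im x + Im y. Proof. by case: x; case: y. Qed.

Lemma cReN x : Re (- x) = - Re x. Proof. by case: x. Qed.

Lemma cImN x : Im (- x) = - Im x. Proof. by case: x. Qed.

Lemma eq_ReIm x y : Re x = Re y -> Im x = Im y -> x = y.
Proof. by case: x; case: y => a b c d /= -> ->. Qed.

(** Kept by components, the form in which [dpw_solution] states its equation. *)
Definition cder f t z := is_derive t 1 (fun s => Re (f s)) (Re z) /\
  is_derive t 1 (fun s => Im (f s)) (Im z).

Lemma cder_cst z t : cder (fun=> z) t 0.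
Proof. by split; exact: is_derive_cst. Qed.

Lemma cderD f g t z w : cder f t z -> cder g t w -> cder (fun s => f s + g s) t (z + w).
Proof.
move=> [f1 f2] [g1 g2]; split; [rewrite cReD|rewrite cImD].
  rewrite (_ : (fun _ => _) = (fun s => Re (f s)) + (fun s => Re (g s))).
    exact: is_deriveD.
  by apply/funext => s; rewrite cReD.
rewrite (_ : (fun _ => _) = (fun s => Im (f s)) + (fun s => Im (g s))).
  exact: is_deriveD.
by apply/funext => s; rewrite cImD.
Qed.

Lemma cderN f t z : cder f t z -> cder (fun s => - f s) t (- z).
Proof.
move=> [f1 f2]; split; [rewrite cReN|rewrite cImN].
  rewrite (_ : (fun _ => _) = - (fun s => Re (f s))); first exact: is_deriveN.
  by apply/funext => s; rewrite cReN.
rewrite (_ : (fun _ => _) = - (fun s => Im (f s))); first exact: is_deriveN.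
by apply/funext => s; rewrite cImN.
Qed.

Lemma cderM f g t z w : cder f t z -> cder g t w ->
  cder (fun s => f s * g s) t (z * g t + f t * w).
Proof.
move=> [f1 f2] [g1 g2]; split.
  rewrite (_ : (fun _ => _) = (fun s => Re (f s)) * (fun s => Re (g s))
     - (fun s => Im (f s)) * (fun s => Im (g s))).
    apply: is_derive_eq (is_deriveB (is_deriveM f1 g1) (is_deriveM f2 g2)) _.
    rewrite cReD !cReM /GRing.scale/=.
    move: (Re z) (Im z) (Re w) (Im w) (Re (f t)) (Im (f t)) (Re (g t)) (Im (g t)).
    by move=> *; ring.
  by apply/funext => s; rewrite cReM.
rewrite (_ : (fun _ => _) = (fun s => Re (f s)) * (fun s => Im (g s))
   + (fun s => Im (f s)) * (fun s => Re (g s))).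
  apply: is_derive_eq (is_deriveD (is_deriveM f1 g2) (is_deriveM f2 g1)) _.
  rewrite cImD !cImM /GRing.scale/=.
  move: (Re z) (Im z) (Re w) (Im w) (Re (f t)) (Im (f t)) (Re (g t)) (Im (g t)).
  by move=> *; ring.
by apply/funext => s; rewrite cImM.
Qed.

Lemma cder_eq f t z w : z = w -> cder f t z -> cder f t w.
Proof. by move=> ->. Qed.

Lemma cder_ext a b f g t z : a < t < b -> (forall s, a < s < b -> f s = g s) ->
  cder f t z -> cder g t z.
Proof.
move=> tab fg [f1 f2]; split.
  by apply: (is_derive_itv_ext tab _ f1) => s sab; rewrite fg.
by apply: (is_derive_itv_ext tab _ f2) => s sab; rewrite fg.
Qed.

Lemma cder0_const a b f s t : (forall r, a < r < b -> cder f r 0) ->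
  a < s < b -> a < t < b -> f t = f s.
Proof.
move=> f0 sab tab; apply: eq_ReIm.
  by apply: (derive0_const (f := fun r => Re (f r)) _ sab tab) => r /f0[].
by apply: (derive0_const (f := fun r => Im (f r)) _ sab tab) => r /f0[].
Qed.

Lemma cder_real (f : R -> R) t d : is_derive t 1 f d -> cder (fun s => (f s)%:C%C) t d%:C%C.
Proof. by move=> fd; split => //; exact: is_derive_cst. Qed.

Definition mcder (F : R -> 'M[R[i]]_2) t (D : 'M[R[i]]_2) :=
  forall i j, cder (fun s => F s i j) t (D i j).

Lemma mcder_cst A t : mcder (fun=> A) t 0.
Proof. by move=> i j; rewrite mxE; exact: cder_cst. Qed.

Lemma mcderM F G t D E : mcder F t D -> mcder G t E ->
  mcder (fun s => F s *m G s) t (D *m G t + F t *m E).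
Proof.
move=> dF dG i j; apply: (@cder_ext (t - 1) (t + 1)
  (fun s => F s i 0 * G s 0 j + F s i 1 * G s 1 j)).
- by apply/andP; split; lra.
- by move=> s _; rewrite mulmx2E.
- rewrite mxE !mulmx2E addrACA.
  by apply: cderD; apply: cderM.
Qed.

Lemma mcder_eq F t D E : D = E -> mcder F t D -> mcder F t E.
Proof. by move=> ->. Qed.

Lemma mcder_ext a b F G t D : a < t < b -> (forall s, a < s < b -> F s = G s) ->
  mcder F t D -> mcder G t D.
Proof. by move=> tab FG h i j; apply: (cder_ext tab _ (h i j)) => s sab; rewrite FG. Qed.

Lemma mcder0_const a b F s t : (forall r, a < r < b -> mcder F r 0) ->
  a < s < b -> a < t < b -> F t = F s.
Proof.
move=> F0 sab tab; apply/matrixP => i j.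
apply: (cder0_const (f := fun r => F r i j) _ sab tab) => r /F0/(_ i j).
by rewrite mxE.
Qed.

Lemma is_derive_mxP (F : R -> 'M[R]_2) t (D : 'M[R]_2) :
  is_derive t 1 F D <-> forall i j, is_derive t 1 (fun s => F s i j) (D i j).
Proof.
split=> [[dF FD] i j|h].
  have dFij := (derivable_mxP F t 1).1 dF i j.
  split => //; rewrite -FD (derive_mx dF) mxE//.
have dF : derivable F t 1 by apply/derivable_mxP => i j; have [] := h i j.
split => //; rewrite (derive_mx dF); apply/matrixP => i j; rewrite mxE.
by have [] := h i j.
Qed.

Lemma mcderP F t D : is_derive t 1 (fun s => mxRe (F s)) (mxRe D) ->
  is_derive t 1 (fun s => mxIm (F s)) (mxIm D) -> mcder F t D.
Proof.
move=> /is_derive_mxP h1 /is_derive_mxP h2 i j; split.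
  have := h1 i j; rewrite mxE (_ : (fun s => _) = (fun s => Re (F s i j)))//.
  by apply/funext => s; rewrite mxE.
have := h2 i j; rewrite mxE (_ : (fun s => _) = (fun s => Im (F s i j)))//.
by apply/funext => s; rewrite mxE.
Qed.

Lemma mcder_toC (F : R -> 'M[R]_2) t (D : 'M[R]_2) :
  (forall i j, is_derive t 1 (fun s => F s i j) (D i j)) ->
  mcder (fun s => toC (F s)) t (toC D).
Proof.
move=> h i j; rewrite mxE; apply: (@cder_ext (t - 1) (t + 1) (fun s => (F s i j)%:C%C)).
- by apply/andP; split; lra.
- by move=> s _; rewrite mxE.
- exact: cder_real.
Qed.

End ComplexDerivative.

(** * Entire series with real coefficients, evaluated at a complex point *)

Section Evaluation.
Context {R : realType}.
Local Notation Re := complex.Re.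
Local Notation Im := complex.Im.
Implicit Types (a c : nat -> R) (z w : R[i]).

(** The l1 norm takes values in [R] and is submultiplicative, so all estimates stay over the
    reals. *)
Definition cnorm1 z : R := `|Re z| + `|Im z|.

Lemma cnorm1_ge0 z : 0 <= cnorm1 z. Proof. exact: addr_ge0. Qed.

Lemma cnorm1M z w : cnorm1 (z * w) <= cnorm1 z * cnorm1 w.
Proof.
rewrite /cnorm1 cReM cImM mulrDl !mulrDr -!normrM.
apply: (le_trans (lerD (ler_normB _ _) (ler_normD _ _))); lra.
Qed.

Lemma cnorm1X z n : cnorm1 (z ^+ n) <= cnorm1 z ^+ n.
Proof.
elim: n => [|n IH]; first by rewrite !expr0 /cnorm1/= normr1 normr0 addr0.
by rewrite !exprS; apply: (le_trans (cnorm1M _ _)); rewrite ler_wpM2l// cnorm1_ge0.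
Qed.

Lemma norm_ReX z n : `|Re (z ^+ n)| <= cnorm1 z ^+ n.
Proof. by apply: le_trans (cnorm1X z n); rewrite lerDl. Qed.

Lemma norm_ImX z n : `|Im (z ^+ n)| <= cnorm1 z ^+ n.
Proof. by apply: le_trans (cnorm1X z n); rewrite lerDr. Qed.

Lemma fast_Re a z : fast a -> fast (fun n => a n * Re (z ^+ n)).
Proof.
move=> /(fast_geometric (cnorm1 z))/fast_le; apply => n.
rewrite !normrM ler_wpM2l// normrX (ger0_norm (cnorm1_ge0 _)); exact: norm_ReX.
Qed.

Lemma fast_Im a z : fast a -> fast (fun n => a n * Im (z ^+ n)).
Proof.
move=> /(fast_geometric (cnorm1 z))/fast_le; apply => n.
rewrite !normrM ler_wpM2l// normrX (ger0_norm (cnorm1_ge0 _)); exact: norm_ImX.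
Qed.

Lemma fast_tsumD a c : fast a -> fast c -> tsum (fun n => a n + c n) = tsum a + tsum c.
Proof. by move=> /fast_halving[C aC] /fast_halving[D cD]; exact: tsumD aC cD. Qed.

Lemma fast_tsumZ k a : fast a -> tsum (fun n => k * a n) = k * tsum a.
Proof. by move=> /fast_halving[C aC]; exact: tsumZ aC. Qed.

Lemma fast_tsumS a : fast a -> tsum a = a 0%N + tsum (fun n => a n.+1).
Proof. by move=> /fast_halving[C aC]; exact: tsumS aC. Qed.

(** Splitting [z^n] into its real and imaginary parts leaves two real series. That the coefficients
    are real will give the reality condition of the loop group. *)
Definition ev a z : R[i] :=
  Complex (tsum (fun n => a n * Re (z ^+ n))) (tsum (fun n => a n * Im (z ^+ n))).

Lemma ev_ext a c z : (forall n, a n = c n) -> ev a z = ev c z.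
Proof. by move=> ac; rewrite (_ : a = c)//; exact/funext. Qed.

Lemma evD a c z : fast a -> fast c -> ev (fun n => a n + c n) z = ev a z + ev c z.
Proof.
move=> fa fc; apply: eq_ReIm => /=.
- rewrite -fast_tsumD; try exact: fast_Re.
  by congr tsum; apply/funext => n; rewrite mulrDl.
- rewrite -fast_tsumD; try exact: fast_Im.
  by congr tsum; apply/funext => n; rewrite mulrDl.
Qed.

Lemma evZ k a z : fast a -> ev (fun n => k * a n) z = k%:C%C * ev a z.
Proof.
move=> fa; apply: eq_ReIm; [rewrite cReM|rewrite cImM] => /=; rewrite mul0r ?subr0 ?addr0.
- rewrite -fast_tsumZ; last exact: fast_Re.
  by congr tsum; apply/funext => n; rewrite mulrA.
- rewrite -fast_tsumZ; last exact: fast_Im.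
  by congr tsum; apply/funext => n; rewrite mulrA.
Qed.

Lemma evS a z : fast a -> ev a z = (a 0%N)%:C%C + z * ev (fun n => a n.+1) z.
Proof.
move=> fa; have fS := fastS fa; have fR := fast_Re z fS; have fI := fast_Im z fS.
apply: eq_ReIm; [rewrite cReD cReM|rewrite cImD cImM] => /=.
- rewrite fast_tsumS ?expr0/= ?mulr1; last exact: fast_Re.
  congr (_ + _); rewrite -!fast_tsumZ// -mulN1r -fast_tsumZ; last exact: fastZ.
  rewrite -fast_tsumD; [|exact: fastZ|exact/fastZ/fastZ].
  by congr tsum; apply/funext => n; rewrite exprS cReM; ring.
- rewrite fast_tsumS ?expr0/= ?mulr0 ?add0r; last exact: fast_Im.
  rewrite -!fast_tsumZ// -fast_tsumD; [|exact: fastZ..].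
  by congr tsum; apply/funext => n; rewrite exprS cImM; ring.
Qed.

Lemma ReX_conj z n : Re (conjc z ^+ n) = Re (z ^+ n) /\ Im (conjc z ^+ n) = - Im (z ^+ n).
Proof.
elim: n => [|n [IH1 IH2]]; first by rewrite !expr0/= oppr0.
rewrite !exprS !cReM !cImM IH1 IH2; case: z {IH1 IH2} => x y /=.
by split; ring.
Qed.

Lemma ev_conj a z : fast a -> ev a (conjc z) = conjc (ev a z).
Proof.
move=> fa; apply: eq_ReIm => /=.
  by congr tsum; apply/funext => n; rewrite (ReX_conj z n).1.
rewrite -mulN1r -fast_tsumZ; last exact: fast_Im.
by congr tsum; apply/funext => n; rewrite (ReX_conj z n).2; ring.
Qed.

Lemma evN a z : ev a (- z) = ev (fun n => (-1) ^+ n * a n) z.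
Proof.
have E n : Re ((- z) ^+ n) = (-1) ^+ n * Re (z ^+ n) /\
    Im ((- z) ^+ n) = (-1) ^+ n * Im (z ^+ n).
  elim: n => [|n [IH1 IH2]]; first by rewrite !expr0 !mul1r.
  by rewrite !exprS !cReM !cImM IH1 IH2 cReN cImN; split; ring.
apply: eq_ReIm => /=; congr tsum; apply/funext => n.
  by rewrite (E n).1; ring.
by rewrite (E n).2; ring.
Qed.

(** The majorants [B], [G] and [L] control values, derivatives and quadratic remainders;
    multiplication by the real or imaginary part of [z^n] keeps them rapidly decreasing. *)
Lemma cder_ev (p q x : R) (f : nat -> R -> R) (g B L G : nat -> R) z :
  p < x < q -> fast B -> fast L -> fast G ->
  (forall n y, p < y < q -> `|f n y| <= B n) -> (forall n, `|g n| <= G n) ->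
  (forall n y, p < y < q ->
    `|f n y - f n x - (y - x) * g n| <= L n * (y - x) ^+ 2) ->
  cder (fun y => ev (f^~ y) z) x (ev g z).
Proof.
move=> xpq fB fL fG fB' gG h.
have key (v : nat -> R) (k : R) : (forall a, fast a -> fast (fun n => a n * v n)) ->
    is_derive x 1 (fun y => tsum (fun n => f n y * v n)) (tsum (fun n => g n * v n)).
  move=> hv; have [C1 h1] := fast_halving (hv _ fB).
  have [C2 h2] := fast_halving (hv _ fG); have [C3 h3] := fast_halving (hv _ fL).
  apply: (@is_derive_tsum _ p q x C3 (fun n y => f n y * v n) _ C1 C2) => //.
  - move=> y ypq n; apply: le_trans (h1 n); rewrite !normrM ler_wpM2r//.
    by apply: le_trans (fB' n y ypq) _; exact: ler_norm.
  - move=> n; apply: le_trans (h2 n); rewrite !normrM ler_wpM2r//.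
    by apply: le_trans (gG n) _; exact: ler_norm.
  - move=> n y ypq.
    have -> : f n y * v n - f n x * v n - (y - x) * (g n * v n) =
      (f n y - f n x - (y - x) * g n) * v n by ring.
    rewrite normrM; apply: (@le_trans _ _ (`|L n * v n| * (y - x) ^+ 2)).
      rewrite normrM mulrAC ler_wpM2r//; apply: (le_trans (h n y ypq)).
      by rewrite ler_wpM2r ?sqr_ge0// ler_norm.
    by rewrite ler_wpM2r ?sqr_ge0.
split; apply: key => // a fa; [exact: fast_Re|exact: fast_Im].
Qed.

End Evaluation.

(** * Entries and determinant of 2 by 2 matrices, and the twist by [e3] *)

Section Mx2.
Context {K : nzRingType}.
Implicit Types a b c d : K.

Lemma mx2_00 a b c d : mx2 a b c d 0 0 = a. Proof. by rewrite mxE. Qed.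

Lemma mx2_01 a b c d : mx2 a b c d 0 1 = b. Proof. by rewrite mxE. Qed.

Lemma mx2_10 a b c d : mx2 a b c d 1 0 = c. Proof. by rewrite mxE. Qed.

Lemma mx2_11 a b c d : mx2 a b c d 1 1 = d. Proof. by rewrite mxE. Qed.

Definition mx2E := (mx2_00, mx2_01, mx2_10, mx2_11).

Lemma scalar_mx2E a (i j : 'I_2) : (a%:M : 'M[K]_2) i j = if i == j then a else 0.
Proof. by rewrite mxE; case: eqP. Qed.

End Mx2.

Lemma det_mx2 (K : comPzRingType) (A : 'M[K]_2) : \det A = A 0 0 * A 1 1 - A 0 1 * A 1 0.
Proof.
rewrite (expand_det_row _ 0) big_ord_recl big_ord1 /cofactor !det_mx11 !mxE /=.
rewrite /bump/= expr0 expr1 mul1r mulN1r mulrN.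
by congr (_ * A _ _ - A _ _ * A _ _); apply/val_inj.
Qed.

Lemma Ad_e3E (K : fieldType) (X : 'M[K]_2) i j :
  Ad (e3 K) X i j = (if i == j then 1 else -1) * X i j.
Proof.
have e3V : invmx (e3 K) = e3 K.
  have ee : e3 K *m e3 K = 1%:M.
    by apply: mx2P; rewrite mulmx2E !mx2E !scalar_mx2E/=; ring.
  have [u _] := mulmx1_unit ee.
  by rewrite -[LHS]mulmx1 -ee mulmxA mulVmx// mul1mx.
have : Ad (e3 K) X = \matrix_(i, j) ((if i == j then 1 else -1) * X i j).
  by rewrite /Ad e3V; apply: mx2P; rewrite !mulmx2E !mx2E !mxE/=; ring.
by move=> ->; rewrite mxE.
Qed.

(** * Complex differentiability of entire series *)

Section Weights.
Context {R : realType}.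
Local Notation Re := complex.Re.
Local Notation Im := complex.Im.
Implicit Types (a : nat -> R) (z h : R[i]) (v w : nat -> R[i]).

Lemma cnorm1D z h : cnorm1 (z + h) <= cnorm1 z + cnorm1 h.
Proof.
by rewrite /cnorm1 cReD cImD addrACA; apply: lerD; exact: ler_normD.
Qed.

Lemma cnorm1N z : cnorm1 (- z) = cnorm1 z.
Proof. by rewrite /cnorm1 cReN cImN !normrN. Qed.

Lemma cnorm1_nat n : cnorm1 (n%:R : R[i]) = n%:R.
Proof.
have -> : (n%:R : R[i]) = (n%:R : R)%:C%C by rewrite rmorph_nat.
by rewrite /cnorm1/= normr0 addr0 normr_nat.
Qed.

(** The exponent [n.+1] rather than [n] leaves room for a constant at [n = 0]. *)
Definition geometric_growth v := exists r, 0 <= r /\ forall n, cnorm1 (v n) <= r ^+ n.+1.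

Lemma growth_fastRe a v : geometric_growth v -> fast a -> fast (fun n => a n * Re (v n)).
Proof.
move=> [r [r0 vr]] /(fast_geometric r)/(fastZ r)/fast_le; apply => n.
rewrite mulrCA -exprS !normrM ler_wpM2l// normrX (ger0_norm r0).
by apply: le_trans (vr n); rewrite lerDl.
Qed.

Lemma growth_fastIm a v : geometric_growth v -> fast a -> fast (fun n => a n * Im (v n)).
Proof.
move=> [r [r0 vr]] /(fast_geometric r)/(fastZ r)/fast_le; apply => n.
rewrite mulrCA -exprS !normrM ler_wpM2l// normrX (ger0_norm r0).
by apply: le_trans (vr n); rewrite lerDr.
Qed.

Definition weighted_sum a v : R[i] :=
  Complex (tsum (fun n => a n * Re (v n))) (tsum (fun n => a n * Im (v n))).

Lemma weighted_sumB a v w : fast a -> geometric_growth v -> geometric_growth w ->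
  weighted_sum a (fun n => v n - w n) = weighted_sum a v - weighted_sum a w.
Proof.
move=> fa gv gw; apply: eq_ReIm; [rewrite cReD cReN|rewrite cImD cImN] => /=.
- have := @fast_tsumZ R (-1) _ (growth_fastRe gw fa); rewrite mulN1r => <-.
  rewrite -fast_tsumD; [|exact: growth_fastRe|exact/fastZ/growth_fastRe].
  by congr tsum; apply/funext => n; rewrite cReD cReN; ring.
- have := @fast_tsumZ R (-1) _ (growth_fastIm gw fa); rewrite mulN1r => <-.
  rewrite -fast_tsumD; [|exact: growth_fastIm|exact/fastZ/growth_fastIm].
  by congr tsum; apply/funext => n; rewrite cImD cImN; ring.
Qed.

Lemma weighted_sumZ a v h : fast a -> geometric_growth v ->
  weighted_sum a (fun n => h * v n) = h * weighted_sum a v.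
Proof.
move=> fa gv; have fR := growth_fastRe gv fa; have fI := growth_fastIm gv fa.
apply: eq_ReIm; [rewrite cReM|rewrite cImM] => /=.
- have := @fast_tsumZ R (- Im h) _ fI; rewrite mulNr => <-.
  rewrite -fast_tsumZ// -fast_tsumD; [|exact: fastZ..].
  by congr tsum; apply/funext => n; rewrite cReM; ring.
- rewrite -!fast_tsumZ// -fast_tsumD; [|exact: fastZ..].
  by congr tsum; apply/funext => n; rewrite cImM; ring.
Qed.

Lemma growth_pow z : geometric_growth (fun n => z ^+ n).
Proof.
exists (1 + cnorm1 z); have z0 := cnorm1_ge0 z; split; first exact: addr_ge0.
move=> n; apply: (le_trans (cnorm1X z n)).
rewrite exprS; apply: (@le_trans _ _ ((1 + cnorm1 z) ^+ n)).
  by rewrite lerXn2r ?nnegrE; lra.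
by rewrite ler_peMl ?exprn_ge0; lra.
Qed.

Lemma growth_dpow z : geometric_growth (fun n => n%:R * z ^+ n.-1).
Proof.
exists (2 * (1 + cnorm1 z)); have z0 := cnorm1_ge0 z; split.
  by rewrite mulr_ge0// addr_ge0.
move=> n; apply: (le_trans (cnorm1M _ _)); rewrite cnorm1_nat exprMn.
apply: ler_pM => //; first exact: cnorm1_ge0.
  by rewrite -natrX ler_nat (leq_trans (ltnW (ltn_expl n (isT : 1 < 2)%N)))// leq_exp2l.
apply: (le_trans (cnorm1X z _)).
apply: (@le_trans _ _ ((1 + cnorm1 z) ^+ n.-1)).
  by rewrite lerXn2r ?nnegrE; lra.
by apply: ler_weXn2l; [lra|rewrite leqW// leq_pred].
Qed.

Lemma growthB v w : geometric_growth v -> geometric_growth w ->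
  geometric_growth (fun n => v n - w n).
Proof.
move=> [r [r0 vr]] [s [s0 ws]]; exists (r + s); split; first exact: addr_ge0.
move=> n; apply: (le_trans (cnorm1D _ _)); rewrite cnorm1N.
apply: (le_trans (lerD (vr n) (ws n))).
have : 0 <= r * s by exact: mulr_ge0.
elim: n => [|n IH] rs; first by rewrite !expr1.
rewrite exprS [s ^+ _]exprS [leRHS]exprS; apply: le_trans (ler_wpM2l _ (IH rs)).
  rewrite mulrDl !mulrDr.
  have : 0 <= r * s ^+ n.+1 by rewrite mulr_ge0// exprn_ge0.
  have : 0 <= s * r ^+ n.+1 by rewrite mulr_ge0// exprn_ge0.
  by lra.
exact: addr_ge0.
Qed.

(** The remainders satisfy [q (n+1) = (z + h) q n + n h^2 z^(n-1)]. As [r >= 1], the power [n - 1]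
    may be bounded through the power [n] of [r], which also covers [n = 0]. *)
Lemma pow_quadratic z h n (r : R) : 1 <= r -> cnorm1 z <= r -> cnorm1 (z + h) <= r ->
  cnorm1 ((z + h) ^+ n - z ^+ n - h * (n%:R * z ^+ n.-1)) <=
  (n%:R * (n%:R * r ^+ n)) * cnorm1 h ^+ 2.
Proof.
move=> r1 zr zhr; have r0 : 0 <= r by lra.
elim: n => [|n IH].
  have -> : (z + h) ^+ 0 - z ^+ 0 - h * (0%:R * z ^+ 0.-1) = 0%:R :> R[i].
    by rewrite !expr0 mulr0n; ring.
  by rewrite cnorm1_nat !mul0r.
set q := (X in cnorm1 X <= _) in IH.
have -> : (z + h) ^+ n.+1 - z ^+ n.+1 - h * (n.+1%:R * z ^+ n.+1.-1) =
    n%:R * (h ^+ 2 * z ^+ n.-1) + (z + h) * q.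
  rewrite /q exprS [z ^+ n.+1]exprS -natr1/=; case: n {IH q} => [|n]/=.
    by rewrite !expr0 mulr0n; ring.
  by rewrite !exprS; ring.
apply: (le_trans (cnorm1D _ _)).
have h0 := cnorm1_ge0 h.
have hh : cnorm1 (h ^+ 2) <= cnorm1 h ^+ 2 by exact: cnorm1X.
have zn : cnorm1 (z ^+ n.-1) <= r ^+ n.
  apply: (le_trans (cnorm1X z _)); apply: (@le_trans _ _ (r ^+ n.-1)).
    by rewrite lerXn2r ?nnegrE// cnorm1_ge0.
  by apply: ler_weXn2l; rewrite ?leq_pred.
have t1 : cnorm1 (n%:R * (h ^+ 2 * z ^+ n.-1)) <= n%:R * (cnorm1 h ^+ 2 * r ^+ n).
  apply: (le_trans (cnorm1M _ _)); rewrite cnorm1_nat ler_wpM2l//.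
  by apply: (le_trans (cnorm1M _ _)); apply: ler_pM; rewrite ?cnorm1_ge0.
have t2 : cnorm1 ((z + h) * q) <= r * (n%:R * (n%:R * r ^+ n) * cnorm1 h ^+ 2).
  by apply: (le_trans (cnorm1M _ _)); apply: ler_pM; rewrite ?cnorm1_ge0.
apply: (le_trans (lerD t1 t2)); rewrite [r ^+ n.+1]exprS -natr1.
have n0 : 0 <= n%:R :> R by [].
have X0 : 0 <= r ^+ n * cnorm1 h ^+ 2 by rewrite mulr_ge0// exprn_ge0.
move: (n%:R : R) (r ^+ n) (cnorm1 h ^+ 2) n0 X0 => N X Y n0 X0.
rewrite -subr_ge0.
have -> : (N + 1) * ((N + 1) * (r * X)) * Y - (N * (Y * X) + r * (N * (N * X) * Y)) =
  (X * Y) * (N * (2 * r - 1) + r) by ring.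
apply: mulr_ge0 => //; apply: addr_ge0 => //; apply: mulr_ge0 => //; lra.
Qed.

Lemma normc_le_cnorm1 z : Normc.normc z <= cnorm1 z.
Proof.
case: z => x y; rewrite /Normc.normc /cnorm1/= -[leRHS]ger0_norm ?addr_ge0//.
rewrite -sqrtr_sqr ler_wsqrtr// -(real_normK (num_real x)) -(real_normK (num_real y)).
rewrite sqrrD lerD2r lerDl; have := mulr_ge0 (normr_ge0 x) (normr_ge0 y); lra.
Qed.

Lemma cnorm1_le_normc z : cnorm1 z <= 2 * Normc.normc z.
Proof.
case: z => x y; rewrite /Normc.normc /cnorm1/= mulr_natl mulr2n.
apply: lerD; rewrite -sqrtr_sqr ler_wsqrtr// ?lerDl ?lerDr sqr_ge0//.
Qed.

(** For [h] of norm at most 1 all powers are controlled by [r = 1 + cnorm1 z], and the factor [n^2]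
    of [pow_quadratic] is absorbed by the rapid decrease of [a]. *)
Lemma ev_quadratic a z : fast a -> exists C, 0 <= C /\ forall h, cnorm1 h <= 1 ->
  cnorm1 (ev a (z + h) - ev a z - h * weighted_sum a (fun n => n%:R * z ^+ n.-1))
  <= C * cnorm1 h ^+ 2.
Proof.
move=> fa; pose r := 1 + cnorm1 z; have z0 := cnorm1_ge0 z.
have [C hC] := fast_halving (fast_natr (fast_natr (fast_geometric r fa))).
have C0 : 0 <= C.
  by have := le_trans (normr_ge0 _) (hC 0%N); rewrite expr0 mulr1.
exists (2 * C + 2 * C); split; first by rewrite addr_ge0// mulr_ge0.
move=> h h1.
rewrite -[ev a (z + h)]/(weighted_sum a (fun n => (z + h) ^+ n)).
rewrite -[ev a z]/(weighted_sum a (fun n => z ^+ n)).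
rewrite -weighted_sumZ//; last exact: growth_dpow.
have gh : geometric_growth (fun n => h * (n%:R * z ^+ n.-1)).
  have [s [s0 hs]] := growth_dpow z; exists s; split => // n.
  apply: (le_trans (cnorm1M _ _)); apply: le_trans (hs n).
  by rewrite ler_piMl// cnorm1_ge0.
rewrite -weighted_sumB; [|exact: fa|exact: growth_pow..].
rewrite -weighted_sumB; [|exact: fa|exact: growthB (growth_pow _) (growth_pow _)|exact: gh].
have H0 : 0 <= cnorm1 h ^+ 2 by exact: sqr_ge0.
have key n (p : R) : `|p| <= cnorm1 ((z + h) ^+ n - z ^+ n - h * (n%:R * z ^+ n.-1)) ->
    `|a n * p| <= C * cnorm1 h ^+ 2 * 2^-1 ^+ n.
  move=> hp; rewrite mulrAC.
  apply: (@le_trans _ _ (`|n%:R * (n%:R * (a n * r ^+ n))| * cnorm1 h ^+ 2)); last first.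
    by rewrite ler_wpM2r.
  rewrite !normrM; apply: (@le_trans _ _ (`|a n| * ((n%:R * (n%:R * r ^+ n)) * cnorm1 h ^+ 2))).
    rewrite ler_wpM2l//; apply: (le_trans hp); apply: pow_quadratic; rewrite /r; first by lra.
      by lra.
    by apply: (le_trans (cnorm1D _ _)); lra.
  rewrite le_eqVlt; apply/orP; left; apply/eqP.
  by rewrite !normr_nat normrX (@ger0_norm _ r) ?addr_ge0//; ring.
rewrite {1}/cnorm1/= mulrDl -!mulrA; apply: lerD; apply: tsum_bound => n; apply: key.
  by rewrite /cnorm1 lerDl.
by rewrite /cnorm1 lerDr.
Qed.

Lemma ev_derivable a z : fast a -> derivable (ev a : R[i]^o -> R[i]^o) z 1.
Proof.
move=> fa; have [C [C0 hC]] := ev_quadratic z fa.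
set d := weighted_sum _ _ in hC.
apply/cvg_ex; exists d; apply/cvgrPdist_le => e e0.
(* In the order of [R[i]] a positive element is real. *)
have [e1 e2] : 0 < Re e /\ e = (Re e)%:C%C.
  case: e e0 => e1 e2; rewrite ltcE/= => /andP[/eqP -> ?]; split => //.
(* The factor 4 is the square of the 2 in [cnorm1_le_normc]. *)
have C1 : 0 < 4 * C + 1 by rewrite ltr_wpDl// mulr_ge0.
have p1 : 0 < (Re e / (4 * C + 1))%:C%C :> R[i] by rewrite ltcR divr_gt0.
have p2 : 0 < (2^-1)%:C%C :> R[i] by rewrite ltcR invr_gt0.
near=> h.
have h0 : h != 0 by near: h; exact: nbhs_dnbhs_neq.
have hn0 : 0 < Normc.normc h.
  have := normr_gt0 h; rewrite h0.
  by rewrite -[`|h|]/((Normc.normc h)%:C%C) ltcR.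
have he : `|h| <= (Re e / (4 * C + 1))%:C%C by near: h; exact: dnbhs0_le.
have h2 : `|h| <= (2^-1)%:C%C by near: h; exact: dnbhs0_le.
have {}he : Normc.normc h <= Re e / (4 * C + 1) by rewrite -lecR.
have {}h2 : Normc.normc h <= 2^-1 by rewrite -lecR.
have h3 : cnorm1 h <= 1.
  by apply: (le_trans (cnorm1_le_normc h)); move: h2; lra.
have := hC h h3; rewrite [z + h]addrC; set q := (X in cnorm1 X <= _) => hq.
rewrite [h *: 1]mulr1.
have -> : d - h^-1 *: (ev a (h + z) - ev a z) = - (h^-1 * q).
  by rewrite /q mulrBr mulrA mulVf// mul1r opprB.
rewrite normrN e2 -[`|_|]/((Normc.normc (h^-1 * q))%:C%C) lecR Normc.normcM Normc.normcV.
rewrite ler_pdivrMl//.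
apply: (le_trans (normc_le_cnorm1 q)); apply: (le_trans hq).
have h4 : cnorm1 h ^+ 2 <= (2 * Normc.normc h) ^+ 2.
  by rewrite lerXn2r ?nnegrE ?cnorm1_ge0 ?cnorm1_le_normc// mulr_ge0// ltW.
apply: (@le_trans _ _ (C * (2 * Normc.normc h) ^+ 2)); first by rewrite ler_wpM2l.
have : Normc.normc h * (4 * C + 1) <= Re e by rewrite -ler_pdivlMr.
move=> h5; rewrite expr2; apply: (@le_trans _ _ (Normc.normc h * (Normc.normc h * (4 * C + 1)))).
  rewrite -subr_ge0.
  have -> (x : R) : x * (x * (4 * C + 1)) - C * (2 * x * (2 * x)) = x * x by ring.
  by rewrite mulr_ge0// ltW.
by rewrite ler_wpM2l// ltW.
Unshelve. all: by end_near. Qed.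

Lemma ev_continuous a z : fast a -> {for z, continuous (ev a : R[i]^o -> R[i]^o)}.
Proof.
by move=> fa; apply/differentiable_continuous/derivable1_diffP; exact: ev_derivable.
Qed.

End Weights.

(** * Trigonometric series with rapidly decreasing coefficients *)

Section FourierSeries.
Context {R : realType}.
Implicit Types (a b : nat -> R) (t x y : R).

Definition cos_series a t : R := tsum (fun n => a n * cos (n%:R * t)).

Definition sin_series a t : R := tsum (fun n => a n * sin (n%:R * t)).

Lemma is_derive_cosM (k t : R) : is_derive t 1 (fun s => cos (k * s)) (- (k * sin (k * t))).
Proof.
have dk : is_derive t 1 (fun s => k * s) k.
  by have := @is_deriveZ R R R id k t 1 1 (is_derive_id _ _); rewrite [k *: 1]mulr1.
have := @is_derive1_comp R cos (fun s => k * s) t _ _ (is_derive_cos _) dk.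
by rewrite mulNr mulrC.
Qed.

Lemma is_derive_sinM (k t : R) : is_derive t 1 (fun s => sin (k * s)) (k * cos (k * t)).
Proof.
have dk : is_derive t 1 (fun s => k * s) k.
  by have := @is_deriveZ R R R id k t 1 1 (is_derive_id _ _); rewrite [k *: 1]mulr1.
have := @is_derive1_comp R sin (fun s => k * s) t _ _ (is_derive_sin _) dk.
by rewrite mulrC.
Qed.

Lemma norm_cos_le1 t : `|cos t| <= 1 :> R.
Proof. by rewrite ler_norml cos_geN1 cos_le1. Qed.

Lemma norm_sin_le1 t : `|sin t| <= 1 :> R.
Proof. by rewrite ler_norml sin_geN1 sin_le1. Qed.

(** The function and its first two derivatives, all bounded by 1, are kept abstract so that cosine
    and sine series share one proof. *)
Lemma is_derive_trig_series (f g h : R -> R) (a : nat -> R) x :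
  (forall k t, 0 <= k -> is_derive t 1 (fun s => f (k * s)) (k * g (k * t))) ->
  (forall k t, 0 <= k -> is_derive t 1 (fun s => g (k * s)) (k * h (k * t))) ->
  (forall t, `|f t| <= 1) -> (forall t, `|g t| <= 1) -> (forall t, `|h t| <= 1) ->
  fast a -> is_derive x 1 (fun t => tsum (fun n => a n * f (n%:R * t)))
    (tsum (fun n => n%:R * a n * g (n%:R * x))).
Proof.
move=> df dg f1 g1 h1 fa.
have [B hB] := fast_halving fa; have [G hG] := fast_halving (fast_natr fa).
have [L hL] := fast_halving (fast_natr (fast_natr fa)).
have xI : x - 1 < x < x + 1 by apply/andP; split; lra.
apply: (@is_derive_tsum _ (x - 1) (x + 1) x L (fun n t => a n * f (n%:R * t)) _ B G) => //.
- by move=> y _ n; rewrite normrM; apply: le_trans (hB n); rewrite ler_piMr.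
- by move=> n; rewrite normrM; apply: le_trans (hG n); rewrite ler_piMr.
move=> n y yI.
have -> : a n * f (n%:R * y) - a n * f (n%:R * x) - (y - x) * (n%:R * a n * g (n%:R * x)) =
  a n * (f (n%:R * y) - f (n%:R * x) - (y - x) * (n%:R * g (n%:R * x))) by ring.
have := @quadratic_remainder R (x - 1) (x + 1) (fun s => f (n%:R * s))
  (fun s => n%:R * g (n%:R * s)) (n%:R * n%:R) x y.
have lip s t : x - 1 < s < x + 1 -> x - 1 < t < x + 1 ->
    `|n%:R * g (n%:R * t) - n%:R * g (n%:R * s)| <= n%:R * n%:R * `|t - s|.
  move=> sI tI; rewrite -mulrBr normrM normr_nat -mulrA ler_wpM2l//.
  apply: (@mean_value_le R (x - 1) (x + 1) (fun s => g (n%:R * s))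
    (fun s => n%:R * h (n%:R * s))) => // r _; first exact: dg.
  by rewrite normrM normr_nat ler_piMr.
move=> /(_ (fun s _ => df _ s (ler0n _ _)) lip xI yI) q.
rewrite normrM; apply: (le_trans (ler_wpM2l (normr_ge0 _) q)).
rewrite mulrA ler_wpM2r ?sqr_ge0//; apply: le_trans (hL n).
by rewrite !normrM !normr_nat; lra.
Qed.

Lemma fast_opp a : fast a -> fast (fun n => - a n).
Proof. by move=> /(fastZ (-1))/fast_le; apply => n; rewrite mulN1r. Qed.

Lemma is_derive_cos_series a x : fast a ->
  is_derive x 1 (cos_series a) (sin_series (fun n => - (n%:R * a n)) x).
Proof.
move=> fa; have := @is_derive_trig_series cos (fun t => - sin t) (fun t => - cos t) a x.
rewrite /sin_series (_ : (fun n => - _ * _) = (fun n => n%:R * a n * - sin (n%:R * x))); last first.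
  by apply/funext => n; rewrite mulNr mulrN.
apply => //.
- by move=> k t _; rewrite mulrN; exact: is_derive_cosM.
- by move=> k t _; rewrite mulrN; apply: is_deriveN; exact: is_derive_sinM.
- exact: norm_cos_le1.
- by move=> t; rewrite normrN norm_sin_le1.
- by move=> t; rewrite normrN norm_cos_le1.
Qed.

Lemma is_derive_sin_series a x : fast a ->
  is_derive x 1 (sin_series a) (cos_series (fun n => n%:R * a n) x).
Proof.
move=> fa; apply: (@is_derive_trig_series sin cos (fun t => - sin t) a x) => //.
- by move=> k t _; exact: is_derive_sinM.
- by move=> k t _; rewrite mulrN; exact: is_derive_cosM.
- exact: norm_sin_le1.
- exact: norm_cos_le1.
- by move=> t; rewrite normrN norm_sin_le1.
Qed.

(** A class stable under differentiation, so that membership alone gives smoothness of every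
    order. *)
Definition trig_mx (f : R -> 'M[R]_2) := exists a b : 'I_2 -> 'I_2 -> nat -> R,
  (forall i j, fast (a i j)) /\ (forall i j, fast (b i j)) /\
  forall t i j, f t i j = cos_series (a i j) t + sin_series (b i j) t.

Lemma trig_mx_derive f : trig_mx f -> (forall x, derivable f x 1) /\ trig_mx (derive1 f).
Proof.
move=> [a [b [fa [fb fE]]]].
have d i j x : is_derive x 1 (fun t => f t i j)
    (cos_series (fun n => n%:R * b i j n) x + sin_series (fun n => - (n%:R * a i j n)) x).
  rewrite (_ : (fun t => _) = cos_series (a i j) + sin_series (b i j)); last first.
    by apply/funext => t; rewrite fE.
  by rewrite [X in is_derive _ _ _ X]addrC; apply: is_deriveD;
    [exact: is_derive_cos_series|exact: is_derive_sin_series].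
have df x : derivable f x 1 by apply/derivable_mxP => i j; have [] := d i j x.
split => //; exists (fun i j n => n%:R * b i j n), (fun i j n => - (n%:R * a i j n)).
split; [|split].
- by move=> i j; exact: fast_natr.
- by move=> i j; exact/fast_opp/fast_natr.
- by move=> t i j; rewrite derive1E (derive_mx (df t)) mxE; have [_ ->] := d i j t.
Qed.

Lemma trig_mx_smooth f : trig_mx f -> smooth1 setT f.
Proof.
move=> tf n x _; elim: n f tf => [|n IH] f /trig_mx_derive[df tf]; first exact: df.
by rewrite derive1Sn; exact: IH.
Qed.

Lemma Re_expi (t : R) n : complex.Re ((cos t +i* sin t)%C ^+ n) = cos (n%:R * t) /\
  complex.Im ((cos t +i* sin t)%C ^+ n) = sin (n%:R * t).
Proof.
elim: n => [|n [IH1 IH2]]; first by rewrite !expr0 mul0r cos0 sin0.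
by rewrite exprS cReM cImM IH1 IH2 /= -natr1 mulrDl mul1r [_ + t]addrC cosD sinD; split; ring.
Qed.

End FourierSeries.

(** * From coefficient sequences to twisted loops *)

Section LoopSeries.
Context {R : realType}.
Implicit Types (P : nat -> 'M[R]_2) (z : R[i]).

Definition fast_mx P := forall i j, fast (fun n => P n i j).

Definition mxev P z : 'M[R[i]]_2 := \matrix_(i, j) ev (fun n => P n i j) z.

(** The coefficient form of the twisting condition: diagonal entries vanish for odd [n],
    off-diagonal ones for even [n]. *)
Definition twisted P := forall n i j,
  (-1) ^+ n * P n i j = (if i == j then 1 else -1) * P n i j.

Lemma mxev_conj P z : fast_mx P -> map_mx (@conjc R) (mxev P (conjc z)) = mxev P z.
Proof.
by move=> fP; apply/matrixP => i j; rewrite !mxE ev_conj; [rewrite conjcK|exact: fP].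
Qed.

Lemma mxev_twisted P z : fast_mx P -> twisted P -> mxev P (- z) = Ad (e3 R[i]) (mxev P z).
Proof.
move=> fP tP; apply/matrixP => i j; rewrite Ad_e3E !mxE evN.
rewrite (@ev_ext _ _ (fun n => (if i == j then 1 else -1) * P n i j)); last first.
  by move=> n; exact: tP.
rewrite (@evZ _ (if i == j then 1 else -1) (fun n => P n i j)); last exact: fP.
by case: (i == j); congr (_ * _); apply: eq_ReIm => /=; rewrite ?oppr0.
Qed.

Lemma inv_expi (t : R) : ((cos t +i* sin t)%C)^-1 = conjc (cos t +i* sin t)%C.
Proof.
have h : (cos t +i* sin t)%C * conjc (cos t +i* sin t)%C = 1.
  apply: eq_ReIm; rewrite ?cReM ?cImM /=; last by ring.
  by rewrite mulrN opprK -!expr2 cos2Dsin2.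
have n0 : (cos t +i* sin t)%C != 0.
  by apply/eqP => h0; move: h; rewrite h0 mul0r => /eqP; rewrite eq_sym oner_eq0.
by rewrite -[LHS]mulr1 -h mulrA mulVf// mul1r.
Qed.

(** On the unit circle the parts of [z^n] are [cos (n t)] and [sin (n t)], and [z^-1] is the
    conjugate of [z], which only reverses the sine coefficients. *)
Lemma mxev_circle P : fast_mx P ->
  [/\ trig_mx (fun t => mxRe (mxev P (cos t +i* sin t)%C)),
      trig_mx (fun t => mxIm (mxev P (cos t +i* sin t)%C)),
      trig_mx (fun t => mxRe (mxev P ((cos t +i* sin t)%C)^-1)) &
      trig_mx (fun t => mxIm (mxev P ((cos t +i* sin t)%C)^-1))].
Proof.
move=> fP.
have f0 : fast (fun=> 0 : R) by move=> r _; exists 0 => n; rewrite normr0 mul0r.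
have z0 (f : R -> R) : tsum (fun n => 0 * f n%:R) = 0.
  by rewrite (_ : (fun _ => _) = fun=> 0) ?tsum0//; apply/funext => n; rewrite mul0r.
have c0 t : cos_series (fun=> 0) t = 0 :> R by rewrite /cos_series (z0 (fun r => cos (r * t))).
have s0 t : sin_series (fun=> 0) t = 0 :> R by rewrite /sin_series (z0 (fun r => sin (r * t))).
split; [exists (fun i j n => P n i j), (fun _ _ _ => 0)
  |exists (fun _ _ _ => 0), (fun i j n => P n i j)
  |exists (fun i j n => P n i j), (fun _ _ _ => 0)
  |exists (fun _ _ _ => 0), (fun i j n => - P n i j)];
  (split; [|split]) => //; try (by move=> i j; exact: fP);
  try (by move=> i j; apply: fast_opp; exact: fP);
  move=> t i j; rewrite ?c0 ?s0 ?addr0 ?add0r ?inv_expi !mxE /=; congr tsum; apply/funext => n.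
- by rewrite (Re_expi t n).1.
- by rewrite (Re_expi t n).2.
- by rewrite -(Re_expi t n).1 -(ReX_conj _ n).1.
- by rewrite -(Re_expi t n).2 mulNr -mulrN -(ReX_conj _ n).2.
Qed.

Lemma mxev_loop P : fast_mx P -> twisted P -> (forall z, \det (mxev P z) = 1) ->
  loop_group (mxev P) /\ loop_group (fun l => mxev P l^-1).
Proof.
move=> fP tP dP; have [h1 h2 h3 h4] := mxev_circle fP.
split; split; try exact: trig_mx_smooth; move=> l _; split => //.
- exact: mxev_conj.
- exact: mxev_twisted.
- by rewrite -conjc_inv; exact: mxev_conj.
- by rewrite invrN; exact: mxev_twisted.
Qed.

Lemma mxev_holomorphic P : fast_mx P -> holomorphic_on_disc (mxev P).
Proof.
move=> fP i j; have E : (fun z : R[i]^o => mxev P z i j : R[i]^o) = ev (fun n => P n i j).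
  by apply/funext => z; rewrite mxE.
rewrite E; split.
  apply: continuous_subspaceT => z; exact: (ev_continuous (fP i j)).
by move=> z _; exact: (ev_derivable (fP i j)).
Qed.

Lemma mxev0 P : fast_mx P -> mxev P 0 = toC (P 0%N).
Proof.
by move=> fP; apply/matrixP => i j; rewrite !mxE evS ?mul0r ?addr0//; exact: fP.
Qed.

Lemma mxev_plus P : fast_mx P -> twisted P -> (forall z, \det (mxev P z) = 1) ->
  loop_group_plus (mxev P).
Proof.
by move=> fP tP dP; split; [exact: (mxev_loop fP tP dP).1|exact: mxev_holomorphic].
Qed.

(** In the chart at infinity the loop is the series itself. The value Id prescribed at the origin of
    the chart is the constant coefficient, so the definition by cases introduces no jump. *)
Lemma mxev_minus P : fast_mx P -> twisted P -> (forall z, \det (mxev P z) = 1) ->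
  P 0%N = 1%:M -> loop_group_minus (fun l => mxev P l^-1).
Proof.
move=> fP tP dP P0; split; first exact: (mxev_loop fP tP dP).2.
rewrite (_ : (fun z => _) = mxev P); first exact: mxev_holomorphic.
apply/funext => z; rewrite invrK; case: eqP => // ->.
rewrite mxev0// P0; apply/matrixP => i j; rewrite !mxE; case: (i == j) => //.
Qed.

Lemma fast_mxP (B : nat -> R) P : fast B -> (forall n i j, `|P n i j| <= B n) -> fast_mx P.
Proof.
by move=> fB h i j; apply: fast_le fB _ => n; apply: (le_trans (h n i j)); exact: ler_norm.
Qed.

Lemma fast_mxD P Q : fast_mx P -> fast_mx Q -> fast_mx (fun n => P n + Q n).
Proof.
move=> fP fQ i j; apply: fast_le (fastD (fP i j) (fQ i j)) _ => n.
by rewrite mxE.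
Qed.

Lemma fast_mxN P : fast_mx P -> fast_mx (fun n => - P n).
Proof. by move=> fP i j; apply: fast_le (fP i j) _ => n; rewrite mxE normrN. Qed.

Lemma fast_mxMr P A : fast_mx P -> fast_mx (fun n => P n *m A).
Proof.
move=> fP i j; apply: fast_le (fastD (fastZ (A 0 j) (fP i 0)) (fastZ (A 1 j) (fP i 1))) _ => n.
by rewrite mulmx2E [_ * A 0 j]mulrC [_ * A 1 j]mulrC.
Qed.

Lemma fast_mxMl P A : fast_mx P -> fast_mx (fun n => A *m P n).
Proof.
move=> fP i j; apply: fast_le (fastD (fastZ (A i 0) (fP 0 j)) (fastZ (A i 1) (fP 1 j))) _ => n.
by rewrite mulmx2E.
Qed.

Lemma fast_mxS P : fast_mx P -> fast_mx (fun n => P n.+1).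
Proof. by move=> fP i j; exact: (fastS (fP i j)). Qed.

Lemma mxevD P Q z : fast_mx P -> fast_mx Q ->
  mxev (fun n => P n + Q n) z = mxev P z + mxev Q z.
Proof.
move=> fP fQ; apply/matrixP => i j; rewrite !mxE -evD; [|exact: fP|exact: fQ].
by apply: ev_ext => n; rewrite mxE.
Qed.

Lemma mxevN P z : fast_mx P -> mxev (fun n => - P n) z = - mxev P z.
Proof.
move=> fP; apply/matrixP => i j; rewrite !mxE -mulN1r.
have -> : -1 = (-1 : R)%:C%C by apply: eq_ReIm => /=; rewrite ?oppr0.
rewrite -evZ; last exact: fP.
by apply: ev_ext => n; rewrite mxE mulN1r.
Qed.

Lemma mxevMr P A z : fast_mx P -> mxev (fun n => P n *m A) z = mxev P z *m toC A.
Proof.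
move=> fP; apply/matrixP => i j; rewrite mulmx2E !mxE.
rewrite [_ * _%:C%C]mulrC [ev (fun n => P n i 1) z * _]mulrC -!evZ; try exact: fP.
rewrite -evD; [|exact/fastZ/fP..].
by apply: ev_ext => n; rewrite mulmx2E; ring.
Qed.

Lemma mxevMl P A z : fast_mx P -> mxev (fun n => A *m P n) z = toC A *m mxev P z.
Proof.
move=> fP; apply/matrixP => i j; rewrite mulmx2E !mxE -!evZ; try exact: fP.
rewrite -evD; [|exact/fastZ/fP..].
by apply: ev_ext => n; rewrite mulmx2E.
Qed.

Lemma mxevS P z : fast_mx P -> mxev P z = toC (P 0%N) + z *: mxev (fun n => P n.+1) z.
Proof. by move=> fP; apply/matrixP => i j; rewrite !mxE evS//; exact: fP. Qed.

Lemma mxev_tr P z : mxev (fun n => (P n)^T) z = (mxev P z)^T.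
Proof. by apply/matrixP => i j; rewrite !mxE; apply: ev_ext => n; rewrite mxE. Qed.

Lemma mcder_mxev (p q x : R) (f : nat -> R -> 'M[R]_2) (g : nat -> 'M[R]_2)
    (B L G : nat -> R) z :
  p < x < q -> fast B -> fast L -> fast G ->
  (forall n y i j, p < y < q -> `|f n y i j| <= B n) ->
  (forall n i j, `|g n i j| <= G n) ->
  (forall n y i j, p < y < q ->
    `|f n y i j - f n x i j - (y - x) * g n i j| <= L n * (y - x) ^+ 2) ->
  mcder (fun y => mxev (f^~ y) z) x (mxev g z).
Proof.
move=> xpq fB fL fG hB hG hL i j; rewrite mxE.
apply: (cder_ext (f := fun y => ev (fun n => f n y i j) z) xpq).
  by move=> y _; rewrite mxE.
apply: (@cder_ev R p q x (fun n y => f n y i j) (fun n => g n i j) B L G) => //.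
- by move=> n y ypq; exact: hB.
- by move=> n y ypq; exact: hL.
Qed.

End LoopSeries.

(** * Entrywise calculus of real matrix functions *)

Section RealMatrixCalculus.
Context {R : realType}.
Implicit Types (f g : R -> 'M[R]_2) (t : R).

Definition rmder f t (D : 'M[R]_2) := forall i j, is_derive t 1 (fun s => f s i j) (D i j).

Lemma rmder_eq f t D E : D = E -> rmder f t D -> rmder f t E.
Proof. by move=> ->. Qed.

Lemma rmder_cst A t : rmder (fun=> A) t 0.
Proof. by move=> i j; rewrite mxE; exact: is_derive_cst. Qed.

Lemma rmderD f g t D E : rmder f t D -> rmder g t E -> rmder (fun s => f s + g s) t (D + E).
Proof.
move=> df dg i j; rewrite mxE (_ : (fun s => _) = (fun s => f s i j) + (fun s => g s i j)).
  exact: is_deriveD (df i j) (dg i j).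
by apply/funext => s; rewrite mxE.
Qed.

Lemma rmderN f t D : rmder f t D -> rmder (fun s => - f s) t (- D).
Proof.
move=> df i j; rewrite mxE (_ : (fun s => _) = - (fun s => f s i j)).
  exact: is_deriveN (df i j).
by apply/funext => s; rewrite mxE.
Qed.

Lemma rmderB f g t D E : rmder f t D -> rmder g t E -> rmder (fun s => f s - g s) t (D - E).
Proof. by move=> df dg; apply: rmderD => //; exact: rmderN. Qed.

Lemma rmderM f g t D E : rmder f t D -> rmder g t E ->
  rmder (fun s => f s *m g s) t (D *m g t + f t *m E).
Proof.
move=> df dg i j.
rewrite (_ : (fun s => _) = (fun s => f s i 0) * (fun s => g s 0 j)
  + (fun s => f s i 1) * (fun s => g s 1 j)); last first.
  by apply/funext => s; rewrite mulmx2E.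
apply: is_derive_eq (is_deriveD (is_deriveM (df i 0) (dg 0 j))
  (is_deriveM (df i 1) (dg 1 j))) _.
by rewrite mxE !mulmx2E /GRing.scale/=; ring.
Qed.

Lemma rmder_ext a b f g t D : a < t < b -> (forall s, a < s < b -> f s = g s) ->
  rmder f t D -> rmder g t D.
Proof. by move=> tab fg h i j; apply: (is_derive_itv_ext tab _ (h i j)) => s sab; rewrite fg. Qed.

Lemma rmderZ (f : R -> R) A t d : is_derive t 1 f d -> rmder (fun s => f s *: A) t (d *: A).
Proof.
move=> fd i j; rewrite mxE (_ : (fun s => _) = (A i j *: (f : R -> R))); last first.
  by apply/funext => s; rewrite mxE mulrC.
by rewrite mulrC; exact: is_deriveZ.
Qed.

Lemma rmder_mx2 (p q r s : R -> R) t p' q' r' s' :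
  is_derive t 1 p p' -> is_derive t 1 q q' -> is_derive t 1 r r' -> is_derive t 1 s s' ->
  rmder (fun x => mx2 (p x) (q x) (r x) (s x)) t (mx2 p' q' r' s').
Proof.
move=> hp hq hr hs i j; rewrite mxE.
rewrite (_ : (fun x => _) = if i == ord0 then (if j == ord0 then p else q)
  else (if j == ord0 then r else s)); last first.
  by apply/funext => x; rewrite mxE; case: ifP => _; case: ifP.
by case: ifP => _; case: ifP.
Qed.

Variables a b : R.

Definition blip f (B L : R) :=
  (forall t i j, a < t < b -> `|f t i j| <= B) /\
  forall s t i j, a < s < b -> a < t < b -> `|f t i j - f s i j| <= L * `|t - s|.

Lemma blipD f g B L B' L' : blip f B L -> blip g B' L' ->
  blip (fun t => f t + g t) (B + B') (L + L').
Proof.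
move=> [f1 f2] [g1 g2]; split.
  move=> t i j tab; rewrite mxE; apply: (le_trans (ler_normD _ _)).
  by apply: lerD; [exact: f1|exact: g1].
move=> s t i j sab tab; rewrite !mxE opprD addrACA mulrDl.
by apply: (le_trans (ler_normD _ _)); apply: lerD; [exact: f2|exact: g2].
Qed.

Lemma blipN f B L : blip f B L -> blip (fun t => - f t) B L.
Proof.
move=> [f1 f2]; split.
  by move=> t i j tab; rewrite mxE normrN; exact: f1.
by move=> s t i j sab tab; rewrite !mxE -opprD normrN; exact: f2.
Qed.

Lemma blipM f g B L B' L' : 0 <= B -> 0 <= B' -> 0 <= L -> 0 <= L' ->
  blip f B L -> blip g B' L' ->
  blip (fun t => f t *m g t) (2 * B * B') (2 * (L * B' + B * L')).
Proof.
move=> B0 B'0 L0 L'0 [f1 f2] [g1 g2]; split.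
  by move=> t i j tab; apply: mulmx2_bound => // k l; [exact: f1|exact: g1].
move=> s t i j sab tab; rewrite !mulmx2E.
have -> (x y z w : R) : x + y - (z + w) = (x - z) + (y - w) by ring.
have key k : `|f t i k * g t k j - f s i k * g s k j| <= (L * B' + B * L') * `|t - s|.
  have -> (x y z w : R) : x * y - z * w = (x - z) * y + z * (y - w) by ring.
  apply: (le_trans (ler_normD _ _)); rewrite !normrM mulrDl; apply: lerD.
    by rewrite mulrAC; apply: ler_pM => //; [exact: f2|exact: g1].
  by rewrite -mulrA; apply: ler_pM => //; [exact: f1|exact: g2].
apply: (le_trans (ler_normD _ _)).
by rewrite -mulrA mulr_natl mulr2n; apply: lerD; exact: key.
Qed.

End RealMatrixCalculus.

(** * Parity of the Picard terms for an off-diagonal coefficient *)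

Section PicardParity.
Context {R : realType}.
Variables (C : R -> 'M[R]_2) (t0 : R).
Hypotheses (C00 : forall t, C t 0 0 = 0) (C11 : forall t, C t 1 1 = 0).

Lemma itg0 (c t : R) : itg (fun=> 0) c t = 0 :> R.
Proof.
have z A : Rintegral (@lebesgue_measure R) A (fun=> 0) = 0.
  by rewrite /Rintegral integral0.
by rewrite /itg !z oppr0 if_same.
Qed.

Lemma I2E (i : 'I_2) : i = 0 \/ i = 1.
Proof. by case: i => [[|[|]]//= h]; [left|right]; apply/val_inj. Qed.

(** Each multiplication by the off-diagonal [C] exchanges diagonal and off-diagonal matrices, and
    the series starts from Id. *)
Lemma picard_parity n t i j : (i == j) = odd n -> picard C t0 n t i j = 0.
Proof.
elim: n t i j => [|n IH] t i j /= ij; first by rewrite mxE ij.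
rewrite mxE (_ : (fun s => _) = fun=> 0) ?itg0//; apply/funext => s.
rewrite mulmx2E; move: ij.
by have [->|->] := I2E i; have [->|->] := I2E j; rewrite ?C00 ?C11 ?mulr0 ?add0r ?addr0 => ij;
  rewrite IH ?mul0r//=; case: (odd n) ij.
Qed.

Lemma twisted_picard t : twisted (fun n => picard C t0 n t).
Proof.
move=> n i j; have [h|h] := eqVneq (i == j) (odd n); first by rewrite picard_parity// !mulr0.
rewrite -signr_odd; move: h; case: (odd n); case: (i == j) => //.
Qed.

End PicardParity.

(** * Matrix functions in the regularity classes *)

Section MatrixClass.
Context {R : realType}.
Variables a b : R.
Implicit Types f g : R -> R -> 'M[R]_2.

Definition CLm n f := forall i j, CL a b n (fun x y => f x y i j).

Lemma CLm_mx2 n (p q r s : R -> R -> R) : CL a b n p -> CL a b n q -> CL a b n r ->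
  CL a b n s -> CLm n (fun x y => mx2 (p x y) (q x y) (r x y) (s x y)).
Proof.
move=> hp hq hr hs i j; have [->|->] := I2E i; have [->|->] := I2E j.
- by apply: CL_ext hp => x y _ _; rewrite mx2E.
- by apply: CL_ext hq => x y _ _; rewrite mx2E.
- by apply: CL_ext hr => x y _ _; rewrite mx2E.
- by apply: CL_ext hs => x y _ _; rewrite mx2E.
Qed.

Lemma CLmD n f g : CLm n f -> CLm n g -> CLm n (fun x y => f x y + g x y).
Proof. by move=> hf hg i j; apply: CL_ext (CLD (hf i j) (hg i j)) => x y _ _; rewrite mxE. Qed.

Lemma mxscaleE k (A : 'M[R]_2) i j : (k *: A) i j = k * A i j.
Proof. by rewrite mxE. Qed.

Lemma mxsubE (A B : 'M[R]_2) i j : (A - B) i j = A i j - B i j.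
Proof. by rewrite !mxE. Qed.

Lemma CLmB n f g : CLm n f -> CLm n g -> CLm n (fun x y => f x y - g x y).
Proof. by move=> hf hg i j; apply: CL_ext (CLB (hf i j) (hg i j)) => x y _ _; rewrite mxsubE. Qed.

Lemma CLmM n f g : CLm n f -> CLm n g -> CLm n (fun x y => f x y *m g x y).
Proof.
move=> hf hg i j.
apply: CL_ext (CLD (CLM (hf i 0) (hg 0 j)) (CLM (hf i 1) (hg 1 j))) => x y _ _.
by rewrite mulmx2E.
Qed.

Lemma CLm_cst n A : CLm n (fun _ _ => A).
Proof. by move=> i j; exact: CL_cst. Qed.

Lemma entrywise_bound (P : 'I_2 -> 'I_2 -> R -> Prop) :
  (forall i j m m', m <= m' -> P i j m -> P i j m') ->
  (forall i j, exists m, 0 <= m /\ P i j m) -> exists m, 0 <= m /\ forall i j, P i j m.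
Proof.
move=> mono h; have [p [p0 hp]] := h 0 0; have [q [q0 hq]] := h 0 1.
have [r [r0 hr]] := h 1 0; have [t [t0 ht]] := h 1 1.
exists (p + q + (r + t)); split; first by rewrite !addr_ge0.
by move=> i j; have [->|->] := I2E i; have [->|->] := I2E j;
  [move: hp|move: hq|move: hr|move: ht]; apply: mono; lra.
Qed.

(** A single constant serves all entries, both variables and both kinds of bound, so the Picard
    estimates apply on every slice with the same majorant. *)
Lemma uniform_blip f : CLm 0 f -> exists D, [/\ 0 <= D,
  forall x, a < x < b -> blip a b (f x) D D & forall y, a < y < b -> blip a b (f^~ y) D D].
Proof.
move=> hf; pose g i j x y := f x y i j.
have [|i j|D [D0 hD]] := @entrywise_bound (fun i j m =>
    [/\ bound2 a b (g i j) m, lipx a b (g i j) m & lipy a b (g i j) m]).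
- move=> i j m m' mm' [h1 h2 h3]; split=> x y z *.
  + by apply: le_trans mm'; exact: h1.
  + by apply: le_trans (ler_wpM2r (normr_ge0 _) mm'); exact: h2.
  + by apply: le_trans (ler_wpM2r (normr_ge0 _) mm'); exact: h3.
- by have [m [m0 h1 h2 h3]] := CL_lip (hf i j); exists m.
exists D; split => // [x xab|y yab]; split=> [t i j tab|t r i j tab rab];
  have [h1 h2 h3] := hD i j; [exact: h1|exact: h3|exact: h1|exact: h2].
Qed.

End MatrixClass.

(** * The embedding of real matrices into complex ones *)

Section RealToComplex.
Context {R : realType}.
Implicit Types A B : 'M[R]_2.

Lemma toCM A B : toC (A *m B) = toC A *m toC B. Proof. exact: map_mxM. Qed.

Lemma toCN A : toC (- A) = - toC A. Proof. exact: map_mxN. Qed.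

Lemma toCD A B : toC (A + B) = toC A + toC B. Proof. exact: map_mxD. Qed.

Lemma toC_tr A : (toC A)^T = toC A^T. Proof. by apply/matrixP => i j; rewrite !mxE. Qed.

Lemma toCE A i j : toC A i j = (A i j)%:C%C. Proof. by rewrite mxE. Qed.

Lemma toCI : injective (@toC R).
Proof.
move=> A B AB; apply/matrixP => i j.
by have := congr1 (fun M : 'M[R[i]]_2 => complex.Re (M i j)) AB; rewrite /= !toCE.
Qed.

End RealToComplex.

(** * The Picard series at a complex parameter *)

Section PicardEvaluation.
Context {R : realType}.
Variables (C : R -> 'M[R]_2) (a b t0 K : R).
Hypotheses (t0ab : a < t0 < b) (K0 : 0 <= K) (CK : blip a b C K K).
Hypotheses (C00 : forall t, C t 0 0 = 0) (C11 : forall t, C t 1 1 = 0).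

Let P t n := picard C t0 n t.

Lemma fast_picard t : a < t < b -> fast_mx (P t).
Proof.
move=> tab; apply: (fast_mxP (fast_picard_majorant a b K)) => n i j.
exact: (picard_bound t0ab K0 CK.1 CK.2).
Qed.

Lemma mcder_picard z t : a < t < b ->
  mcder (fun r => mxev (P r) z) t (z *: (mxev (P t) z *m toC (C t))).
Proof.
move=> tab.
(* The derivative of term [n] is term [n - 1] times [C]: the sequence is shifted by one, with 0 in
   front, and the shift produces the factor [z]. *)
pose Q n : 'M[R]_2 := if n is m.+1 then P t m else 0.
have fQ : fast_mx Q.
  apply: (fast_mxP (fast_pred (fast_picard_majorant a b K))) => -[|n] i j /=.
    by rewrite mxE normr0 (picard_majorant_ge0 t0ab K0).
  exact: (picard_bound t0ab K0 CK.1 CK.2).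
have -> : z *: (mxev (P t) z *m toC (C t)) = mxev (fun n => dpicard C t0 n t) z.
  rewrite (_ : (fun n => _) = fun n => Q n *m C t); last first.
    by apply/funext => -[|n] //=; rewrite mul0mx.
  by rewrite mxevMr// [mxev Q z]mxevS// /toC map_mx0 add0r scalemxAl.
apply: (@mcder_mxev _ a b t (fun n t => picard C t0 n t) _ (picard_majorant a b K)
  (picard_remainder a b K) (dpicard_majorant a b K)) => //.
- exact: fast_picard_majorant.
- exact: fast_picard_remainder.
- exact: fast_dpicard_majorant.
- by move=> n r i j rab; exact: (picard_bound t0ab K0 CK.1 CK.2).
- by move=> n i j; exact: (dpicard_bound t0ab K0 CK.1 CK.2).
- by move=> n r i j rab; exact: (picard_quadratic t0ab K0 CK.1 CK.2).
Qed.

Lemma mxev_picard_base z : mxev (P t0) z = 1%:M.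
Proof.
rewrite mxevS; last exact: fast_picard.
rewrite (_ : mxev _ z = 0) ?scaler0 ?addr0.
  by rewrite /P picard_base/= /toC map_mx1.
apply/matrixP => i j; rewrite !mxE.
have z0 (v : nat -> R) : tsum (fun n => P t0 n.+1 i j * v n) = 0.
  rewrite (_ : (fun _ => _) = fun=> 0) ?tsum0//; apply/funext => n.
  by rewrite /P picard_base/= mxE mul0r.
by apply: eq_ReIm => /=; exact: z0.
Qed.

(** Liouville formula: the coefficient has zero diagonal, so the derivative of the determinant
    vanishes identically. *)
Lemma det_mxev_picard z t : a < t < b -> \det (mxev (P t) z) = 1.
Proof.
move=> tab.
suff -> : \det (mxev (P t) z) = \det (mxev (P t0) z) by rewrite mxev_picard_base det1.
have E r : \det (mxev (P r) z) = mxev (P r) z 0 0 * mxev (P r) z 1 1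
    - mxev (P r) z 0 1 * mxev (P r) z 1 0 by exact: det_mx2.
rewrite !E; apply: (cder0_const (f := fun r => mxev (P r) z 0 0 * mxev (P r) z 1 1
    - mxev (P r) z 0 1 * mxev (P r) z 1 0) _ t0ab tab) => r rab.
have d := mcder_picard z rab.
apply: cder_eq (cderD (cderM (d 0 0) (d 1 1)) (cderN (cderM (d 0 1) (d 1 0)))).
have E' i j : (z *: (mxev (P r) z *m toC (C r))) i j =
    z * (mxev (P r) z i 0 * (C r 0 j)%:C%C + mxev (P r) z i 1 * (C r 1 j)%:C%C).
  by rewrite mxE mulmx2E !(mxE map_mx_key).
rewrite !E' C00 C11.
have -> : (0 : R)%:C%C = 0 by [].
move: (mxev _ _ 0 0) (mxev _ _ 0 1) (mxev _ _ 1 0) (mxev _ _ 1 1) => p q v w.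
by ring.
Qed.

End PicardEvaluation.

(** * The explicit Birkhoff factors on one square *)

Section Frame.
Context {R : realType}.
Variables (a b : R) (s0 b1 b2 g1 g2 : R -> R) (u s : R -> R -> R).

Definition coefc1 x y := g1 y * expR (u x y).

Definition coefc2 x y := g2 y * expR (- u x y).

Definition mxc x y : 'M[R]_2 := mx2 0 (coefc1 x y) (coefc2 x y) 0.

Definition mxb x : 'M[R]_2 := mx2 0 (b1 x) (b2 x) 0.

Definition mxg x : 'M[R]_2 := mx2 0 (g1 x) (g2 x) 0.

Definition mxs x y : 'M[R]_2 := s x y *: e3 R.

Definition mxs0 x : 'M[R]_2 := s0 x *: e3 R.

Hypotheses (hs0 : smooth_data a b s0) (hb1 : smooth_data a b b1)
  (hb2 : smooth_data a b b2) (hg1 : smooth_data a b g1) (hg2 : smooth_data a b g2).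
Hypotheses (hu : forall n, CL a b n u) (hs : forall n, CL a b n s).
Hypothesis ux : partialx a b u (fun x y => 2 * s x y).
Hypothesis sy : partialy a b s (fun x y => b2 x * coefc1 x y - b1 x * coefc2 x y).
Hypotheses (u_diag : forall x, a < x < b -> u x x = 0)
  (s_diag : forall x, a < x < b -> s x x = s0 x).

Lemma coefc1_CL n : CL a b n coefc1.
Proof. by apply: CLM; [exact: CL_swap (hg1 n)|exact/CL_expR]. Qed.

Lemma coefc2_CL n : CL a b n coefc2.
Proof. by apply: CLM; [exact: CL_swap (hg2 n)|exact/CL_expR/CLN]. Qed.

Lemma mxc_CL n : CLm a b n mxc.
Proof. by apply: CLm_mx2; [exact: CL_cst|exact: coefc1_CL|exact: coefc2_CL|exact: CL_cst]. Qed.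

Lemma mxb_CL n : CLm a b n (fun x y => mxb x).
Proof. by apply: CLm_mx2; [exact: CL_cst|exact: hb1|exact: hb2|exact: CL_cst]. Qed.

Lemma mxg_CL n : CLm a b n (fun x y => mxg x).
Proof. by apply: CLm_mx2; [exact: CL_cst|exact: hg1|exact: hg2|exact: CL_cst]. Qed.

Lemma mxs_CL n : CLm a b n mxs.
Proof.
move=> i j; apply: CL_ext (CLM (hs n) (CL_cst a b n (e3 R i j))) => x y _ _.
by rewrite [RHS]mxE.
Qed.

Lemma mxs0_CL n : CLm a b n (fun x y => mxs0 x).
Proof.
move=> i j; apply: CL_ext (CLM (hs0 n) (CL_cst a b n (e3 R i j))) => x y _ _.
by rewrite [RHS]mxE.
Qed.

Lemma mxc_diag x : a < x < b -> mxc x x = mxg x.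
Proof. by move=> xab; rewrite /mxc /coefc1 /coefc2 u_diag// oppr0 expR0 !mulr1. Qed.

Lemma partialx_coefc1 : partialx a b coefc1 (fun x y => 2 * s x y * coefc1 x y).
Proof.
move=> x y xab yab.
have h := is_deriveZ (g1 y) (is_derive_comp_expR (ux xab yab)).
by apply: is_derive_eq h _; rewrite /coefc1 /GRing.scale/=; ring.
Qed.

Lemma partialx_coefc2 : partialx a b coefc2 (fun x y => - (2 * s x y * coefc2 x y)).
Proof.
move=> x y xab yab.
have h := is_deriveZ (g2 y) (is_derive_comp_expR (is_deriveN (ux xab yab))).
by apply: is_derive_eq h _; rewrite /coefc2 /GRing.scale/=; ring.
Qed.

(** This is [[c, S]]. By powers of [l], flatness splits into [c_x = [c, S]], which follows from
    [u_x = 2 s], and [S_y = [b, c]], which is the equation for [u]. *)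
Definition mxc_x x y := mxc x y *m mxs x y - mxs x y *m mxc x y.

Lemma mxc_x_CL n : CLm a b n mxc_x.
Proof.
exact: CLmB (CLmM (mxc_CL n) (mxs_CL n)) (CLmM (mxs_CL n) (mxc_CL n)).
Qed.

Lemma rmder_mxc x y : a < x < b -> a < y < b -> rmder (mxc^~ y) x (mxc_x x y).
Proof.
move=> xab yab.
have -> : mxc_x x y = mx2 0 (2 * s x y * coefc1 x y) (- (2 * s x y * coefc2 x y)) 0.
  apply: mx2P; rewrite /mxc_x /mxc /mxs mxsubE !mulmx2E ?mxscaleE /e3 !mx2E;
  ring.
exact: rmder_mx2 (is_derive_cst _ _ _) (partialx_coefc1 xab yab)
  (partialx_coefc2 xab yab) (is_derive_cst _ _ _).
Qed.

Lemma rmder_mxs x y : a < x < b -> a < y < b ->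
  rmder (mxs x) y (mxb x *m mxc x y - mxc x y *m mxb x).
Proof.
move=> xab yab.
have -> : mxb x *m mxc x y - mxc x y *m mxb x =
    (b2 x * coefc1 x y - b1 x * coefc2 x y) *: e3 R.
  apply: mx2P; rewrite /mxb /mxc mxsubE !mulmx2E ?mxscaleE /e3 !mx2E;
  ring.
by apply: rmderZ; exact: sy.
Qed.

(** For fixed [x], the series of [V_y = l^-1 V c] started at [y = x]. The base point moves with [x],
    which is why the derivative in [x] needs an argument of its own. *)
Definition Mseq x y n := picard (mxc x) x n y.
Arguments Mseq : simpl never.

Lemma Mseq0 x y : Mseq x y 0 = 1%:M. Proof. by []. Qed.

Definition Mpred x y n : 'M[R]_2 := if n is m.+1 then Mseq x y m else 0.

(* The coefficient of [l^-n] in [H_- (S + l b) - (s0 e3 + l b + l^-1 g) H_-]. *)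
Definition Mx x y n := Mseq x y n *m mxs x y + Mseq x y n.+1 *m mxb x
  - (mxs0 x *m Mseq x y n + mxb x *m Mseq x y n.+1 + mxg x *m Mpred x y n).

Lemma Mseq_diag x n : Mseq x x n = if n == 0%N then 1%:M else 0.
Proof. exact: picard_base. Qed.

Lemma MseqS x y n i j :
  Mseq x y n.+1 i j = J2 (fun x t => (Mseq x t n *m mxc x t) i j) x y.
Proof. by rewrite /Mseq/= mxE. Qed.

Lemma Mseq_CL k n : CLm a b k (fun x y => Mseq x y n).
Proof.
elim: n => [|n IH]; first exact: CLm_cst.
move=> i j; apply: CL_ext (CL_J2 (CLmM IH (mxc_CL k) i j)) => x y _ _.
by rewrite MseqS.
Qed.

Lemma Mpred_CL k n : CLm a b k (fun x y => Mpred x y n).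
Proof. by case: n => [|n]; [exact: CLm_cst|exact: Mseq_CL]. Qed.

Lemma rmder_Mseq_y x y n : a < x < b -> a < y < b ->
  rmder (fun t => Mseq x t n) y (Mpred x y n *m mxc x y).
Proof.
move=> xab yab; case: n => [|n] /=; first by rewrite mul0mx; exact: rmder_cst.
move=> i j; have h := partialy_J2 (CL_lip (CLmM (Mseq_CL 0 n) (mxc_CL 0) i j)) xab yab.
by apply: (is_derive_itv_ext yab _ h) => t tab; rewrite MseqS.
Qed.

Lemma rmder_Mpred_y x y n : a < x < b -> a < y < b ->
  rmder (fun t => Mpred x t n) y ((if n is m.+1 then Mpred x y m else 0) *m mxc x y).
Proof.
move=> xab yab; case: n => [|n]; last exact: rmder_Mseq_y.
by rewrite mul0mx; exact: rmder_cst.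
Qed.

(** By flatness the terms in [s0], [b] and [g] regroup into [Mx (n - 1)]. What remains is the
    recursion [(M n)_y = M (n - 1) c] differentiated in [x], with [Mx] in place of the derivative of
    [M]. *)
Lemma rmder_Mx_y x y n : a < x < b -> a < y < b ->
  rmder (fun t => Mx x t n) y
  ((if n is m.+1 then Mx x y m else 0) *m mxc x y + Mpred x y n *m mxc_x x y).
Proof.
move=> xab yab.
have dM k := rmder_Mseq_y k xab yab.
have d1 := rmderD (rmderM (dM n) (rmder_mxs xab yab)) (rmderM (dM n.+1) (rmder_cst (mxb x) y)).
have d2 := rmderD (rmderD (rmderM (rmder_cst (mxs0 x) y) (dM n))
  (rmderM (rmder_cst (mxb x) y) (dM n.+1)))
  (rmderM (rmder_cst (mxg x) y) (rmder_Mpred_y n xab yab)).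
apply: rmder_eq (rmderB d1 d2); rewrite !mulmx0 !mul0mx !addr0 !add0r /=.
case: n {dM d1 d2} => [|n] /=.
  rewrite Mseq0 !mul1mx !mul0mx !mulmx0 !addr0 !add0r.
  by apply/matrixP => i j; rewrite !mxE; ring.
rewrite /Mx /mxc_x !(mulmxDl, mulmxDr, mulNmx, mulmxN, mulmxA).
by apply/matrixP => i j; rewrite !mxE; ring.
Qed.

Lemma Mx_diag x n : a < x < b -> Mx x x n = - (Mpred x x n *m mxg x).
Proof.
move=> xab; rewrite /Mx; have -> : mxs x x = mxs0 x by rewrite /mxs s_diag.
case: n => [|[|n]] /=; rewrite !Mseq_diag/= ?mulmx0
  ?mul0mx ?mul1mx ?mulmx1 ?addr0 ?add0r ?subrr ?oppr0//.
Qed.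

Lemma Mx_CL k n : CLm a b k (fun x y => Mx x y n).
Proof.
apply: CLmB; first by apply: CLmD; apply: CLmM;
  [exact: Mseq_CL|exact: mxs_CL|exact: Mseq_CL|exact: mxb_CL].
apply: CLmD; last by apply: CLmM; [exact: mxg_CL|exact: Mpred_CL].
by apply: CLmD; apply: CLmM; [exact: mxs0_CL|exact: Mseq_CL|exact: mxb_CL|exact: Mseq_CL].
Qed.

Lemma antiderivative_J2 (f g : R -> R -> R) : partialy a b f g -> lip2 a b g ->
  eq2 a b f (fun x y => f x x + J2 g x y).
Proof.
move=> fg lg x y xab yab.
have h t : a < t < b -> is_derive t 1 (fun t => f x t - J2 g x t) 0.
  by move=> tab; rewrite -(subrr (g x t));
    exact: is_deriveB (fg _ _ xab tab) (partialy_J2 lg xab tab).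
have := derive0_const h xab yab; rewrite J2_diag; lra.
Qed.

(** Since [M (n + 1)] is an integral from [y = x], its derivative in [x] is minus the diagonal value
    of [M n c] plus the integral of the derivative of [M n c]. The candidate [Mx (n + 1)] has the
    same derivative in [y] and the same diagonal value. *)
Lemma rmder_Mseq_x x y n : a < x < b -> a < y < b ->
  rmder (fun t => Mseq t y n) x (Mx x y n).
Proof.
elim: n x y => [|n IH] x y xab yab.
  (* Term 0 is constant, so its candidate derivative has to vanish: it is 0 on the diagonal and its
     derivative in [y] is 0. *)
  have -> : Mx x y 0 = 0.
    apply/matrixP => i j.
    have h t : a < t < b -> is_derive t 1 (fun t => Mx x t 0 i j) 0.
      move=> tab; have := rmder_Mx_y 0 xab tab i j.
      by rewrite /= !mul0mx addr0 mxE.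
    have := derive0_const h xab yab.
    by rewrite Mx_diag//= mul0mx oppr0.
  exact: rmder_cst.
pose P x y := Mseq x y n *m mxc x y.
pose Px x y := Mx x y n *m mxc x y + Mseq x y n *m mxc_x x y.
have PCL k : CLm a b k P := CLmM (Mseq_CL k n) (mxc_CL k).
have PxCL k : CLm a b k Px.
  by apply: CLmD; apply: CLmM; [exact: Mx_CL|exact: mxc_CL|exact: Mseq_CL|exact: mxc_x_CL].
have dP i j : partialx a b (fun x y => P x y i j) (fun x y => Px x y i j).
  by move=> t r tab rab; exact: rmderM (IH _ _ tab rab) (rmder_mxc tab rab) i j.
have dMx i j : partialy a b (fun x y => Mx x y n.+1 i j) (fun x y => Px x y i j).
  by move=> t r tab rab; exact: rmder_Mx_y n.+1 tab rab i j.
move=> i j.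
have h := partialx_J2 (dP i j) (CL_lip (PCL 0 i j)) (CL_lip (PxCL 0 i j)) xab yab.
rewrite (antiderivative_J2 (dMx i j) (CL_lip (PxCL 0 i j)) xab yab) Mx_diag//.
have -> : (- (Mpred x x n.+1 *m mxg x)) i j = - P x x i j.
  by rewrite mxE /P mxc_diag.
by apply: (is_derive_itv_ext xab _ h) => t tab; rewrite MseqS.
Qed.

(** The majorant depends on the square and not on the base point [x], because one constant bounds
    [c] on all slices. *)
Lemma Mseq_bound : exists B, [/\ fast B, forall n, 0 <= B n &
  forall n x y i j, a < x < b -> a < y < b -> `|Mseq x y n i j| <= B n].
Proof.
have [D [D0 cx cy]] := uniform_blip (mxc_CL 0).
have [ba|ab] := leP b a.
  exists (fun=> 0); split => // [r _|n x y i j /andP[? ?] _].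
    by exists 0 => n; rewrite normr0 mul0r.
  by exfalso; lra.
exists (picard_majorant a b D); split; first exact: fast_picard_majorant.
  have mid : a < (a + b) / 2 < b by apply/andP; split; lra.
  exact: picard_majorant_ge0 mid D0.
move=> n x y i j xab yab; have [c1 c2] := cx x xab.
exact: (picard_bound xab D0 c1 c2).
Qed.

Lemma fast_Mseq x y : a < x < b -> a < y < b -> fast_mx (Mseq x y).
Proof.
move=> xab yab; have [B [fB _ hB]] := Mseq_bound.
by apply: (fast_mxP fB) => n i j; exact: hB.
Qed.

Lemma fast_Mpred x y : a < x < b -> a < y < b -> fast_mx (Mpred x y).
Proof.
move=> xab yab; have [B [fB B0 hB]] := Mseq_bound.
apply: (fast_mxP (fast_pred fB)) => -[|n] i j /=; first by rewrite mxE normr0.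
exact: hB.
Qed.

Definition Hminus (z : R[i]) x y := mxev (Mseq x y) z.

Lemma mxev_Mpred z x y : a < x < b -> a < y < b -> mxev (Mpred x y) z = z *: Hminus z x y.
Proof.
move=> xab yab; rewrite mxevS; last exact: fast_Mpred.
by rewrite /toC map_mx0 add0r.
Qed.

Lemma mxev_MseqS z x y : a < x < b -> a < y < b ->
  z *: mxev (fun n => Mseq x y n.+1) z = Hminus z x y - 1%:M.
Proof.
move=> xab yab; rewrite /Hminus [in RHS]mxevS; last exact: fast_Mseq.
by rewrite Mseq0 /toC map_mx1 [1%:M + _]addrC addrK.
Qed.

Lemma mcder_Hminus_y z x y : a < x < b -> a < y < b ->
  mcder (Hminus z x) y (z *: (Hminus z x y *m toC (mxc x y))).
Proof.
move=> xab yab; have [D [D0 cx _]] := uniform_blip (mxc_CL 0).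
exact: (mcder_picard xab D0 (cx x xab)).
Qed.

Lemma Mx_bound : exists G, [/\ fast G, forall n, 0 <= G n &
  forall n x y i j, a < x < b -> a < y < b -> `|Mx x y n i j| <= G n].
Proof.
have [B [fB B0 hB]] := Mseq_bound.
have hBp n x y i j : a < x < b -> a < y < b -> `|Mpred x y n i j| <= B n.-1.
  by move=> xab yab; case: n => [|n] /=; [rewrite mxE normr0|exact: hB].
have [Ds [Ds0 _ sy']] := uniform_blip (mxs_CL 0).
have [D0 [D00 _ s0y]] := uniform_blip (mxs0_CL 0).
have [Db [Db0 _ by']] := uniform_blip (mxb_CL 0).
have [Dg [Dg0 _ gy]] := uniform_blip (mxg_CL 0).
exists (fun n => 2 * (B n * Ds + B n.+1 * Db + (D0 * B n + Db * B n.+1 + Dg * B n.-1))).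
split.
- apply: fastZ; apply: fastD.
    apply: fastD; [apply: fast_le (fastZ Ds fB) _|apply: fast_le (fastZ Db (fastS fB)) _] => n;
    by rewrite mulrC.
  by apply: fastD; [apply: fastD; [exact: fastZ|exact/fastZ/fastS]|exact/fastZ/fast_pred].
- by move=> n; rewrite !(mulr_ge0, addr_ge0).
- move=> n x y i j xab yab.
  have [ms _] := sy' y yab; have [m0 _] := s0y y yab.
  have [mb _] := by' y yab; have [mg _] := gy y yab.
  rewrite mxsubE !mulrDr; apply: (le_trans (ler_normB _ _)); apply: lerD.
    rewrite mxE !mulrA; apply: (le_trans (ler_normD _ _)).
    by apply: lerD; apply: mulmx2_bound => // k l; by [exact: hB|exact: ms|exact: mb].
  rewrite mxE !mulrA; apply: (le_trans (ler_normD _ _)); apply: lerD.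
    rewrite mxE; apply: (le_trans (ler_normD _ _)).
    by apply: lerD; apply: mulmx2_bound => // k l; by [exact: hB|exact: m0|exact: mb].
  by apply: mulmx2_bound => // k l; by [exact: hBp|exact: mg].
Qed.

Lemma Mseq_blip : exists B G, [/\ fast B, fast G, forall n, 0 <= B n, forall n, 0 <= G n &
  forall n y, a < y < b -> blip a b (fun x => Mseq x y n) (B n) (G n)].
Proof.
have [B [fB B0 hB]] := Mseq_bound; have [G [fG G0 hG]] := Mx_bound.
exists B, G; split => // n y yab; split; first by move=> t i j tab; exact: hB.
move=> r t i j rab tab.
apply: (mean_value_le (a := a) (b := b) (f := fun x => Mseq x y n i j)
  (g := fun x => Mx x y n i j)) => // q qab; last exact: hG.
exact: rmder_Mseq_x.
Qed.

(** These Lipschitz constants give the quadratic remainders in [x] of the terms, by which the series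
    for [H_-] is differentiated in [x]. *)
Lemma Mx_lip : exists L, fast L /\ forall n x x' y i j, a < x < b -> a < x' < b ->
  a < y < b -> `|Mx x' y n i j - Mx x y n i j| <= L n * `|x' - x|.
Proof.
have [B [G [fB fG B0 G0 hBG]]] := Mseq_blip.
have hp n y : a < y < b -> blip a b (fun x => Mpred x y n) (B n.-1) (G n.-1).
  move=> yab; case: n => [|n] /=; last exact: hBG.
  split => [t i j _|t r i j _ _]; first by rewrite mxE normr0.
  by rewrite mxE subrr normr0 mulr_ge0.
have [Ds [Ds0 _ sy']] := uniform_blip (mxs_CL 0).
have [D0 [D00 _ s0y]] := uniform_blip (mxs0_CL 0).
have [Db [Db0 _ by']] := uniform_blip (mxb_CL 0).
have [Dg [Dg0 _ gy]] := uniform_blip (mxg_CL 0).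
pose T (D : R) (k : nat -> nat) (n : nat) := 2 * (G (k n) * D + B (k n) * D).
pose T' (D : R) (k : nat -> nat) (n : nat) := 2 * (D * B (k n) + D * G (k n)).
exists (fun n => T Ds id n + T Db S n + (T' D0 id n + T' Db S n + T' Dg predn n)); split.
- have fT D k : fast (fun n => B (k n)) -> fast (fun n => G (k n)) -> fast (T D k).
    move=> h1 h2; apply: fast_le (fastZ (2 * D) (fastD h2 h1)) _ => n.
    by rewrite /T -mulrDl mulrA mulrAC.
  have fT' D k : fast (fun n => B (k n)) -> fast (fun n => G (k n)) -> fast (T' D k).
    move=> h1 h2; apply: fast_le (fastZ (2 * D) (fastD h1 h2)) _ => n.
    by rewrite /T' -mulrDr mulrA.
  have fBS := fastS fB; have fGS := fastS fG.
  apply: fastD; first by apply: fastD; exact: fT.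
  by apply: fastD; [apply: fastD; exact: fT'|apply: fT'; exact: fast_pred].
- move=> n x x' y i j xab xab' yab.
  have h1 := blipM (B0 n) Ds0 (G0 n) Ds0 (hBG n y yab) (sy' y yab).
  have h2 := blipM (B0 n.+1) Db0 (G0 n.+1) Db0 (hBG n.+1 y yab) (by' y yab).
  have h3 := blipM D00 (B0 n) D00 (G0 n) (s0y y yab) (hBG n y yab).
  have h4 := blipM Db0 (B0 n.+1) Db0 (G0 n.+1) (by' y yab) (hBG n.+1 y yab).
  have h5 := blipM Dg0 (B0 n.-1) Dg0 (G0 n.-1) (gy y yab) (hp n y yab).
  have [_ h] := blipD (blipD h1 h2) (blipN (blipD (blipD h3 h4) h5)).
  exact: h.
Qed.

Lemma mcder_Hminus_mxev z x y : a < x < b -> a < y < b ->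
  mcder (Hminus z ^~ y) x (mxev (Mx x y) z).
Proof.
move=> xab yab.
have [B [fB B0 hB]] := Mseq_bound; have [G [fG G0 hG]] := Mx_bound.
have [L [fL hL]] := Mx_lip.
apply: (@mcder_mxev _ a b x (fun n t => Mseq t y n) _ B L G) => //.
- by move=> n t i j tab; exact: hB.
- by move=> n i j; exact: hG.
- move=> n t i j tab.
  apply: (quadratic_remainder (a := a) (b := b) (f := fun t => Mseq t y n i j)
    (g := fun t => Mx t y n i j)) => // [r rab|r q rab qab]; last exact: hL.
  exact: rmder_Mseq_x.
Qed.

Definition mxalpha (l : R[i]) x := toC (mxs0 x) + l *: toC (mxb x) + l^-1 *: toC (mxg x).

Definition mxA (l : R[i]) x y := toC (mxs x y) + l *: toC (mxb x).

(** The terms [Mx n] are summed with weight [l^-n]. The shifted series is [l (H_- - Id)], and the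
    two contributions [l b] of Id cancel. *)
Lemma mcder_Hminus_x l x y : l != 0 -> a < x < b -> a < y < b ->
  mcder (Hminus l^-1 ^~ y) x
    (Hminus l^-1 x y *m mxA l x y - mxalpha l x *m Hminus l^-1 x y).
Proof.
move=> l0 xab yab; apply: mcder_eq (mcder_Hminus_mxev l^-1 xab yab).
have fM := fast_Mseq xab yab; have fS := fast_mxS fM; have fp := fast_Mpred xab yab.
have hS : mxev (fun n => Mseq x y n.+1) l^-1 = l *: (Hminus l^-1 x y - 1%:M).
  by rewrite -mxev_MseqS// scalerA divff// scale1r.
have f1 := fast_mxMr (mxs x y) fM; have f2 := fast_mxMr (mxb x) fS.
have f3 := fast_mxMl (mxs0 x) fM; have f4 := fast_mxMl (mxb x) fS.
have f5 := fast_mxMl (mxg x) fp.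
rewrite /Mx mxevD; [|exact: fast_mxD f1 f2|exact: fast_mxN (fast_mxD (fast_mxD f3 f4) f5)].
rewrite mxevN; last exact: fast_mxD (fast_mxD f3 f4) f5.
rewrite mxevD// (mxevD _ (fast_mxD f3 f4) f5) (mxevD _ f3 f4).
rewrite !mxevMr// !mxevMl// hS mxev_Mpred// -/(Hminus l^-1 x y).
rewrite /mxA /mxalpha; move: (Hminus _ _ _) => H.
rewrite !(mulmxDl, mulmxDr, mulmxBl, mulmxBr, scalerBr, mul1mx, mulmx1) -!scalemxAl -!scalemxAr.
rewrite !mulNmx !mulmxN -!scalemxAl -!scalemxAr mul1mx mulmx1.
move: (H *m toC (mxs x y)) (H *m toC (mxb x)) (toC (mxs0 x) *m H) (toC (mxb x) *m H)
  (toC (mxg x) *m H) (toC (mxb x)) => m1 m2 m3 m4 m5 m6.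
by apply/matrixP => i j; rewrite !mxE; ring.
Qed.

Lemma det_Hminus z x y : a < x < b -> a < y < b -> \det (Hminus z x y) = 1.
Proof.
move=> xab yab; have [D [D0 cx _]] := uniform_blip (mxc_CL 0).
by apply: (det_mxev_picard xab D0 (cx x xab)) => // t; rewrite mx2E.
Qed.

Lemma Hminus_diag z x : a < x < b -> Hminus z x x = 1%:M.
Proof.
move=> xab; have [D [D0 cx _]] := uniform_blip (mxc_CL 0).
exact: (mxev_picard_base xab D0 (cx x xab)).
Qed.

Lemma Hminus_loop x y : a < x < b -> a < y < b ->
  loop_group_minus (fun l => Hminus l^-1 x y).
Proof.
move=> xab yab; apply: mxev_minus => //; first exact: fast_Mseq.
- by apply: twisted_picard => t; rewrite mx2E.
- by move=> z; exact: det_Hminus.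
Qed.

(* The gauge diag (e^(u/2), e^(-u/2)) absorbs the degree-0 term [S] of the equation for [H_+]:
   its remaining factor solves, after transposition, an equation with off-diagonal
   coefficient [mxat], to which the Picard series applies. *)
Definition mxat y x : 'M[R]_2 :=
  mx2 0 (- (b2 x * expR (u x y))) (- (b1 x * expR (- u x y))) 0.

Lemma mxat_blip y : a < y < b -> exists D, 0 <= D /\ blip a b (mxat y) D D.
Proof.
move=> yab.
have h : CLm a b 0 (fun x y => mxat y x).
  apply: CLm_mx2; try exact: CL_cst.
    by apply/CLN/CLM; [exact: hb2|exact/CL_expR].
  by apply/CLN/CLM; [exact: hb1|exact/CL_expR/CLN].
by have [D [D0 _ hy]] := uniform_blip h; exists D; split => //; exact: hy.
Qed.

Lemma mxat00 y x : mxat y x 0 0 = 0.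
Proof. exact: mx2_00. Qed.

Lemma mxat11 y x : mxat y x 1 1 = 0.
Proof. exact: mx2_11. Qed.

Definition mxgauge x y : 'M[R]_2 := mx2 (expR (u x y / 2)) 0 0 (expR (- (u x y / 2))).

Definition Nseq x y n := mxgauge x y *m (picard (mxat y) y n x)^T.

Definition Hplus (l : R[i]) x y := mxev (Nseq x y) l.

Lemma HplusE l x y : a < x < b -> a < y < b ->
  Hplus l x y = toC (mxgauge x y) *m (mxev (fun n => picard (mxat y) y n x) l)^T.
Proof.
move=> xab yab; have [D [D0 hD]] := mxat_blip yab.
rewrite /Hplus /Nseq mxevMl ?mxev_tr// => i j.
by apply: fast_le (fast_picard yab D0 hD xab j i) _ => n; rewrite mxE.
Qed.

Lemma fast_Nseq x y : a < x < b -> a < y < b -> fast_mx (Nseq x y).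
Proof.
move=> xab yab; have [D [D0 hD]] := mxat_blip yab.
apply: fast_mxMl => i j.
by apply: fast_le (fast_picard yab D0 hD xab j i) _ => n; rewrite mxE.
Qed.

Lemma det_Hplus l x y : a < x < b -> a < y < b -> \det (Hplus l x y) = 1.
Proof.
move=> xab yab; have [D [D0 hD]] := mxat_blip yab.
rewrite HplusE// det_mulmx det_tr (det_mxev_picard yab D0 hD (mxat00 y) (mxat11 y))//.
rewrite mulr1 /toC det_map_mx det_mx2 !mx2E mulr0 subr0 -expRD subrr expR0.
by [].
Qed.

(** The gauge is diagonal and transposition respects parity, so the twisting of the Picard terms is
    inherited. *)
Lemma Nseq_twisted x y : twisted (Nseq x y).
Proof.
move=> n i j; rewrite /Nseq mulmx2E ![_^T _ _]mxE.
have h := twisted_picard y (mxat00 y) (mxat11 y) x n j i.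
have [ei|ei] := I2E i; subst i; rewrite !mx2E mul0r ?add0r ?addr0 mulrCA [RHS]mulrCA eq_sym;
by congr (_ * _).
Qed.

Lemma Hplus_loop x y : a < x < b -> a < y < b -> loop_group_plus (fun l => Hplus l x y).
Proof.
move=> xab yab; apply: mxev_plus; first exact: fast_Nseq.
- exact: Nseq_twisted.
- by move=> z; exact: det_Hplus.
Qed.

Lemma Hplus_diag l x : a < x < b -> Hplus l x x = 1%:M.
Proof.
move=> xab; have [D [D0 hD]] := mxat_blip xab.
rewrite HplusE// (mxev_picard_base xab D0 hD) trmx1 mulmx1.
rewrite /mxgauge u_diag// mul0r oppr0 expR0.
by apply: mx2P; rewrite mxE mx2E scalar_mx2E.
Qed.

Lemma rmder_mxgauge x y : a < x < b -> a < y < b ->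
  rmder (mxgauge^~ y) x (- (mxs x y *m mxgauge x y)).
Proof.
move=> xab yab.
have du : is_derive x 1 (fun x => u x y / 2) (s x y).
  have h := is_deriveZ (2^-1) (ux xab yab).
  rewrite (_ : (fun x => _) = 2^-1 *: (u^~ y : R -> R)); last first.
    by apply/funext => t; rewrite mulrC.
  by apply: is_derive_eq h _; rewrite /GRing.scale/=; field.
have -> : - (mxs x y *m mxgauge x y) =
    mx2 (expR (u x y / 2) * s x y) 0 0 (expR (- (u x y / 2)) * - s x y).
  by apply: mx2P; rewrite [LHS]mxE /mxs /mxgauge mulmx2E !mxscaleE /e3 !mx2E; ring.
exact: rmder_mx2 (is_derive_comp_expR du) (is_derive_cst _ _ _) (is_derive_cst _ _ _)
  (is_derive_comp_expR (is_deriveN du)).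
Qed.

(** Conjugating [b] by the gauge multiplies its entries by [e^-u] and [e^u]; [mxat] is minus the
    transpose of the result. *)
Lemma gauge_mxat x y : mxgauge x y *m (mxat y x)^T = - (mxb x *m mxgauge x y).
Proof.
have E1 : expR (u x y) = expR (u x y / 2) * expR (u x y / 2) by rewrite -expRD -splitr.
have E2 : expR (- u x y) = expR (- (u x y / 2)) * expR (- (u x y / 2)).
  by rewrite -expRD -opprD -splitr.
have E3 : expR (u x y / 2) * expR (- (u x y / 2)) = 1 by exact: expRxMexpNx_1.
apply: mx2P; rewrite [RHS]mxE /mxgauge /mxat !mulmx2E ![_^T _ _]mxE !mx2E ?E1 ?E2; move: E3;
  move: (expR _) (expR _) => p q E3; try ring.
- by rewrite (_ : _ + _ = - (b1 x * p * (q * p))); [rewrite E3; ring|ring].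
- by rewrite (_ : _ + _ = - (b2 x * q * (q * p))); [rewrite E3; ring|ring].
Qed.

Lemma mcder_Hplus_x l x y : a < x < b -> a < y < b ->
  mcder (fun x => Hplus l x y) x (- (mxA l x y *m Hplus l x y)).
Proof.
move=> xab yab; have [D [D0 hD]] := mxat_blip yab.
pose T x := mxev (fun n => picard (mxat y) y n x) l.
have dT : mcder T x (l *: (T x *m toC (mxat y x))) := mcder_picard yab D0 hD l xab.
have dTt : mcder (fun x => (T x)^T) x (l *: (T x *m toC (mxat y x)))^T.
  move=> i j; rewrite mxE (_ : (fun s => _) = fun s => T s j i); first exact: dT.
  by apply/funext => t; rewrite mxE.
have dG := mcder_toC (rmder_mxgauge xab yab).
apply: (mcder_ext xab (F := fun x => toC (mxgauge x y) *m (T x)^T)).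
  by move=> t tab; rewrite HplusE.
apply: mcder_eq (mcderM dG dTt).
rewrite HplusE// -/(T x); move: (T x) => {dT dTt} Z.
have e : toC (mxgauge x y) *m toC (mxat y x)^T = - (toC (mxb x) *m toC (mxgauge x y)).
  by rewrite -toCM gauge_mxat toCN toCM.
rewrite /mxA mulmxDl mulmxA [(l *: _)^T]linearZ/= trmx_mul toC_tr -scalemxAr mulmxA e.
by rewrite toCN toCM !mulNmx scalerN -opprD -scalemxAl mulmxA.
Qed.

Lemma birkhoff_square (X : R -> R[i] -> 'M[R[i]]_2) l x y : l != 0 ->
  (forall t, a < t < b -> mcder (X^~ l) t (X t l *m mxalpha l t)) ->
  a < x < b -> a < y < b -> X x l *m (Hminus l^-1 x y *m Hplus l x y) = X y l.
Proof.
move=> l0 dX xab yab.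
have d t : a < t < b -> mcder (fun t => X t l *m (Hminus l^-1 t y *m Hplus l t y)) t 0.
  move=> tab.
  apply: mcder_eq (mcderM (dX t tab)
    (mcderM (mcder_Hminus_x l0 tab yab) (mcder_Hplus_x l tab yab))).
  move: (X t l) (Hminus _ _ _) (Hplus _ _ _) (mxalpha _ _) (mxA _ _ _) => U h p al am.
  by rewrite mulmxBl mulmxN -!mulmxA addrAC subrr sub0r mulmxN subrr.
rewrite (mcder0_const d yab xab) Hminus_diag// Hplus_diag// !mulmx1//.
Qed.

End Frame.

(** * The adjugate as the inverse of a matrix of determinant 1 *)

Section Adjugate2.
Context {K : comNzRingType}.
Implicit Types A B : 'M[K]_2.

(** Its entries are linear in those of [A], so it is differentiated and bounded without any
    division. *)
Definition adj2 A : 'M[K]_2 := mx2 (A 1 1) (- A 0 1) (- A 1 0) (A 0 0).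

Lemma mulmx_adj2 A : A *m adj2 A = (\det A)%:M.
Proof. by rewrite det_mx2; apply: mx2P; rewrite mulmx2E scalar_mx2E !mx2E/=; ring. Qed.

Lemma adj2_mulmx A : adj2 A *m A = (\det A)%:M.
Proof. by rewrite det_mx2; apply: mx2P; rewrite mulmx2E scalar_mx2E !mx2E/=; ring. Qed.

Lemma det_adj2 A : \det (adj2 A) = \det A.
Proof. by rewrite !det_mx2 !mx2E; ring. Qed.

Lemma tr2E A : \tr A = A 0 0 + A 1 1.
Proof.
by rewrite /mxtrace big_ord_recl big_ord1; congr (_ + A _ _); apply/val_inj.
Qed.

End Adjugate2.

Lemma invmx_adj2 (K : fieldType) (A : 'M[K]_2) : \det A = 1 -> invmx A = adj2 A.
Proof.
move=> dA; have AA : A *m adj2 A = 1%:M by rewrite mulmx_adj2 dA.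
have [u _] := mulmx1_unit AA.
by rewrite -[LHS]mulmx1 -AA mulmxA mulVmx// mul1mx.
Qed.

Lemma toC_adj2 (R : realType) (A : 'M[R]_2) : toC (adj2 A) = adj2 (toC A).
Proof. by apply: mx2P; rewrite !mxE/= ?rmorphN// !mxE. Qed.

(** * Uniqueness for linear equations on an interval *)

Section OdeUniqueness.
Context {R : realType}.
Variables (I : set R) (x0 : R).
Hypotheses (I_open : open I) (I_interval : is_interval I) (Ix0 : I x0).

(** Constancy results are stated on open intervals; one around both points is obtained by going
    slightly beyond each of them, which openness of [I] allows. *)
Lemma itv_inside x : I x -> exists p q, [/\ p < x < q, p < x0 < q &
  forall t, p < t < q -> I t].
Proof.
move=> Ix.
have nb y : I y -> exists p q, [/\ p < y < q, I p & I q].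
  move=> Iy; have /nbhs_ballP[e /= e0 he] : nbhs y I by exact: open_nbhs_nbhs.
  exists (y - e / 2), (y + e / 2); split; first by apply/andP; split; lra.
    by apply: he; rewrite /ball/= opprB addrC subrK ger0_norm; lra.
  by apply: he; rewrite /ball/= opprD addrA subrr sub0r normrN ger0_norm; lra.
have [p [q [/andP[px xq] Ip Iq]]] := nb _ Ix.
have [p0 [q0 [/andP[px0 xq0] Ip0 Iq0]]] := nb _ Ix0.
exists (Num.min p p0), (Num.max q q0); split.
- by apply/andP; split; [rewrite gt_min px|rewrite lt_max xq].
- by apply/andP; split; [rewrite gt_min px0 orbT|rewrite lt_max xq0 orbT].
- move=> t; rewrite gt_min lt_max => /andP[ht1 ht2].
  have [l Il lt] : exists2 l, I l & l < t.
    by case/orP: ht1 => h; [exists p|exists p0].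
  have [r Ir tr] : exists2 r, I r & t < r.
    by case/orP: ht2 => h; [exists q|exists q0].
  by apply: (I_interval Il Ir); rewrite (ltW lt) (ltW tr).
Qed.

Lemma mcder0_interval (U : R -> 'M[R[i]]_2) x : (forall t, I t -> mcder U t 0) -> I x ->
  U x = U x0.
Proof.
move=> dU Ix; have [p [q [xpq x0pq pqI]]] := itv_inside Ix.
by apply: (mcder0_const _ x0pq xpq) => t /pqI/dU.
Qed.

Lemma mcder_adj2 (V : R -> 'M[R[i]]_2) (al : 'M[R[i]]_2) t : al 0 0 + al 1 1 = 0 ->
  mcder V t (V t *m al) -> mcder (fun s => adj2 (V s)) t (- (al *m adj2 (V t))).
Proof.
move=> tr dV.
have E : - (al *m adj2 (V t)) = adj2 (V t *m al).
  have a11 : al 1 1 = - al 0 0 by apply/eqP; rewrite -subr_eq0 opprK addrC tr.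
  by apply: mx2P; rewrite [LHS]mxE !(mulmx2E, mx2E) a11; ring.
rewrite E => i j; have [->|->] := I2E i; have [->|->] := I2E j; rewrite mx2E.
- by rewrite (_ : (fun s => _) = fun s => V s 1 1)//; apply/funext => s; rewrite mx2E.
- rewrite (_ : (fun s => _) = fun s => - V s 0 1); first exact/cderN/dV.
  by apply/funext => s; rewrite mx2E.
- rewrite (_ : (fun s => _) = fun s => - V s 1 0); first exact/cderN/dV.
  by apply/funext => s; rewrite mx2E.
- by rewrite (_ : (fun s => _) = fun s => V s 0 0)//; apply/funext => s; rewrite mx2E.
Qed.

Variable al : R -> 'M[R[i]]_2.
Hypothesis al_tr : forall t, I t -> al t 0 0 + al t 1 1 = 0.

(** For two solutions of one equation with trace-free coefficient, [U V^-1] is constant. Written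
    with the adjugate, the case [U = V] says that the determinant is constant. *)
Lemma ode_adj2_const (U V : R -> 'M[R[i]]_2) x :
  (forall t, I t -> mcder U t (U t *m al t)) -> (forall t, I t -> mcder V t (V t *m al t)) ->
  I x -> U x *m adj2 (V x) = U x0 *m adj2 (V x0).
Proof.
move=> dU dV; apply: (@mcder0_interval (fun t => U t *m adj2 (V t))) => t It.
apply: mcder_eq (mcderM (dU t It) (mcder_adj2 (al_tr It) (dV t It))).
by rewrite mulmxN mulmxA subrr.
Qed.

Lemma ode_det (V : R -> 'M[R[i]]_2) x : (forall t, I t -> mcder V t (V t *m al t)) ->
  I x -> \det (V x) = \det (V x0).
Proof.
move=> dV Ix; have := ode_adj2_const dV dV Ix; rewrite !mulmx_adj2.
by move=> /(congr1 (fun M : 'M[R[i]]_2 => M 0 0)); rewrite !scalar_mx2E.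
Qed.

Lemma ode_unique (U V : R -> 'M[R[i]]_2) x :
  (forall t, I t -> mcder U t (U t *m al t)) -> (forall t, I t -> mcder V t (V t *m al t)) ->
  U x0 = V x0 -> \det (V x0) = 1 -> I x -> U x = V x.
Proof.
move=> dU dV UV0 d0 Ix.
have h : U x *m adj2 (V x) = 1%:M by rewrite (ode_adj2_const dU dV)// UV0 mulmx_adj2 d0.
by rewrite -[LHS]mulmx1 -(d0) -(ode_det dV Ix) -adj2_mulmx mulmxA h mul1mx.
Qed.

End OdeUniqueness.

(** * Uniform bounds from smoothness, and linear systems in two variables *)

Section Bounds.
Context {R : realType}.

Lemma segment_bound (f : R -> R) a b : a <= b ->
  (forall x, a <= x <= b -> {for x, continuous f}) ->
  exists M, forall x, a <= x <= b -> `|f x| <= M.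
Proof.
move=> ab cf.
have cw : {within `[a, b], continuous f}.
  by apply: continuous_in_subspaceT => x; rewrite inE/= in_itv/=; exact: cf.
have [c _ hc] := EVT_max ab cw; have [d _ hd] := EVT_min ab cw.
exists (`|f c| + `|f d|) => x xab; have xin : x \in `[a, b] by rewrite in_itv.
have := hc x xin; have := hd x xin.
have := ler_norm (f c); have := ler_norm (- f d); rewrite normrN => h1 h2 h3 h4.
have := normr_ge0 (f c); have := normr_ge0 (f d).
by move=> ? ?; rewrite ler_norml; apply/andP; split; lra.
Qed.

Lemma smooth1_derive (I : set R) f : smooth1 I f -> smooth1 I (derive1 f).
Proof. by move=> sf n x Ix; rewrite -derive1Sn; exact: sf. Qed.

Lemma smooth1_rmder (I : set R) (f : R -> 'M[R]_2) x : smooth1 I f -> I x ->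
  rmder f x (derive1 f x).
Proof.
move=> sf Ix; apply/is_derive_mxP; have := sf 0%N x Ix; rewrite derive1n0 => df.
by rewrite derive1E; exact: derivableP.
Qed.

Lemma smooth1_bound (I : set R) (f : R -> 'M[R]_2) a b : smooth1 I f -> a < b ->
  (forall x, a <= x <= b -> I x) ->
  exists M, 0 <= M /\ forall x i j, a <= x <= b -> `|f x i j| <= M.
Proof.
move=> sf ab abI.
have [|i j|M [M0 hM]] := @entrywise_bound R (fun i j m => forall x, a <= x <= b -> `|f x i j| <= m).
- by move=> i j m m' mm' h x xab; apply: le_trans mm'; exact: h.
- have [x xab|m hm] := @segment_bound (fun x => f x i j) a b (ltW ab).
    exact: is_derive_continuous (smooth1_rmder sf (abI x xab) i j).
  exists m; split => //; apply: le_trans (normr_ge0 (f a i j)) (hm a _).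
  by rewrite lexx ltW.
- by exists M; split => // x i j; exact: hM.
Qed.

(** Extrema on the closed interval turn smoothness into the uniform bounds that the class demands;
    each class for [f] comes from the previous one for its derivative. *)
Lemma smooth1_CLm (I : set R) (f : R -> 'M[R]_2) a b n : smooth1 I f -> a < b ->
  (forall x, a <= x <= b -> I x) -> CLm a b n (fun x y => f x).
Proof.
move=> sf ab abI.
have abw x : a < x < b -> a <= x <= b by move=> /andP[/ltW -> /ltW ->].
elim: n f sf => [|n IH] f sf i j.
  have [M [M0 hM]] := smooth1_bound sf ab abI.
  have [N [N0 hN]] := smooth1_bound (smooth1_derive sf) ab abI.
  split => //; exists (M + N); split; first exact: addr_ge0.
  - by move=> x y xab yab; apply: (le_trans (hM x i j (abw _ xab))); lra.
  - move=> x x' y xab xab' yab.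
    apply: (@le_trans _ _ (N * `|x' - x|)); last by rewrite ler_wpM2r//; lra.
    apply: (mean_value_le (a := a) (b := b) (f := fun x => f x i j)
      (g := fun x => derive1 f x i j)) => // t tab; last exact: hN (abw _ tab).
    exact: smooth1_rmder sf (abI _ (abw _ tab)) i j.
  - by move=> x y y' xab yab yab'; rewrite subrr normr0 mulr_ge0// addr_ge0.
have [M [M0 hM]] := smooth1_bound sf ab abI.
apply: (@CL_partials R a b n _ (fun x y => derive1 f x i j) (fun _ _ => 0) M).
- by move=> x y xab yab; exact: hM (abw _ xab).
- by move=> x y xab yab; exact: smooth1_rmder sf (abI _ (abw _ xab)) i j.
- by move=> x y xab yab; exact: is_derive_cst.
- exact: IH (smooth1_derive sf) i j.
- exact: CL_cst.
Qed.

(** The partials of [F] are [F A] and [F B], so the a priori bound on [F] starts a bootstrap through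
    all classes. *)
Lemma linear_system_CLm a b (F A B : R -> R -> 'M[R]_2) M n :
  (forall x y i j, a < x < b -> a < y < b -> `|F x y i j| <= M) ->
  (forall n, CLm a b n A) -> (forall n, CLm a b n B) ->
  (forall x y, a < x < b -> a < y < b -> rmder (F^~ y) x (F x y *m A x y)) ->
  (forall x y, a < x < b -> a < y < b -> rmder (F x) y (F x y *m B x y)) ->
  CLm a b n F.
Proof.
move=> FM hA hB dx dy.
have bM (C : R -> R -> 'M[R]_2) : CLm a b 0 C -> exists N, 0 <= N /\
    forall x y i j, a < x < b -> a < y < b -> `|(F x y *m C x y) i j| <= N.
  move=> hC; have [D [D0 hD _]] := uniform_blip hC.
  exists (2 * `|M| * D); split; first by rewrite !mulr_ge0.
  move=> x y i j xab yab; apply: mulmx2_bound => //.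
    by move=> k l; apply: (le_trans (FM x y k l xab yab)); exact: ler_norm.
  by move=> k l; exact: (hD x xab).1.
elim: n => [|n IH] i j.
  have [N [N0 hN]] := bM A (hA 0%N); have [N' [N'0 hN']] := bM B (hB 0%N).
  split => //; exists (`|M| + N + N'); split; first by rewrite !addr_ge0.
  - move=> x y xab yab; apply: (le_trans (FM x y i j xab yab)).
    by apply: (le_trans (ler_norm _)); lra.
  - move=> x x' y xab xab' yab.
    apply: (@le_trans _ _ (N * `|x' - x|)).
      apply: (mean_value_le (a := a) (b := b) (f := fun x => F x y i j)
        (g := fun x => (F x y *m A x y) i j)) => // t tab; last exact: hN.
      exact: dx.
    by rewrite ler_wpM2r//; have := normr_ge0 M; lra.
  - move=> x y y' xab yab yab'.
    apply: (@le_trans _ _ (N' * `|y' - y|)).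
      apply: (mean_value_le (a := a) (b := b) (f := fun y => F x y i j)
        (g := fun y => (F x y *m B x y) i j)) => // t tab; last exact: hN'.
      exact: dy.
    by rewrite ler_wpM2r//; have := normr_ge0 M; lra.
apply: (@CL_partials R a b n _ (fun x y => (F x y *m A x y) i j)
  (fun x y => (F x y *m B x y) i j) M).
- by move=> x y xab yab; exact: FM.
- by move=> x y xab yab; exact: dx.
- by move=> x y xab yab; exact: dy.
- exact: CLmM IH (hA n) i j.
- exact: CLmM IH (hB n) i j.
Qed.

End Bounds.

(** * From the classes on squares to smoothness in the plane *)

Section Bridge.
Context {R : realType}.
Implicit Types (f : R * R -> 'M[R]_2) (p : R * R).

Lemma is_derive_ex f p D : is_derive p.1 1 (fun x => f (x, p.2)) D -> is_derive p (ex R) f D.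
Proof.
case: p => x y /= [d1 d2].
have E : (fun h : R => h^-1 *: ((f \o shift (x, y)) (h *: ex R) - f (x, y))) =
    (fun h : R => h^-1 *: (((fun x => f (x, y)) \o shift x) (h *: (1 : R)) - f (x, y))).
  apply/funext => h /=; congr (_ *: (f _ - _)).
  have -> : h *: ex R + (x, y) = (h *: (1 : R) + x, h *: (0 : R) + y) by [].
  by rewrite scaler0 add0r.
by split; [rewrite /derivable E|rewrite -d2 /derive E].
Qed.

Lemma is_derive_ey f p D : is_derive p.2 1 (fun y => f (p.1, y)) D -> is_derive p (ey R) f D.
Proof.
case: p => x y /= [d1 d2].
have E : (fun h : R => h^-1 *: ((f \o shift (x, y)) (h *: ey R) - f (x, y))) =
    (fun h : R => h^-1 *: (((fun y => f (x, y)) \o shift y) (h *: (1 : R)) - f (x, y))).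
  apply/funext => h /=; congr (_ *: (f _ - _)).
  have -> : h *: ey R + (x, y) = (h *: (0 : R) + x, h *: (1 : R) + y) by [].
  by rewrite scaler0 add0r.
by split; [rewrite /derivable E|rewrite -d2 /derive E].
Qed.

Lemma near_square a b p (P : R * R -> Prop) : a < p.1 < b -> a < p.2 < b ->
  (forall x y, a < x < b -> a < y < b -> P (x, y)) -> \forall q \near p, P q.
Proof.
case: p => x y /= xab yab h.
exists ([set t | a < t < b], [set t | a < t < b]) => /=.
  by split; [apply: (near_itv xab)|apply: (near_itv yab)].
by move=> [s t] /= [sab tab]; exact: h.
Qed.

Lemma mx_norm_le (A : 'M[R]_2) (e : R) : 0 <= e -> (forall i j, `|A i j| <= e) -> `|A| <= e.
Proof.
move=> e0 h; rewrite [leLHS]/Num.Def.normr/= mx_normrE (bigmax_le _ e0)//= => -[i j] _.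
Qed.

Lemma CLm_continuous a b (g : R -> R -> 'M[R]_2) f p : CLm a b 0 g ->
  a < p.1 < b -> a < p.2 < b ->
  (forall x y, a < x < b -> a < y < b -> f (x, y) = g x y) -> {for p, continuous f}.
Proof.
move=> hg pab1 pab2 fg; have [D [D0 hx hy]] := uniform_blip hg.
apply/cvgrPdist_le => e e0.
have D1 : 0 < D + D + 1 by rewrite ltr_wpDl// addr_ge0.
have d0 : 0 < e / (D + D + 1) by rewrite divr_gt0.
near=> q.
have [qab1 qab2] : a < q.1 < b /\ a < q.2 < b.
  by near: q; apply: (near_square pab1 pab2) => x y /=.
have pq : `|p - q| <= e / (D + D + 1) by near: q; exact: cvgr_dist_le.
have [pq1 pq2] : `|p.1 - q.1| <= e / (D + D + 1) /\ `|p.2 - q.2| <= e / (D + D + 1).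
  move: pq; rewrite [leLHS]/Num.Def.normr/= ge_max => /andP[h1 h2]; split => //.
apply: mx_norm_le; first exact: ltW.
move=> i j; rewrite mxsubE.
have -> : f p = g p.1 p.2 by rewrite {1}(surjective_pairing p) fg.
have -> : f q = g q.1 q.2 by rewrite {1}(surjective_pairing q) fg.
have -> : g p.1 p.2 i j - g q.1 q.2 i j =
    (g p.1 p.2 i j - g q.1 p.2 i j) + (g q.1 p.2 i j - g q.1 q.2 i j) by ring.
apply: (le_trans (ler_normD _ _)).
have h1 := (hy p.2 pab2).2 q.1 p.1 i j qab1 pab1.
have h2 := (hx q.1 qab1).2 q.2 p.2 i j qab2 pab2.
apply: (le_trans (lerD h1 h2)).
have k1 := ler_wpM2l D0 pq1; have k2 := ler_wpM2l D0 pq2.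
apply: (le_trans (lerD k1 k2)); rewrite -mulrDl mulrCA ler_piMr//; first exact: ltW.
by rewrite ler_pdivrMr// mul1r; lra.
Unshelve. all: by end_near. Qed.

Lemma CLm_partials a b n (g : R -> R -> 'M[R]_2) : CLm a b n.+1 g ->
  exists gx gy, [/\ CLm a b n gx, CLm a b n gy,
    forall x y, a < x < b -> a < y < b -> rmder (g^~ y) x (gx x y) &
    forall x y, a < x < b -> a < y < b -> rmder (g x) y (gy x y)].
Proof.
move=> h.
have [_ [x00 [y00 [p00 q00 r00 s00]]]] := h 0 0.
have [_ [x01 [y01 [p01 q01 r01 s01]]]] := h 0 1.
have [_ [x10 [y10 [p10 q10 r10 s10]]]] := h 1 0.
have [_ [x11 [y11 [p11 q11 r11 s11]]]] := h 1 1.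
exists (fun x y => mx2 (x00 x y) (x01 x y) (x10 x y) (x11 x y)),
  (fun x y => mx2 (y00 x y) (y01 x y) (y10 x y) (y11 x y)).
split; [exact: CLm_mx2|exact: CLm_mx2| |] => x y xab yab i j;
  have [->|->] := I2E i; have [->|->] := I2E j; rewrite mx2E.
- exact: r00.
- exact: r01.
- exact: r10.
- exact: r11.
- exact: s00.
- exact: s01.
- exact: s10.
- exact: s11.
Qed.

Lemma rmder_is_derive (F : R -> 'M[R]_2) t D : rmder F t D -> is_derive t 1 F D.
Proof. by move=> h; apply/is_derive_mxP. Qed.

Lemma local_partials a b (g gx gy : R -> R -> 'M[R]_2) f :
  (forall x y, a < x < b -> a < y < b -> f (x, y) = g x y) ->
  (forall x y, a < x < b -> a < y < b -> rmder (g^~ y) x (gx x y)) ->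
  (forall x y, a < x < b -> a < y < b -> rmder (g x) y (gy x y)) ->
  forall x y, a < x < b -> a < y < b ->
  [/\ derivable f (x, y) (ex R), derivable f (x, y) (ey R),
      'D_(ex R) f (x, y) = gx x y & 'D_(ey R) f (x, y) = gy x y].
Proof.
move=> fg dx dy x y xab yab.
have [h1 h2] : is_derive (x, y) (ex R) f (gx x y).
  apply/is_derive_ex/rmder_is_derive/(rmder_ext xab _ (dx _ _ xab yab)) => t tab /=.
  by rewrite fg.
have [h3 h4] : is_derive (x, y) (ey R) f (gy x y).
  apply/is_derive_ey/rmder_is_derive/(rmder_ext yab _ (dy _ _ xab yab)) => t tab /=.
  by rewrite fg.
exact: And4.
Qed.

Lemma Ck2_local (Omega : set (R * R)) n f :
  (forall p, Omega p -> exists a b (g : R -> R -> 'M[R]_2),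
    [/\ a < p.1 < b, a < p.2 < b, CLm a b n g &
        forall x y, a < x < b -> a < y < b -> f (x, y) = g x y]) -> Ck2 Omega n f.
Proof.
have le0 (a b : R) k g : CLm a b k g -> CLm a b 0 g.
  by move=> h i j; exact: CL_le (leq0n k) (h i j).
elim: n f => [|n IH] f h; split => //.
- by move=> p /h[a [b [g [p1 p2 hg fg]]]]; exact: CLm_continuous hg p1 p2 fg.
- by move=> p /h[a [b [g [p1 p2 hg fg]]]]; exact: (CLm_continuous (le0 _ _ _ _ hg) p1 p2 fg).
split.
- move=> [x y] /h[a [b [g [/= p1 p2 hg fg]]]].
  have [gx [gy [_ _ dx dy]]] := CLm_partials hg.
  have [d1 d2 _ _] := local_partials fg dx dy p1 p2; exact: (conj d1 d2).
- apply: IH => -[x y] /h[a [b [g [/= p1 p2 hg fg]]]].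
  have [gx [gy [hx _ dx dy]]] := CLm_partials hg.
  exists a, b, gx; split; [exact: p1|exact: p2|exact: hx|] => s t sab tab.
  have [_ _ d1 _] := local_partials fg dx dy sab tab; exact: d1.
- apply: IH => -[x y] /h[a [b [g [/= p1 p2 hg fg]]]].
  have [gx [gy [_ hy dx dy]]] := CLm_partials hg.
  exists a, b, gy; split; [exact: p1|exact: p2|exact: hy|] => s t sab tab.
  have [_ _ _ d2] := local_partials fg dx dy sab tab; exact: d2.
Qed.

End Bridge.

(** * The inner product, Lorentzian forms and Gram determinants *)

Section Inner.
Context {R : realType}.
Implicit Types (X Y P Q : 'M[R]_2) (k l : R).

Lemma mx2_eta X : X = mx2 (X 0 0) (X 0 1) (X 1 0) (X 1 1).
Proof. by apply: mx2P; rewrite mx2E. Qed.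

Lemma innerE X Y : inner X Y =
  - 2^-1 * (X 0 0 * Y 1 1 + X 1 1 * Y 0 0 - X 0 1 * Y 1 0 - X 1 0 * Y 0 1).
Proof.
rewrite /inner !tr2E !mulmx2E !mxsubE !scalar_mx2E/=; congr (_ * _); ring.
Qed.

Lemma inner_adj2 X Y : inner X Y = - 2^-1 * \tr (X *m adj2 Y).
Proof. by rewrite innerE tr2E !mulmx2E !mx2E; congr (_ * _); ring. Qed.

Lemma adj2M P Q : adj2 (P *m Q) = adj2 Q *m adj2 P.
Proof. by apply: mx2P; rewrite !(mx2E, mulmx2E); ring. Qed.

(** The product is [-1/2 tr (X adj Y)] and the adjugate reverses products: [Q adj Q] is Id inside
    the trace, and [adj P P] is Id after a cyclic permutation. *)
Lemma inner_isometry P Q X Y : \det P = 1 -> \det Q = 1 ->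
  inner (P *m X *m Q) (P *m Y *m Q) = inner X Y.
Proof.
move=> dP dQ; rewrite !inner_adj2; congr (_ * _).
have -> : P *m X *m Q *m adj2 (P *m Y *m Q) =
    P *m (X *m (Q *m adj2 Q) *m adj2 Y *m adj2 P) by rewrite !adj2M !mulmxA.
rewrite mulmx_adj2 dQ mulmx1 mxtrace_mulC -!mulmxA adj2_mulmx dP mulmx1//.
Qed.

Lemma innerZ k l X Y : inner (k *: X) (l *: Y) = k * l * inner X Y.
Proof. by rewrite !innerE !mxscaleE; ring. Qed.

Lemma innerC X Y : inner X Y = inner Y X.
Proof. by rewrite !innerE; ring. Qed.

Lemma inner_det X : inner X X = - \det X.
Proof. by rewrite innerE det_mx2; field. Qed.

Lemma AdS3_det X : AdS3 X <-> \det X = 1.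
Proof.
by rewrite /AdS3/= inner_det; split => [/oppr_inj|->].
Qed.

(** For [p != 0] the basis is made, up to scale, of the first coordinate vector and of [(-q, p)],
    which is orthogonal to it and has square [p (p r - q^2)], of sign opposite to [p]. For [p = 0]
    both vectors are sought in the form [(x, 1)]. *)
Lemma lorentzian_det (p q r : R) : p * r - q ^+ 2 < 0 -> lorentzian (mx2 p q q r).
Proof.
move=> d0.
have key (x y z w : R) : x * w - y * z != 0 ->
    p * x ^+ 2 + 2 * q * x * z + r * z ^+ 2 = 1 ->
    p * x * y + q * (x * w + y * z) + r * z * w = 0 ->
    p * y ^+ 2 + 2 * q * y * w + r * w ^+ 2 = -1 -> lorentzian (mx2 p q q r).
  move=> dn e1 e2 e3; exists (mx2 x y z w).
    by rewrite unitmxE det_mx2 !mx2E unitfE.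
  apply: mx2P; rewrite !mulmx2E ![_^T _ _]mxE !mx2E.
  - by rewrite -e1; ring.
  - by rewrite -e2; ring.
  - by rewrite -e2; ring.
  - by rewrite -e3; ring.
have [p0|p0|p0] := ltgtP p 0.
- set d := p * r - q ^+ 2 in d0 *.
  have s1 : 0 < p * d by rewrite nmulr_rgt0.
  have [t t0 tt] : exists2 t, 0 < t & t ^+ 2 = p * d.
    by exists (Num.sqrt (p * d)); rewrite ?sqrtr_gt0// sqr_sqrtr// ltW.
  have [v v0 vv] : exists2 v, 0 < v & v ^+ 2 = - p.
    by exists (Num.sqrt (- p)); rewrite ?sqrtr_gt0 ?oppr_gt0// sqr_sqrtr// oppr_ge0 ltW.
  have tn : t != 0 by rewrite gt_eqF. have vn : v != 0 by rewrite gt_eqF.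
  have dn : d != 0 by rewrite lt_eqF.
  have pn : p != 0 by rewrite lt_eqF.
  apply: (key (- q / t) (1 / v) (p / t) 0).
  + rewrite mulr0 sub0r oppr_eq0 mulf_neq0// mulf_neq0 ?invr_neq0 ?oner_neq0//.
  + have -> : p * (- q / t) ^+ 2 + 2 * q * (- q / t) * (p / t) + r * (p / t) ^+ 2
      = p * d / t ^+ 2 by rewrite /d; field.
    by rewrite tt divff// mulf_neq0.
  + by field; rewrite tn vn.
  + have -> : p * (1 / v) ^+ 2 + 2 * q * (1 / v) * 0 + r * 0 ^+ 2 = p / v ^+ 2 by field.
    by rewrite vv invrN mulrN divff.
- set d := p * r - q ^+ 2 in d0 *.
  have s1 : 0 < - (p * d) by rewrite oppr_gt0 pmulr_rlt0.
  have [t t0 tt] : exists2 t, 0 < t & t ^+ 2 = - (p * d).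
    by exists (Num.sqrt (- (p * d))); rewrite ?sqrtr_gt0// sqr_sqrtr// ltW.
  have [v v0 vv] : exists2 v, 0 < v & v ^+ 2 = p.
    by exists (Num.sqrt p); rewrite ?sqrtr_gt0// sqr_sqrtr// ltW.
  have tn : t != 0 by rewrite gt_eqF. have vn : v != 0 by rewrite gt_eqF.
  have dn : d != 0 by rewrite lt_eqF.
  have pn : p != 0 by rewrite gt_eqF.
  apply: (key (1 / v) (- q / t) 0 (p / t)).
  + rewrite mulr0 subr0 mulf_neq0// mulf_neq0 ?invr_neq0 ?oner_neq0//.
  + have -> : p * (1 / v) ^+ 2 + 2 * q * (1 / v) * 0 + r * 0 ^+ 2 = p / v ^+ 2 by field.
    by rewrite vv divff.
  + by field; rewrite tn vn.
  + have -> : p * (- q / t) ^+ 2 + 2 * q * (- q / t) * (p / t) + r * (p / t) ^+ 2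
      = p * d / t ^+ 2 by rewrite /d; field.
    by rewrite tt invrN mulrN divff// mulf_neq0.
- have qn : q != 0.
    by apply/eqP => q0; move: d0; rewrite p0 q0 expr0n/= mul0r subr0 ltxx.
  apply: (key ((1 - r) / (2 * q)) ((- 1 - r) / (2 * q)) 1 1).
  + have -> : (1 - r) / (2 * q) * 1 - (-1 - r) / (2 * q) * 1 = q^-1 by field.
    by rewrite invr_neq0.
  + by rewrite p0; field.
  + by rewrite p0; field.
  + by rewrite p0; field.
Qed.

Lemma free2P X Y : free [:: X; Y] <->
  forall k l, k *: X + l *: Y = 0 -> k = 0 /\ l = 0.
Proof.
split.
  move=> /freeP f k l h.
  have := f (fun i : 'I_2 => if i == 0 then k else l).
  have -> : \sum_(i < 2) (if i == 0 then k else l) *: [:: X; Y]`_i = 0.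
    by rewrite big_ord_recl big_ord1/=.
  by move=> /(_ erefl) e; split; [exact: (e 0)|exact: (e 1)].
move=> h; apply/freeP => k; rewrite big_ord_recl big_ord1/= => e i.
have [k0 k1] := h _ _ e; have [->|->] := I2E i.
  by rewrite -k0; congr k; apply/val_inj.
by rewrite -k1; congr k; apply/val_inj.
Qed.

Lemma free_gram X Y : inner X X * inner Y Y - inner X Y ^+ 2 != 0 -> free [:: X; Y].
Proof.
move=> g; apply/free2P => k l h.
have h1 : k * inner X X + l * inner X Y = 0.
  have -> : k * inner X X + l * inner X Y = inner (k *: X + l *: Y) X.
    by rewrite !innerE !mxE; ring.
  by rewrite h innerE !mxE; ring.
have h2 : k * inner X Y + l * inner Y Y = 0.
  have -> : k * inner X Y + l * inner Y Y = inner (k *: X + l *: Y) Y.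
    by rewrite !innerE !mxE; ring.
  by rewrite h innerE !mxE; ring.
have e1 : k * (inner X X * inner Y Y - inner X Y ^+ 2) = 0.
  have -> : k * (inner X X * inner Y Y - inner X Y ^+ 2) =
    (k * inner X X + l * inner X Y) * inner Y Y - (k * inner X Y + l * inner Y Y) * inner X Y by ring.
  by rewrite h1 h2 !mul0r subrr.
have e2 : l * (inner X X * inner Y Y - inner X Y ^+ 2) = 0.
  have -> : l * (inner X X * inner Y Y - inner X Y ^+ 2) =
    (k * inner X Y + l * inner Y Y) * inner X X - (k * inner X X + l * inner X Y) * inner X Y by ring.
  by rewrite h1 h2 !mul0r subrr.
by move/eqP: e1; move/eqP: e2; rewrite !mulf_eq0 (negbTE g) !orbF => /eqP -> /eqP ->.
Qed.

End Inner.

(** * Algebra of the fundamental forms at a point *)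

Section SurfaceAlgebra.
Context {R : realType}.
Variables (P Q : 'M[R]_2) (mu b1 b2 c1 c2 : R).
Hypotheses (dP : \det P = 1) (dQ : \det Q = 1) (mu0 : mu != 0) (mu1 : mu != 1).
Hypothesis nondeg : b1 * c2 - b2 * c1 != 0.

Let b : 'M[R]_2 := mx2 0 b1 b2 0.
Let c : 'M[R]_2 := mx2 0 c1 c2 0.

Definition surf_x := (mu - 1) *: (P *m b *m Q).

Definition surf_y := (mu^-1 - 1) *: (P *m c *m Q).

Definition surf_N := P *m e3 R *m Q.

Lemma surf_xx : inner surf_x surf_x = (mu - 1) ^+ 2 * (b1 * b2).
Proof. by rewrite /surf_x innerZ inner_isometry// innerE !mx2E; field. Qed.

Lemma surf_yy : inner surf_y surf_y = (mu^-1 - 1) ^+ 2 * (c1 * c2).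
Proof. by rewrite /surf_y innerZ inner_isometry// innerE !mx2E; field. Qed.

Lemma surf_xy : inner surf_x surf_y =
  (mu - 1) * (mu^-1 - 1) * ((b1 * c2 + b2 * c1) / 2).
Proof. by rewrite /surf_x /surf_y innerZ inner_isometry// innerE !mx2E; field. Qed.

Lemma surf_NN : inner surf_N surf_N = 1.
Proof. by rewrite /surf_N inner_isometry// innerE !mx2E; field. Qed.

Lemma surf_inner_N X : inner (P *m X *m Q) surf_N = (X 1 1 - X 0 0) / 2.
Proof. by rewrite /surf_N inner_isometry// innerE !mx2E; field. Qed.

(** The Gram determinant is minus a square because [(b1 c2 + b2 c1)^2 - 4 b1 b2 c1 c2 = (b1 c2 - b2
    c1)^2]. Independence of [b] and [c] thus yields the immersion and its signature together. *)
Lemma surf_gram : inner surf_x surf_x * inner surf_y surf_y - inner surf_x surf_y ^+ 2 =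
  - ((mu - 1) * (mu^-1 - 1) * (b1 * c2 - b2 * c1) / 2) ^+ 2.
Proof. by rewrite surf_xx surf_yy surf_xy; field. Qed.

Lemma surf_gram_lt0 :
  inner surf_x surf_x * inner surf_y surf_y - inner surf_x surf_y ^+ 2 < 0.
Proof.
have m1 : mu^-1 - 1 != 0 by rewrite subr_eq0 invr_eq1.
have h : (mu - 1) * (mu^-1 - 1) * (b1 * c2 - b2 * c1) / 2 != 0.
  by rewrite !mulf_neq0 ?subr_eq0 ?invr_neq0 ?pnatr_eq0// -subr_eq0.
by rewrite surf_gram oppr_lt0 exprn_even_gt0.
Qed.

(** The factor [b1 c2 - b2 c1] cancels, and [(mu^-1 + 1) / (mu^-1 - 1)] is [rho]. *)
Lemma surf_curvature (rho : R) : rho != -1 -> mu = (rho - 1) / (rho + 1) ->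
  let M := (mu - 1) * ((mu^-1 + 1) * (b1 * c2 - b2 * c1) / 2) in
  (0 * 0 - M ^+ 2) /
    (inner surf_x surf_x * inner surf_y surf_y - inner surf_x surf_y ^+ 2) = rho ^+ 2.
Proof.
move=> rn muE; rewrite /= surf_gram.
have r1 : rho + 1 != 0 by rewrite -[1]opprK subr_eq0.
have rm : rho - 1 != 0.
  by apply: contra mu0 => /eqP e; rewrite muE e mul0r.
rewrite muE; field.
rewrite ?r1 ?rm nondeg /=; apply/andP; split.
  by rewrite (_ : _ + _ = 2) ?pnatr_eq0//; ring.
by rewrite (_ : _ + _ = - 2) ?oppr_eq0 ?pnatr_eq0//; ring.
Qed.

End SurfaceAlgebra.

(** * Real matrices among complex ones, and complex conjugation *)

Section Reality.
Context {R : realType}.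

Lemma toCZ (k : R) (A : 'M[R]_2) : toC (k *: A) = k%:C%C *: toC A.
Proof. by apply/matrixP => i j; rewrite !mxE rmorphM. Qed.

Lemma toC_mxRe (M : 'M[R[i]]_2) : map_mx (@conjc R) M = M -> toC (mxRe M) = M.
Proof.
move=> h; apply/matrixP => i j; rewrite !mxE.
have := congr1 (fun A : 'M[R[i]]_2 => complex.Im (A i j)) h; rewrite mxE.
case: (M i j) => x y /= e; congr Complex.
lra.
Qed.

Lemma mxRe_toC (M : 'M[R]_2) : mxRe (toC M) = M.
Proof. by apply/matrixP => i j; rewrite !mxE. Qed.

Lemma map_conjM (A B : 'M[R[i]]_2) :
  map_mx (@conjc R) (A *m B) = map_mx (@conjc R) A *m map_mx (@conjc R) B.
Proof. exact: map_mxM. Qed.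

Lemma map_conj_toC (A : 'M[R]_2) : map_mx (@conjc R) (toC A) = toC A.
Proof. by apply/matrixP => i j; rewrite !mxE; apply: eq_ReIm => /=; rewrite ?oppr0. Qed.

Lemma det_toC (A : 'M[R]_2) : \det (toC A) = (\det A)%:C%C.
Proof. exact: det_map_mx. Qed.

Lemma rmder_mxRe (G : R -> 'M[R[i]]_2) t D : mcder G t (toC D) -> rmder (fun s => mxRe (G s)) t D.
Proof.
move=> h i j; rewrite (_ : (fun s => _) = fun s => complex.Re (G s i j)).
  by have [] := h i j; rewrite toCE.
by apply/funext => s; rewrite mxE.
Qed.

Lemma mcder_conj (G : R -> 'M[R[i]]_2) t D : mcder G t D ->
  mcder (fun s => map_mx (@conjc R) (G s)) t (map_mx (@conjc R) D).
Proof.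
move=> h i j; have [h1 h2] := h i j; split; rewrite mxE.
  rewrite (_ : (fun s => _) = fun s => complex.Re (G s i j)).
    by case: (D i j) h1 => d1 d2.
  by apply/funext => s; rewrite mxE; case: (G s i j).
rewrite (_ : (fun s => _) = - (fun s => complex.Im (G s i j))).
  by case: (D i j) h2 => d1 d2 /= h2; exact: is_deriveN.
by apply/funext => s; rewrite mxE /=; rewrite [RHS]/GRing.opp/=; case: (G s i j).
Qed.

End Reality.

(** * The frame at a real parameter *)

Section RealFrame.
Context {R : realType}.
Variables (a b : R) (s0 b1 b2 g1 g2 : R -> R) (u s : R -> R -> R).
Hypotheses (hs0 : smooth_data a b s0) (hb1 : smooth_data a b b1)
  (hb2 : smooth_data a b b2) (hg1 : smooth_data a b g1) (hg2 : smooth_data a b g2).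
Hypotheses (hu : forall n, CL a b n u) (hs : forall n, CL a b n s).
Hypothesis ux : partialx a b u (fun x y => 2 * s x y).
Hypothesis sy : partialy a b s (fun x y => b2 x * coefc1 g1 u x y - b1 x * coefc2 g2 u x y).
Hypotheses (u_diag : forall x, a < x < b -> u x x = 0)
  (s_diag : forall x, a < x < b -> s x x = s0 x).

Local Notation cm := (mxc g1 g2 u).
Local Notation bm := (mxb b1 b2).
Local Notation sm := (mxs s).

Variables (X : R -> R[i] -> 'M[R[i]]_2) (l : R).
Hypothesis l0 : l != 0.
Hypothesis dX : forall t, a < t < b ->
  mcder (X^~ l%:C%C) t (X t l%:C%C *m mxalpha s0 b1 b2 g1 g2 l%:C%C t).
Hypothesis X_real : forall t, a < t < b -> map_mx (@conjc R) (X t l%:C%C) = X t l%:C%C.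
Hypothesis X_det : forall t, a < t < b -> \det (X t l%:C%C) = 1.

(** At a real parameter [X] and [H_-] are real, so taking the real part loses nothing
    ([toC_real_frame]); it yields a frame with real entries, to which the real calculus applies. *)
Definition real_frame x y := mxRe (X x l%:C%C *m Hminus g1 g2 u l%:C%C^-1 x y).

Let lC0 : l%:C%C != 0 :> R[i].
Proof. by apply: contra l0 => /eqP e; apply/eqP; have := congr1 (@complex.Re R) e. Qed.

Let lV : l%:C%C^-1 = l^-1%:C%C :> R[i]. Proof. by rewrite fmorphV. Qed.

Lemma toC_real_frame x y : a < x < b -> a < y < b ->
  toC (real_frame x y) = X x l%:C%C *m Hminus g1 g2 u l%:C%C^-1 x y.
Proof.
move=> xab yab; apply: toC_mxRe; rewrite map_conjM X_real//; congr (_ *m _).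
have e : conjc (l%:C%C^-1) = l%:C%C^-1 :> R[i].
  by rewrite lV; apply: eq_ReIm => /=; rewrite ?oppr0.
rewrite -{1}e; apply: mxev_conj.
exact: (fast_Mseq hg1 hg2 hu xab yab).
Qed.

Lemma det_real_frame x y : a < x < b -> a < y < b -> \det (real_frame x y) = 1.
Proof.
move=> xab yab; have : \det (toC (real_frame x y)) = 1.
  by rewrite toC_real_frame// det_mulmx X_det// (det_Hminus hg1 hg2 hu _ xab yab) mulr1.
by rewrite det_toC => /(congr1 (@complex.Re R)).
Qed.

Lemma real_frame_x x y : a < x < b -> a < y < b ->
  rmder (real_frame^~ y) x (real_frame x y *m (sm x y + l *: bm x)).
Proof.
move=> xab yab; apply: rmder_mxRe.
have dH := mcder_Hminus_x hs0 hb1 hb2 hg1 hg2 hu hs ux sy u_diag s_diag lC0 xab yab.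
apply: mcder_eq (mcderM (dX xab) dH).
rewrite toCM toC_real_frame// toCD toCZ -/(mxA b1 b2 s l%:C%C x y).
by rewrite mulmxBr !mulmxA addrC subrK.
Qed.

Lemma real_frame_y x y : a < x < b -> a < y < b ->
  rmder (real_frame x) y (real_frame x y *m (l^-1 *: cm x y)).
Proof.
move=> xab yab; apply: rmder_mxRe.
have dH := mcder_Hminus_y hg1 hg2 hu l%:C%C^-1 xab yab.
apply: mcder_eq (mcderM (mcder_cst (X x l%:C%C) y) dH).
rewrite toCM toC_real_frame// toCZ mul0mx add0r -lV.
by rewrite -!scalemxAr mulmxA.
Qed.

(** A bound on [X] and the majorant of the series for [H_-] bound the frame; its linear system then
    supplies all derivatives. *)
Lemma real_frame_CLm n D : (forall x i j, a < x < b -> `|mxRe (X x l%:C%C) i j| <= D) ->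
  CLm a b n real_frame.
Proof.
move=> Xr.
have [B [fB B0 hB]] := Mseq_bound hg1 hg2 hu.
have [C hC] := fast_halving (fast_geometric l^-1 fB).
have Hr x y i j : a < x < b -> a < y < b -> `|mxRe (Hminus g1 g2 u l%:C%C^-1 x y) i j| <= 2 * C.
  move=> xab yab; rewrite mxE mxE /=; apply: tsum_bound => n'.
  apply: le_trans (hC n'); rewrite lV -rmorphXn /= !normrM ler_wpM2r//.
  by rewrite (ger0_norm (B0 n')); exact: hB.
have XE x : a < x < b -> X x l%:C%C = toC (mxRe (X x l%:C%C)).
  by move=> xab; rewrite toC_mxRe// X_real.
have bF x y i j : a < x < b -> a < y < b -> `|real_frame x y i j| <= 2 * D * (2 * C).
  move=> xab yab.
  have D0 : 0 <= D by apply: le_trans (Xr x 0 0 xab).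
  have -> : real_frame x y = mxRe (X x l%:C%C) *m mxRe (Hminus g1 g2 u l%:C%C^-1 x y).
    apply: toCI; rewrite toC_real_frame// toCM -XE//; congr (_ *m _).
    rewrite toC_mxRe//.
    have e : conjc (l%:C%C^-1) = l%:C%C^-1 :> R[i].
      by rewrite lV; apply: eq_ReIm => /=; rewrite ?oppr0.
    rewrite -{1}e; apply: mxev_conj.
    exact: (fast_Mseq hg1 hg2 hu xab yab).
  by apply: mulmx2_bound => // k m; [exact: Xr|exact: Hr].
apply: (linear_system_CLm n bF _ _ real_frame_x real_frame_y).
  move=> k; apply: CLmD; first exact: mxs_CL.
  move=> i j; apply: CL_ext (CLZ l (mxb_CL hb1 hb2 k i j)) => x y _ _.
  by rewrite mxscaleE.
move=> k i j; apply: CL_ext (CLZ l^-1 (mxc_CL hg1 hg2 hu k i j)) => x y _ _.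
by rewrite mxscaleE.
Qed.

End RealFrame.

(** * Derivatives of products [P Z V^-1] *)

Section Sandwich.
Context {R : realType}.

Lemma rmder_adj2 (V : R -> 'M[R]_2) (al : 'M[R]_2) t : al 0 0 + al 1 1 = 0 ->
  rmder V t (V t *m al) -> rmder (fun s => adj2 (V s)) t (- (al *m adj2 (V t))).
Proof.
move=> tr dV.
have -> : - (al *m adj2 (V t)) = adj2 (V t *m al).
  have a11 : al 1 1 = - al 0 0 by apply/eqP; rewrite -subr_eq0 opprK addrC tr.
  by apply: mx2P; rewrite [LHS]mxE !(mulmx2E, mx2E) a11; ring.
by apply: rmder_mx2; [exact: dV|exact/is_deriveN/dV|exact/is_deriveN/dV|exact: dV].
Qed.

(** One formula for several derivatives: [Z = 1] gives those of the surface, [Z = b] or [c] its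
    second derivatives, and [Z = e3] the derivative of the given normal [F e3 F^-1]. *)
Lemma rmder_sandwich (P Z V : R -> 'M[R]_2) (p z q : 'M[R]_2) t : q 0 0 + q 1 1 = 0 ->
  rmder P t (P t *m p) -> rmder Z t z -> rmder V t (V t *m q) ->
  rmder (fun s => P s *m Z s *m adj2 (V s)) t
    (P t *m (p *m Z t + z - Z t *m q) *m adj2 (V t)).
Proof.
move=> trq dP dZ dV; apply: rmder_eq (rmderM (rmderM dP dZ) (rmder_adj2 trq dV)).
rewrite mulmxN mulmxBr mulmxBl mulmxDr mulmxDl !mulmxA; congr (_ - _).
by rewrite mulmxDl.
Qed.

Lemma rmder_scale (k : R) (V : R -> 'M[R]_2) t D :
  rmder V t D -> rmder (fun s => k *: V s) t (k *: D).
Proof.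
move=> h i j; rewrite mxscaleE (_ : (fun s => _) = (k *: (fun s => V s i j))).
  exact: is_deriveZ.
by apply/funext => s; rewrite mxscaleE.
Qed.

Lemma CLm_adj2 a b n (V : R -> R -> 'M[R]_2) : CLm a b n V -> CLm a b n (fun x y => adj2 (V x y)).
Proof. by move=> h; apply: CLm_mx2; [exact: h|exact/CLN/h|exact/CLN/h|exact: h]. Qed.

Lemma mxaddE (A B : 'M[R]_2) i j : (A + B) i j = A i j + B i j.
Proof. by rewrite mxE. Qed.

Lemma inner_scalel (k : R) (X Y : 'M[R]_2) : inner (k *: X) Y = k * inner X Y.
Proof. by rewrite -[Y in LHS]scale1r innerZ mulr1. Qed.

End Sandwich.

(** * Geometry of the surface built from two frames *)

Section Surface.
Context {R : realType}.
Variables (a b mu rho : R) (A0 : 'M[R]_2) (b1 b2 : R -> R) (c1 c2 s : R -> R -> R).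
Variables (Fm F1 : R -> R -> 'M[R]_2) (f nu : R * R -> 'M[R]_2).
Local Notation bm := (mxb b1 b2).
Local Notation cm x y := (mx2 0 (c1 x y) (c2 x y) 0 : 'M[R]_2).
Local Notation sm := (mxs s).

Hypotheses (mu0 : mu != 0) (mu1 : mu != 1) (rho0 : rho != 0) (rhoN1 : rho != -1)
  (muE : mu = (rho - 1) / (rho + 1)).
Hypotheses (hb1 : CL a b 1 (fun x y => b1 x)) (hb2 : CL a b 1 (fun x y => b2 x))
  (hc1 : CL a b 1 c1) (hc2 : CL a b 1 c2).
Hypotheses (dA0 : \det A0 = 1)
  (dFm : forall x y, a < x < b -> a < y < b -> \det (Fm x y) = 1)
  (dF1 : forall x y, a < x < b -> a < y < b -> \det (F1 x y) = 1).
Hypotheses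
  (Fm_x : forall x y, a < x < b -> a < y < b ->
     rmder (Fm^~ y) x (Fm x y *m (sm x y + mu *: bm x)))
  (Fm_y : forall x y, a < x < b -> a < y < b ->
     rmder (Fm x) y (Fm x y *m (mu^-1 *: cm x y)))
  (F1_x : forall x y, a < x < b -> a < y < b ->
     rmder (F1^~ y) x (F1 x y *m (sm x y + 1 *: bm x)))
  (F1_y : forall x y, a < x < b -> a < y < b ->
     rmder (F1 x) y (F1 x y *m (1^-1 *: cm x y))).

Definition surf x y := A0 *m Fm x y *m adj2 (F1 x y).

Hypotheses (fE : forall x y, a < x < b -> a < y < b -> f (x, y) = surf x y)
  (nuE : forall x y, a < x < b -> a < y < b ->
     nu (x, y) = F1 x y *m e3 R *m adj2 (F1 x y)).

Let P x y := A0 *m Fm x y.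
Let fx x y := surf_x (P x y) (adj2 (F1 x y)) mu (b1 x) (b2 x).
Let fy x y := surf_y (P x y) (adj2 (F1 x y)) mu (c1 x y) (c2 x y).

Let P_x x y : a < x < b -> a < y < b -> rmder (P^~ y) x (P x y *m (sm x y + mu *: bm x)).
Proof.
move=> xab yab; apply: rmder_eq (rmderM (rmder_cst A0 x) (Fm_x xab yab)).
by rewrite mul0mx add0r mulmxA.
Qed.

Let P_y x y : a < x < b -> a < y < b -> rmder (P x) y (P x y *m (mu^-1 *: cm x y)).
Proof.
move=> xab yab; apply: rmder_eq (rmderM (rmder_cst A0 y) (Fm_y xab yab)).
by rewrite mul0mx add0r mulmxA.
Qed.

Let tr_x x y : (sm x y + 1 *: bm x) 0 0 + (sm x y + 1 *: bm x) 1 1 = 0.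
Proof. rewrite /mxs /mxb /e3 !mxE/=; ring. Qed.

Let tr_y x y : (1^-1 *: cm x y) 0 0 + (1^-1 *: cm x y) 1 1 = 0.
Proof. by rewrite !mxscaleE !mx2E; ring. Qed.

(** The term [S] is common to both frames and cancels: [(S + mu b) - (S + b) = (mu - 1) b]. *)
Let surf_dx x y : a < x < b -> a < y < b -> rmder (surf^~ y) x (fx x y).
Proof.
move=> xab yab.
have h := rmder_sandwich (tr_x x y) (P_x xab yab) (rmder_cst 1%:M x) (F1_x xab yab).
apply: rmder_ext xab _ (rmder_eq _ h) => [t _|]; first by rewrite mulmx1.
rewrite mulmx1 mul1mx addr0 scale1r /fx /surf_x scalemxAl scalemxAr; congr (_ *m _ *m _).
by rewrite opprD addrACA subrr add0r scalerBl scale1r.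
Qed.

Let surf_dy x y : a < x < b -> a < y < b -> rmder (surf x) y (fy x y).
Proof.
move=> xab yab.
have h := rmder_sandwich (tr_y x y) (P_y xab yab) (rmder_cst 1%:M y) (F1_y xab yab).
apply: rmder_ext yab _ (rmder_eq _ h) => [t _|]; first by rewrite mulmx1.
rewrite mulmx1 mul1mx addr0 invr1 scale1r /fy /surf_y scalemxAl scalemxAr; congr (_ *m _ *m _).
by rewrite scalerBl scale1r.
Qed.

(** The derivatives [z1], [z2] of [b1], [b2] can stay anonymous: they sit in an off-diagonal matrix,
    which is orthogonal to [e3] and does not contribute to the second fundamental form. *)
Let fx_dx x y : a < x < b -> a < y < b -> exists z1 z2, rmder (fx^~ y) x
  ((mu - 1) *: (P x y *m ((sm x y + mu *: bm x) *m bm x + mx2 0 z1 z2 0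
     - bm x *m (sm x y + 1 *: bm x)) *m adj2 (F1 x y))).
Proof.
move=> xab yab.
have [_ [z1 [_ [_ _ d1 _]]]] := hb1; have [_ [z2 [_ [_ _ d2 _]]]] := hb2.
exists (z1 x y), (z2 x y); apply: rmder_scale.
apply: rmder_sandwich (tr_x x y) (P_x xab yab) _ (F1_x xab yab).
exact: rmder_mx2 (is_derive_cst _ _ _) (d1 _ _ xab yab) (d2 _ _ xab yab) (is_derive_cst _ _ _).
Qed.

Let fy_dy x y : a < x < b -> a < y < b -> exists z1 z2, rmder (fy x) y
  ((mu^-1 - 1) *: (P x y *m ((mu^-1 *: cm x y) *m cm x y + mx2 0 z1 z2 0
     - cm x y *m (1^-1 *: cm x y)) *m adj2 (F1 x y))).
Proof.
move=> xab yab.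
have [_ [_ [z1 [_ _ _ d1]]]] := hc1; have [_ [_ [z2 [_ _ _ d2]]]] := hc2.
exists (z1 x y), (z2 x y); apply: rmder_scale.
apply: rmder_sandwich (tr_y x y) (P_y xab yab) _ (F1_y xab yab).
exact: rmder_mx2 (is_derive_cst _ _ _) (d1 _ _ xab yab) (d2 _ _ xab yab) (is_derive_cst _ _ _).
Qed.

Let fx_dy x y : a < x < b -> a < y < b -> rmder (fx x) y
  ((mu - 1) *: (P x y *m ((mu^-1 *: cm x y) *m bm x + 0
     - bm x *m (1^-1 *: cm x y)) *m adj2 (F1 x y))).
Proof.
move=> xab yab; apply: rmder_scale.
exact: rmder_sandwich (tr_y x y) (P_y xab yab) (rmder_cst _ _) (F1_y xab yab).
Qed.

Lemma rmder_derive_ex (g : R * R -> 'M[R]_2) (h : R -> R -> 'M[R]_2) x y D :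
  a < x < b -> a < y < b -> (forall x y, a < x < b -> a < y < b -> g (x, y) = h x y) ->
  rmder (h^~ y) x D -> 'D_(ex R) g (x, y) = D.
Proof.
move=> xab yab gh dh.
suff [_ ->] : is_derive (x, y) (ex R) g D by [].
apply/is_derive_ex/rmder_is_derive/(rmder_ext xab _ dh) => t tab /=.
by rewrite gh.
Qed.

Lemma rmder_derive_ey (g : R * R -> 'M[R]_2) (h : R -> R -> 'M[R]_2) x y D :
  a < x < b -> a < y < b -> (forall x y, a < x < b -> a < y < b -> g (x, y) = h x y) ->
  rmder (h x) y D -> 'D_(ey R) g (x, y) = D.
Proof.
move=> xab yab gh dh.
suff [_ ->] : is_derive (x, y) (ey R) g D by [].
apply/is_derive_ey/rmder_is_derive/(rmder_ext yab _ dh) => t tab /=.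
by rewrite gh.
Qed.

Lemma surf_Dx x y : a < x < b -> a < y < b -> 'D_(ex R) f (x, y) = fx x y.
Proof. by move=> xab yab; apply: rmder_derive_ex fE _ => //; exact: surf_dx. Qed.

Lemma surf_Dy x y : a < x < b -> a < y < b -> 'D_(ey R) f (x, y) = fy x y.
Proof. by move=> xab yab; apply: rmder_derive_ey fE _ => //; exact: surf_dy. Qed.

Section Point.
Variables x y : R.
Hypotheses (xab : a < x < b) (yab : a < y < b).
Hypothesis nondeg : b1 x * c2 x y - b2 x * c1 x y != 0.

Let dP : \det (P x y) = 1. Proof. by rewrite det_mulmx dA0 dFm// mulr1. Qed.
Let dQ : \det (adj2 (F1 x y)) = 1. Proof. by rewrite det_adj2 dF1. Qed.

Let fnu : f (x, y) *m nu (x, y) = surf_N (P x y) (adj2 (F1 x y)).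
Proof.
rewrite fE// nuE// /surf /surf_N -/(P x y) !mulmxA; congr (_ *m _ *m _).
by rewrite -mulmxA adj2_mulmx dF1// mulmx1.
Qed.

(** [b^2] is scalar and [[S, b]] is off-diagonal, so neither has a component along [e3]. *)
Let f_xx : IIxx f nu (x, y) = 0.
Proof.
have [z1 [z2 d]] := fx_dx xab yab.
rewrite /IIxx fnu (rmder_derive_ex xab yab surf_Dx d) inner_scalel surf_inner_N//.
rewrite !mxsubE !mxaddE !mulmx2E !mxaddE !mxscaleE /mxb !mx2E.
by ring.
Qed.

Let f_yy : IIyy f nu (x, y) = 0.
Proof.
have [z1 [z2 d]] := fy_dy xab yab.
rewrite /IIyy fnu (rmder_derive_ey xab yab surf_Dy d) inner_scalel surf_inner_N//.
rewrite !mxsubE !mxaddE !mulmx2E !mxscaleE !mx2E.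
by ring.
Qed.

(** The component of [mu^-1 c b - b c] along [e3]: the diagonals of [c b] and [b c] are exchanged,
    which turns the difference into the sum [mu^-1 + 1]. *)
Let f_xy : IIxy f nu (x, y) =
  (mu - 1) * ((mu^-1 + 1) * (b1 x * c2 x y - b2 x * c1 x y) / 2).
Proof.
rewrite /IIxy fnu (rmder_derive_ey xab yab surf_Dx (fx_dy xab yab)) inner_scalel surf_inner_N//.
rewrite addr0 invr1 scale1r !mxsubE !mulmx2E !mxscaleE /mxb !mx2E.
by ring.
Qed.

Lemma surf_immersion : [/\ AdS3 (f (x, y)), free [:: 'D_(ex R) f (x, y); 'D_(ey R) f (x, y)]
  & lorentzian (first_form f (x, y))].
Proof.
have g := surf_gram_lt0 dP dQ mu0 mu1 nondeg.
split.
- by apply/AdS3_det; rewrite fE// /surf det_mulmx dP dQ mulr1.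
- by rewrite surf_Dx// surf_Dy//; apply: free_gram; rewrite lt_eqF.
- by rewrite /first_form surf_Dx// surf_Dy//; exact: lorentzian_det.
Qed.

Lemma surf_gauss_map : let N := f (x, y) *m nu (x, y) in
  [/\ inner N N = 1, inner N (f (x, y)) = 0,
      inner N ('D_(ex R) f (x, y)) = 0 & inner N ('D_(ey R) f (x, y)) = 0].
Proof.
rewrite /= fnu; split.
- exact: surf_NN.
- rewrite fE// innerC /surf -[A0 *m _]mulmx1 surf_inner_N// !scalar_mx2E/=; ring.
- by rewrite surf_Dx// innerC inner_scalel surf_inner_N// !mx2E; ring.
- by rewrite surf_Dy// innerC inner_scalel surf_inner_N// !mx2E; ring.
Qed.

Lemma surf_asymptotic : [/\ IIxx f nu (x, y) = 0, IIyy f nu (x, y) = 0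
  & lorentzian (second_form f nu (x, y))].
Proof.
split => //; rewrite /second_form f_xx f_yy; apply: lorentzian_det.
rewrite mul0r sub0r oppr_lt0 exprn_even_gt0//= f_xy.
(* The second fundamental form is nondegenerate because [mu != -1], which amounts to [rho != 0]. *)
have mu1' : mu^-1 + 1 != 0.
  have r1 : rho + 1 != 0 by rewrite -[1]opprK subr_eq0.
  have rm : rho - 1 != 0 by apply: contra mu0 => /eqP e; rewrite muE e mul0r.
  have -> : mu^-1 + 1 = 2 * rho / (rho - 1) by rewrite muE; field; rewrite rm.
  by rewrite !mulf_neq0 ?invr_neq0 ?pnatr_eq0.
by rewrite !mulf_neq0 ?subr_eq0 ?invr_neq0 ?pnatr_eq0// -subr_eq0.
Qed.

Lemma surf_gauss_curvature : gauss_curvature f nu (x, y) + 1 = rho ^+ 2.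
Proof.
rewrite /gauss_curvature subrK /second_form /first_form surf_Dx// surf_Dy// f_xx f_yy f_xy.
rewrite -(surf_curvature dP dQ mu0 nondeg rhoN1 muE) !det_mx2 !mx2E -!expr2.
by [].
Qed.

End Point.

Lemma surf_CLm n : CLm a b n Fm -> CLm a b n F1 -> CLm a b n surf.
Proof. by move=> h h1; apply: CLmM; [apply: CLmM => //; exact: CLm_cst|exact: CLm_adj2]. Qed.

End Surface.

(** * The potential in coordinates *)

Section Potential.
Context {R : realType}.

Lemma mxoppE (A : 'M[R]_2) i j : (- A) i j = - A i j.
Proof. by rewrite mxE. Qed.

Definition entryE := (@mxaddE R, mxoppE, @mxscaleE R, @mulmx2E R, @mx2E R).
Implicit Types (F N : R -> 'M[R]_2).

Definition pull F N x := adj2 (F x) *m N x *m F x.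

(** With [off2], the off-diagonal entries of [-1/4 [e3, F^-1 N F]]. *)
Definition off1 F N x := pull F N x 0 1 / 2.

Definition off2 F N x := - (pull F N x 1 0 / 2).

Definition velocity F x := adj2 (F x) *m derive1 F x.

Definition vel3 F x := inner (velocity F x) (e3 R).

Lemma bracket_e3 (X : 'M[R]_2) : bracket (e3 R) X = mx2 0 (- (2 * X 0 1)) (2 * X 1 0) 0.
Proof. by apply: mx2P; rewrite /bracket mxsubE !mulmx2E /e3 !mx2E; ring. Qed.

Lemma Ad_invmx F N x : \det (F x) = 1 -> Ad (invmx (F x)) (N x) = pull F N x.
Proof. by move=> d; rewrite /Ad invmxK invmx_adj2. Qed.

Lemma dpw_coefE (X : 'M[R]_2) : - 4^-1 *: bracket (e3 R) X = mx2 0 (X 0 1 / 2) (- (X 1 0 / 2)) 0.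
Proof. by rewrite bracket_e3; apply: mx2P; rewrite mxscaleE !mx2E; field. Qed.

Lemma dpw_potentialE N0 N1 F l x : \det (F x) = 1 ->
  dpw_potential N0 N1 F l x = mxalpha (vel3 F) (off1 F N1) (off2 F N1)
    (off1 F (fun x => derive1 N0 x - N1 x)) (off2 F (fun x => derive1 N0 x - N1 x)) l x.
Proof.
move=> d.
have e1 : dpw_beta N1 F x = mxb (off1 F N1) (off2 F N1) x by rewrite /dpw_beta Ad_invmx// dpw_coefE.
have e2 : dpw_gamma N0 N1 F x =
    mxg (off1 F (fun x => derive1 N0 x - N1 x)) (off2 F (fun x => derive1 N0 x - N1 x)) x.
  by rewrite /dpw_gamma (Ad_invmx (fun x => derive1 N0 x - N1 x) d) dpw_coefE.
have e3 : proj_k (invmx (F x) *m derive1 F x) = mxs0 (vel3 F) x by rewrite /proj_k invmx_adj2.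
by rewrite /dpw_potential e1 e2 e3.
Qed.

Lemma mxalpha_real (s0 b1 b2 g1 g2 : R -> R) (l : R) x :
  mxalpha s0 b1 b2 g1 g2 l%:C%C x = toC (mxs0 s0 x + l *: mxb b1 b2 x + l^-1 *: mxg g1 g2 x).
Proof. by rewrite /mxalpha !toCD !toCZ fmorphV. Qed.

Lemma mxalpha_trace (s0 b1 b2 g1 g2 : R -> R) l x :
  mxalpha s0 b1 b2 g1 g2 l x 0 0 + mxalpha s0 b1 b2 g1 g2 l x 1 1 = 0.
Proof.
have tr0 (A : 'M[R]_2) : \tr A = 0 -> \tr (toC A) = 0.
  by move=> A0; rewrite /toC trace_map_mx A0 rmorph0.
rewrite -tr2E /mxalpha !mxtraceD !mxtraceZ !tr0 ?mulr0 ?addr0// tr2E /mxs0 /mxb /mxg.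
- by rewrite !mx2E addr0.
- by rewrite !mx2E addr0.
- by rewrite !mxscaleE /e3 !mx2E; ring.
Qed.

Lemma derive1_rmder (f : R -> 'M[R]_2) x D : rmder f x D -> derive1 f x = D.
Proof. by move=> /rmder_is_derive[_ <-]; rewrite derive1E. Qed.

End Potential.

(** * The adapted frame and the potential at [l = 1] *)

Section AdaptedFrame.
Context {R : realType}.
Variables (I : set R) (F nut : R -> 'M[R]_2).
Hypotheses (I_open : open I) (I_interval : is_interval I).
Hypotheses (F_smooth : smooth1 I F) (F_det : forall x, I x -> \det (F x) = 1)
  (F_nut : forall x, I x -> F x *m e3 R *m adj2 (F x) = nut x).

Lemma open_itv x : I x -> exists p q, p < x < q /\ forall t, p < t < q -> I t.
Proof. by move=> Ix; have [p [q [h _ h']]] := itv_inside I_open I_interval Ix Ix; exists p, q. Qed.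

Lemma det1_trace (G : R -> 'M[R]_2) x : I x -> (forall x, I x -> \det (G x) = 1) ->
  rmder G x (derive1 G x) -> velocity G x 0 0 + velocity G x 1 1 = 0.
Proof.
move=> Ix G1 dG.
have [p [q [xpq pqI]]] := open_itv Ix.
have d := is_deriveB (is_deriveM (dG 0 0) (dG 1 1)) (is_deriveM (dG 0 1) (dG 1 0)).
have d' := @is_derive_itv_ext _ p q _ _ (fun=> 1) _ xpq _ d.
have [_ e] := d' (fun t tpq => etrans (esym (det_mx2 (G t))) (G1 t (pqI t tpq))).
have [_ e0] := @is_derive_cst _ R R 1 x 1.
rewrite e0 in e.
rewrite /velocity !mulmx2E !mx2E.
by rewrite [RHS]e /GRing.scale/=; ring.
Qed.

Lemma frame_rmder x : I x -> rmder F x (F x *m velocity F x).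
Proof.
move=> Ix; apply: rmder_eq (smooth1_rmder F_smooth Ix).
by rewrite /velocity mulmxA mulmx_adj2 F_det// mul1mx.
Qed.

Lemma velocity_trace x : I x -> velocity F x 0 0 + velocity F x 1 1 = 0.
Proof. by move=> Ix; exact: det1_trace Ix F_det (smooth1_rmder F_smooth Ix). Qed.

Lemma pullM (X : 'M[R]_2) x : \det (F x) = 1 ->
  adj2 (F x) *m (F x *m X *m adj2 (F x)) *m F x = X.
Proof.
by move=> d; rewrite !mulmxA adj2_mulmx d mul1mx -mulmxA adj2_mulmx d mulmx1.
Qed.

(** Conjugating the derivative of [F e3 F^-1] back by [F] leaves the commutator of [F^-1 F'] with
    [e3]. *)
Lemma pull_derive x : I x ->
  pull F (derive1 nut) x = velocity F x *m e3 R - e3 R *m velocity F x.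
Proof.
move=> Ix; have [p [q [xpq pqI]]] := open_itv Ix.
have h := rmder_sandwich (velocity_trace Ix) (frame_rmder Ix) (rmder_cst (e3 R) x) (frame_rmder Ix).
have h' : rmder nut x _ := rmder_ext xpq (fun t tpq => F_nut (pqI t tpq)) h.
by rewrite /pull (derive1_rmder h') pullM ?F_det// addr0.
Qed.

Lemma pullB N0 N1 x : pull F (fun x => N0 x - N1 x) x = pull F N0 x - pull F N1 x.
Proof. by rewrite /pull mulmxBr mulmxBl. Qed.

(** At [l = 1] the contributions of [N1] cancel, and [-1/4 [e3, [v, e3]]] is the off-diagonal part
    of [v = F^-1 F']. Its diagonal part is a multiple of [e3], since [v] has trace 0. *)
Lemma potential_at1 N1 x : I x ->
  mxs0 (vel3 F) x + 1 *: mxb (off1 F N1) (off2 F N1) x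
  + 1^-1 *: mxg (off1 F (fun x => derive1 nut x - N1 x)) (off2 F (fun x => derive1 nut x - N1 x)) x
  = velocity F x.
Proof.
move=> Ix; rewrite invr1 !scale1r.
have tr : velocity F x 1 1 = - velocity F x 0 0.
  by apply/eqP; rewrite -addr_eq0 addrC velocity_trace.
rewrite /mxs0 /mxb /mxg /off1 /off2 pullB pull_derive// /vel3 innerE.
move: (velocity F x) (pull F N1 x) tr => v z tr.
by apply: mx2P; rewrite /e3 ?entryE ?tr; field.
Qed.

End AdaptedFrame.

(** * The algebra behind the choice of [N1] *)

Section ReflectionAlgebra.
Context {R : realType}.
Variables (rho : R) (H Z V X : 'M[R]_2).
Hypotheses (rho0 : rho != 0) (rho1 : rho != 1) (rhoN1 : rho != -1).

(** Read backwards, this is the origin of [N1]: with [mu - mu^-1 = -4 rho / (rho^2 - 1)] each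
    off-diagonal equation can be solved for the entry of [X], and the solution is the stated
    combination of [Z] and [V]. *)
Lemma reflection_split : H 0 0 = 0 -> H 1 1 = 0 -> V = mx2 0 (- H 0 1) (H 1 0) 0 ->
  X = ((rho + 1) / (2 * rho)) *: (Z + (rho - 1) *: V) ->
  H = ((rho - 1) / (rho + 1) - 1) *: mx2 0 (X 0 1 / 2) (- (X 1 0 / 2)) 0
    + (((rho - 1) / (rho + 1))^-1 - 1) *: mx2 0 ((Z - X) 0 1 / 2) (- ((Z - X) 1 0 / 2)) 0.
Proof.
have r1 : rho + 1 != 0 by rewrite -[1]opprK subr_eq0.
have rm : rho - 1 != 0 by rewrite subr_eq0.
move=> h0 h1 VE XE.
have X01 : X 0 1 = (rho + 1) / (2 * rho) * (Z 0 1 - (rho - 1) * H 0 1).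
  by rewrite XE VE !entryE mulrN.
have X10 : X 1 0 = (rho + 1) / (2 * rho) * (Z 1 0 + (rho - 1) * H 1 0).
  by rewrite XE VE !entryE.
apply: mx2P; rewrite !entryE ?h0 ?h1 ?mulr0 ?addr0// ?X01 ?X10.
- by move: (H 0 1) (Z 0 1) => h z; field; rewrite rho0 r1 rm.
- by move: (H 1 0) (Z 1 0) => h z; field; rewrite rho0 r1 rm.
Qed.

(** The left side is alternating in [X] and [Z - X]: the latter may be replaced by [Z], after which
    only the part of [X] along [V] survives. *)
Lemma reflection_det : X = ((rho + 1) / (2 * rho)) *: (Z + (rho - 1) *: V) ->
  X 0 1 / 2 * - ((Z - X) 1 0 / 2) - - (X 1 0 / 2) * ((Z - X) 0 1 / 2) =
  (rho + 1) / (2 * rho) * (rho - 1) / 4 * (V 1 0 * Z 0 1 - V 0 1 * Z 1 0).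
Proof. by move=> ->; rewrite !entryE; field. Qed.

(** If the determinant vanished, [V01 Z - Z01 V] and [V10 Z - Z10 V] would both be zero; freeness
    then kills both entries of [V], hence [V]. *)
Lemma free_offdiag : free [:: Z; V] -> Z 0 0 = 0 -> Z 1 1 = 0 -> V 0 0 = 0 -> V 1 1 = 0 ->
  V 1 0 * Z 0 1 - V 0 1 * Z 1 0 != 0.
Proof.
move=> /free2P fr z0 z1 v0 v1; apply/eqP => d0.
have c1 : V 0 1 *: Z + (- Z 0 1) *: V = 0.
  apply: mx2P; rewrite !entryE ?z0 ?v0 ?z1 ?v1 [RHS]mxE; lra.
have c2 : V 1 0 *: Z + (- Z 1 0) *: V = 0.
  apply: mx2P; rewrite !entryE ?z0 ?v0 ?z1 ?v1 [RHS]mxE; lra.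
have [v01 _] := fr _ _ c1; have [v10 _] := fr _ _ c2.
have V0 : V = 0 by rewrite (mx2_eta V) v0 v1 v01 v10; apply: mx2P; rewrite mx2E mxE.
have [_ /eqP] := fr 0 1 (ltac:(by rewrite V0 scale0r scaler0 addr0)).
by rewrite oner_eq0.
Qed.

Lemma free_conj (F : 'M[R]_2) : \det F = 1 -> free [:: Z; V] ->
  free [:: adj2 F *m Z *m F; adj2 F *m V *m F].
Proof.
move=> dF /free2P fr; apply/free2P => k l h; apply: fr.
have bk (N : 'M[R]_2) : F *m (adj2 F *m N *m F) *m adj2 F = N.
  by rewrite !mulmxA mulmx_adj2 dF mul1mx -mulmxA mulmx_adj2 dF mulmx1.
have := congr1 (fun N => F *m N *m adj2 F) h.
by rewrite mulmx0 mul0mx mulmxDr mulmxDl -!scalemxAr -!scalemxAl !bk.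
Qed.

End ReflectionAlgebra.

(** * The potential at [mu], and nondegeneracy on the diagonal *)

Section Reflection.
Context {R : realType}.
Variables (I : set R) (F ft nut : R -> 'M[R]_2) (rho : R).
Hypotheses (I_open : open I) (I_interval : is_interval I).
Hypotheses (F_smooth : smooth1 I F) (F_det : forall x, I x -> \det (F x) = 1)
  (F_nut : forall x, I x -> F x *m e3 R *m adj2 (F x) = nut x).
Hypotheses (ft_smooth : smooth1 I ft) (ft_det : forall x, I x -> \det (ft x) = 1)
  (ft_nut : forall x, I x -> inner (velocity ft x) (nut x) = 0).
Hypotheses (rho0 : rho != 0) (rho1 : rho != 1) (rhoN1 : rho != -1).

Let W x := 2^-1 *: bracket (nut x) (velocity ft x).
Let N1 x := ((rho + 1) / (2 * rho)) *: (derive1 nut x + (rho - 1) *: W x).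
Let mu := (rho - 1) / (rho + 1).
Let H x := pull F (velocity ft) x.

(** The trace is 0 because [ft] has determinant 1, and the component along [e3] is 0 because
    [ft^-1 ft'] is orthogonal to [nut = F e3 F^-1]. *)
Let H_diag x : I x -> H x 0 0 = 0 /\ H x 1 1 = 0.
Proof.
move=> Ix.
have dF := F_det Ix.
have e1 : H x 1 1 - H x 0 0 = 0.
  have := ft_nut Ix; rewrite -(F_nut Ix).
  have -> : velocity ft x = F x *m H x *m adj2 (F x).
    by rewrite /H /pull !mulmxA mulmx_adj2 dF mul1mx -mulmxA mulmx_adj2 dF mulmx1.
  rewrite inner_isometry ?det_adj2// innerE /e3 !mx2E => e.
  by rewrite -[RHS](mulr0 2) -e; field.
have e2 : H x 0 0 + H x 1 1 = 0.
  have h := det1_trace I_open I_interval Ix ft_det (smooth1_rmder ft_smooth Ix).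
  by rewrite -tr2E /H /pull mxtrace_mulC mulmxA mulmx_adj2 dF mul1mx tr2E.
split; lra.
Qed.

Let pull_W x : I x -> pull F W x = mx2 0 (- H x 0 1) (H x 1 0) 0.
Proof.
move=> Ix; have dF := F_det Ix.
have -> : pull F W x = 2^-1 *: bracket (e3 R) (H x).
  rewrite /pull /W -scalemxAr -scalemxAl; congr (_ *: _).
  rewrite -(F_nut Ix) /bracket mulmxBr mulmxBl; congr (_ - _).
    by rewrite /H /pull !mulmxA adj2_mulmx dF mul1mx.
  by rewrite /H /pull -!mulmxA adj2_mulmx dF mulmx1.
by rewrite bracket_e3; apply: mx2P; rewrite mxscaleE !mx2E; field.
Qed.

Let pull_N1 x : pull F N1 x =
  ((rho + 1) / (2 * rho)) *: (pull F (derive1 nut) x + (rho - 1) *: pull F W x).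
Proof.
by rewrite /pull /N1 -scalemxAr -scalemxAl mulmxDr mulmxDl -scalemxAr -scalemxAl.
Qed.

Lemma potential_at_mu x : I x ->
  mxs0 (vel3 F) x + mu *: mxb (off1 F N1) (off2 F N1) x
  + mu^-1 *: mxg (off1 F (fun x => derive1 nut x - N1 x)) (off2 F (fun x => derive1 nut x - N1 x)) x
  = H x + velocity F x.
Proof.
move=> Ix; have [h0 h1] := H_diag Ix.
have e : H x = (mu - 1) *: mxb (off1 F N1) (off2 F N1) x
  + (mu^-1 - 1) *: mxg (off1 F (fun x => derive1 nut x - N1 x)) (off2 F (fun x => derive1 nut x - N1 x)) x.
  rewrite (reflection_split rho0 rho1 rhoN1 h0 h1 (pull_W Ix) (pull_N1 x)).
  by rewrite -pullB.
rewrite e -(potential_at1 I_open I_interval F_smooth F_det F_nut N1 Ix) invr1 !scale1r.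
move: (mxs0 _ _) (mxb _ _ _) (mxg _ _ _) => S B G.
by apply/matrixP => i j; rewrite !entryE; ring.
Qed.

Lemma nondegenerate x : I x -> free [:: derive1 nut x; W x] ->
  off1 F N1 x * off2 F (fun x => derive1 nut x - N1 x) x
  - off2 F N1 x * off1 F (fun x => derive1 nut x - N1 x) x != 0.
Proof.
move=> Ix fr; have dF := F_det Ix.
have Z0 : pull F (derive1 nut) x 0 0 = 0 /\ pull F (derive1 nut) x 1 1 = 0.
  rewrite (pull_derive I_open I_interval F_smooth F_det F_nut)// /e3 !entryE.
  by split; ring.
have V0 : pull F W x 0 0 = 0 /\ pull F W x 1 1 = 0 by rewrite pull_W// !mx2E.
rewrite /off1 /off2 pullB (reflection_det rho0 (pull_N1 x)).
rewrite mulf_neq0 ?(free_offdiag (free_conj dF fr))//; 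
  [|exact: Z0.1|exact: Z0.2|exact: V0.1|exact: V0.2].
have r1 : rho + 1 != 0 by rewrite -[1]opprK subr_eq0.
have rm : rho - 1 != 0 by rewrite subr_eq0.
by rewrite !mulf_neq0 ?invr_neq0 ?mulf_neq0 ?pnatr_eq0.
Qed.

End Reflection.

(** * Squares around diagonal points on which the contraction works *)

Section GoodSquares.
Context {R : realType}.
Variables (s0 b1 b2 g1 g2 : R -> R).

Definition good_square (a b : R) := [/\ a < b, b - a <= 1,
  [/\ smooth_data a b s0, smooth_data a b b1, smooth_data a b b2,
      smooth_data a b g1 & smooth_data a b g2] &
  exists M : R, [/\ 0 <= M, 4 * (b - a) * (M + 2 * (M * M * expR 2)) <= 1 &
    [/\ bound1 a b M s0, bound1 a b M b1, bound1 a b M b2,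
        bound1 a b M g1 & bound1 a b M g2]]].

Local Notation u := (sg_sol s0 b1 b2 g1 g2).
Local Notation s := (sg_velocity s0 b1 b2 g1 g2 u).

Lemma good_square_sol a b : good_square a b ->
  [/\ forall n, CL a b n u, forall n, CL a b n s,
      partialx a b u (fun x y => 2 * s x y),
      partialy a b s (fun x y => b2 x * coefc1 g1 u x y - b1 x * coefc2 g2 u x y) &
      forall x, a < x < b -> u x x = 0].
Proof.
move=> [ab ab1 [hs0 hb1 hb2 hg1 hg2] [M [M0 small [ks0 kb1 kb2 kg1 kg2]]]].
split.
- by move=> n; exact: sg_sol_CL ks0 kb1 kb2 kg1 kg2 ab ab1 small n.
- by move=> n; exact: sg_sol_velocity_CL ks0 kb1 kb2 kg1 kg2 ab ab1 small n.
- exact: partialx_sg_sol ks0 kb1 kb2 kg1 kg2 ab ab1 small.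
- move=> x y xab yab.
  apply: is_derive_eq (partialy_sg_sol_velocity
    hs0 hb1 hb2 hg1 hg2 M0 ks0 kb1 kb2 kg1 kg2 ab ab1 small xab yab) _.
  by rewrite /sg_rhs /coefc1 /coefc2 !mulrA.
- exact: (sg_sol_diag hs0 hb1 hb2 hg1 hg2 M0 ks0 kb1 kb2 kg1 kg2 ab ab1 small).
Qed.

Variable I : set R.
Hypotheses (I_open : open I) (I_interval : is_interval I).
Hypothesis data : forall a b, a < b -> (forall x, a <= x <= b -> I x) ->
  [/\ smooth_data a b s0, smooth_data a b b1, smooth_data a b b2,
      smooth_data a b g1 & smooth_data a b g2].

(** The bound [M] is taken on a first square and the final one is chosen inside it, so that
    shrinking does not change [M]. *)
Lemma good_square_exists x : I x -> exists a b,
  [/\ a < x < b, good_square a b & forall t, a <= t <= b -> I t].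
Proof.
move=> Ix; have [p [q [/andP[px xq] pqI]]] := open_itv I_open I_interval Ix.
pose a0 := (p + x) / 2; pose b0 := (x + q) / 2.
have [a0x xb0 pa0 b0q] : [/\ a0 < x, x < b0, p < a0 & b0 < q].
  by rewrite /a0 /b0; split; lra.
have I0 t : a0 <= t <= b0 -> I t.
  by move=> /andP[t1 t2]; apply: pqI; apply/andP; split; lra.
have [d0 d1 d2 d3 d4] := data (lt_trans a0x xb0) I0.
have bd f : smooth_data a0 b0 f -> exists m, 0 <= m /\ forall t, a0 < t < b0 -> `|f t| <= m.
  move=> h; have [m [m0 hm _ _]] := CL_lip (h 0%N).
  by exists m; split => // t tab; exact: (hm t t tab tab).
have [m0 [p0 h0]] := bd _ d0; have [m1 [p1 h1]] := bd _ d1.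
have [m2 [p2 h2]] := bd _ d2; have [m3 [p3 h3]] := bd _ d3.
have [m4 [p4 h4]] := bd _ d4.
pose M := m0 + m1 + m2 + m3 + m4.
have M0 : 0 <= M by rewrite /M; lra.
pose K := M + 2 * (M * M * expR 2).
have K0 : 0 <= K by rewrite addr_ge0// !mulr_ge0// expR_ge0.
(* The side is [2 * e]: the constant 8 gives [4 * (2 * e) * K <= 1], and [K + 1] in place of [K]
   also bounds the side by 1. *)
pose e := Num.min (Num.min (x - a0) (b0 - x)) (1 / (8 * (K + 1))).
have K1 : 0 < 8 * (K + 1) by lra.
have e0 : 0 < e by rewrite !lt_min !subr_gt0 a0x xb0 divr_gt0.
have [ea eb eK] : [/\ e <= x - a0, e <= b0 - x & e <= 1 / (8 * (K + 1))].
  by rewrite /e !ge_min !lexx !orbT.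
have eK' : e * (8 * (K + 1)) <= 1 by rewrite -ler_pdivlMr.
have eK0 : 0 <= e * K by rewrite mulr_ge0// ltW.
have sub t : x - e < t < x + e -> a0 < t < b0.
  by move=> /andP[t1 t2]; apply/andP; split; lra.
have subI t : x - e <= t <= x + e -> I t.
  by move=> /andP[t1 t2]; apply: I0; apply/andP; split; lra.
exists (x - e), (x + e); split => //.
  by apply/andP; split; lra.
split; [lra|lra| |].
  by apply: data => //; lra.
exists M; split => //; first by rewrite -/K; lra.
by split => t /sub tab; [move: (h0 t tab)|move: (h1 t tab)|move: (h2 t tab)|
  move: (h3 t tab)|move: (h4 t tab)] => h; apply: (le_trans h); rewrite /M; lra.
Qed.

End GoodSquares.

(** * Frame, immersion and Gauss map on a neighbourhood of the diagonal *)

Section Construction.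
Context {R : realType}.
Variables (I : set R) (x0 : R) (F ft nut : R -> 'M[R]_2) (rho : R).
Hypotheses (I_open : open I) (I_interval : is_interval I) (Ix0 : I x0).
Hypotheses (F_smooth : smooth1 I F) (F_det : forall x, I x -> \det (F x) = 1)
  (F_nut : forall x, I x -> F x *m e3 R *m adj2 (F x) = nut x).
Hypotheses (ft_smooth : smooth1 I ft) (ft_det : forall x, I x -> \det (ft x) = 1)
  (ft_nut : forall x, I x -> inner (velocity ft x) (nut x) = 0)
  (nut_smooth : smooth1 I nut).
Hypotheses (rho0 : rho != 0) (rho1 : rho != 1) (rhoN1 : rho != -1).

Let W x := 2^-1 *: bracket (nut x) (velocity ft x).
Let N1 x := ((rho + 1) / (2 * rho)) *: (derive1 nut x + (rho - 1) *: W x).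
Let N2 x := derive1 nut x - N1 x.
Let mu := (rho - 1) / (rho + 1).
Hypothesis nut_free : forall x, I x -> free [:: derive1 nut x; W x].

Let s0 := vel3 F.
Let b1 := off1 F N1.
Let b2 := off2 F N1.
Let g1 := off1 F N2.
Let g2 := off2 F N2.
Let u := sg_sol s0 b1 b2 g1 g2.
Let s := sg_velocity s0 b1 b2 g1 g2 u.

Lemma CLm_scale a b n (k : R) (V : R -> R -> 'M[R]_2) : CLm a b n V ->
  CLm a b n (fun x y => k *: V x y).
Proof. by move=> h i j; apply: CL_ext (CLZ k (h i j)) => x y _ _; rewrite mxscaleE. Qed.

Let data a b : a < b -> (forall x, a <= x <= b -> I x) ->
  [/\ smooth_data a b s0, smooth_data a b b1, smooth_data a b b2,
      smooth_data a b g1 & smooth_data a b g2].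
Proof.
move=> ab abI.
have sm G n : smooth1 I G -> CLm a b n (fun x y => G x) by move=> h; exact: (smooth1_CLm n h ab abI).
have sv G n : smooth1 I G -> CLm a b n (fun x y => velocity G x).
  by move=> h; exact: (CLmM (CLm_adj2 (sm G n h)) (sm _ n (smooth1_derive h))).
have sN n := sm _ n (smooth1_derive nut_smooth).
have sW n : CLm a b n (fun x y => W x).
  have h1 := CLmM (sm nut n nut_smooth) (sv ft n ft_smooth).
  have h2 := CLmM (sv ft n ft_smooth) (sm nut n nut_smooth).
  exact: (CLm_scale 2^-1 (CLmB h1 h2)).
have sN1 n : CLm a b n (fun x y => N1 x).
  exact: (CLm_scale _ (CLmD (sN n) (CLm_scale (rho - 1) (sW n)))).
have sN2 n : CLm a b n (fun x y => N2 x) := CLmB (sN n) (sN1 n).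
have sp G n : CLm a b n (fun x y => G x) -> CLm a b n (fun x y => pull F G x).
  by move=> h; exact: (CLmM (CLmM (CLm_adj2 (sm F n F_smooth)) h) (sm F n F_smooth)).
have so1 G : (forall n, CLm a b n (fun x y => G x)) -> smooth_data a b (off1 F G).
  move=> h n; have h' := CLZ 2^-1 (sp G n (h n) 0 1).
  by apply: CL_ext h' => x y _ _; rewrite /off1 mulrC.
have so2 G : (forall n, CLm a b n (fun x y => G x)) -> smooth_data a b (off2 F G).
  move=> h n; have h' := CLZ (- 2^-1) (sp G n (h n) 1 0).
  by apply: CL_ext h' => x y _ _; rewrite /off2 mulNr mulrC.
split; [|exact: so1|exact: so2|exact: so1|exact: so2].
move=> n; have h := sv F n F_smooth.
apply: CL_ext (CLZ 2^-1 (CLB (h 1 1) (h 0 0))) => x y _ _.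
by rewrite /s0 /vel3 innerE /e3 !mx2E; field.
Qed.

Variable X : R -> R[i] -> 'M[R[i]]_2.
Hypotheses (X_x0 : forall l, l != 0 -> X x0 l = toC (F x0))
  (dX : forall l t, l != 0 -> I t ->
     mcder (X^~ l) t (X t l *m mxalpha s0 b1 b2 g1 g2 l t)).

Lemma X_det l t : l != 0 -> I t -> \det (X t l) = 1.
Proof.
move=> l0 It.
rewrite (ode_det I_open I_interval Ix0 _ (fun t It => dX l0 It) It) ?X_x0 ?det_toC ?F_det//.
by move=> r _; exact: mxalpha_trace.
Qed.

Lemma X_unique l V t : l != 0 -> V x0 = toC (F x0) ->
  (forall t, I t -> mcder V t (V t *m mxalpha s0 b1 b2 g1 g2 l t)) -> I t -> V t = X t l.
Proof.
move=> l0 V0 dV It.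
apply: (ode_unique I_open I_interval Ix0 _ dV (fun t It => dX l0 It)) => //.
- by move=> r _; exact: mxalpha_trace.
- by rewrite X_x0.
- exact: X_det.
Qed.

Lemma toC_neq0 (l : R) : l != 0 -> l%:C%C != 0 :> R[i].
Proof. by apply: contra => /eqP e; apply/eqP; have := congr1 (@complex.Re R) e. Qed.

(** For real [l] the potential and the initial value are real, so the conjugate of [X] solves the
    same Cauchy problem. *)
Lemma X_real l t : l != 0 -> I t -> map_mx (@conjc R) (X t l%:C%C) = X t l%:C%C.
Proof.
move=> l0; have lC0 := toC_neq0 l0; 
apply: (X_unique (V := fun t => map_mx (@conjc R) (X t l%:C%C)) lC0).
  by rewrite X_x0// map_conj_toC.
move=> r Ir; apply: mcder_eq (mcder_conj (dX lC0 Ir)).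
by rewrite map_conjM mxalpha_real map_conj_toC.
Qed.

Lemma X_at1 t : I t -> X t 1 = toC (F t).
Proof.
move=> It; symmetry; apply: (X_unique (V := fun t => toC (F t)) (oner_neq0 _)) => // r Ir.
apply: mcder_eq (mcder_toC (frame_rmder F_smooth F_det Ir)).
rewrite toCM; congr (_ *m _).
rewrite -(potential_at1 I_open I_interval F_smooth F_det F_nut N1 Ir).
by rewrite -mxalpha_real.
Qed.

Let mu0 : mu != 0.
Proof. by rewrite mulf_neq0 ?subr_eq0// invr_neq0// -[1]opprK subr_eq0. Qed.

Let mu1 : mu != 1.
Proof.
apply/eqP => e; have r1 : rho + 1 != 0 by rewrite -[1]opprK subr_eq0.
have : rho - 1 = rho + 1 by rewrite -[rho - 1](divfK r1) -/mu e mul1r.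
lra.
Qed.

Lemma X_at_mu t : I t -> X t mu%:C%C = toC (adj2 (ft x0) *m ft t *m F t).
Proof.
move=> It; symmetry.
apply: (X_unique (V := fun t => toC (adj2 (ft x0) *m ft t *m F t)) (toC_neq0 mu0)) => //.
  by rewrite adj2_mulmx ft_det// mul1mx.
move=> r Ir.
have d := rmderM (rmderM (rmder_cst (adj2 (ft x0)) r) (smooth1_rmder ft_smooth Ir))
  (frame_rmder F_smooth F_det Ir).
apply: mcder_eq (mcder_toC d).
rewrite mxalpha_real -toCM; congr toC.
rewrite (potential_at_mu I_open I_interval F_smooth F_det F_nut
  ft_smooth ft_det ft_nut rho0 rho1 rhoN1 Ir).
rewrite mul0mx add0r mulmxDr !mulmxA; congr (_ + _).
rewrite /pull /velocity ?mulmxA; congr (_ *m _).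
rewrite -(mulmxA _ (F r) (adj2 _)) mulmx_adj2 F_det// mulmx1.
by rewrite -(mulmxA _ (ft r) (adj2 _)) mulmx_adj2 ft_det// mulmx1.
Qed.

Let c1 := coefc1 g1 u.
Let c2 := coefc2 g2 u.
Let nondeg x y := b1 x * c2 x y - b2 x * c1 x y.

Let good a b := good_square s0 b1 b2 g1 g2 a b /\ forall t, a <= t <= b -> I t.

(** A point needs some good square containing both of its coordinates, and nondegeneracy at the
    point itself; the width of the domain may shrink towards the ends of [I]. *)
Definition Omega : set (R * R) := [set p | nondeg p.1 p.2 != 0 /\
  exists a b, [/\ good a b, a < p.1 < b & a < p.2 < b]].

Let goodI a b t : good a b -> a < t < b -> I t.
Proof. by move=> [_ h] /andP[at_ tb]; apply: h; rewrite !ltW. Qed.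

Lemma Omega_open : open Omega.
Proof.
rewrite openE => p [nd [a [b [gab p1 p2]]]].
have [[_ _ [_ hb1 hb2 hg1 hg2] _] _] := gab.
have [uCL _ _ _ _] := good_square_sol gab.1.
have hn : CL a b 0 nondeg.
  apply: CLB; apply: CLM; [exact: hb1|exact: coefc2_CL|exact: hb2|exact: coefc1_CL].
(* The scalar is placed in the corner of a matrix so that the continuity result for matrix classes
   applies. *)
pose G q : 'M[R]_2 := mx2 (nondeg q.1 q.2) 0 0 0.
have cG : {for p, continuous G}.
  apply: (CLm_continuous (g := fun x y => mx2 (nondeg x y) 0 0 0) _ p1 p2) => //.
  by apply: CLm_mx2 => //; exact: CL_cst.
have cn : {for p, continuous (fun q => G q 0 0)}.
  have h := @continuous_comp _ _ _ G (fun M : 'M[R]_2 => M 0 0) p cG.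
  by apply: h; exact: coord_continuous.
have n0 : \forall q \near p, G q 0 0 != 0.
  by apply: (cvgr_neq0 _ cn); rewrite mx2E.
have n1 : \forall q \near p, a < q.1 < b /\ a < q.2 < b by apply: (near_square p1 p2).
apply: filterS2 n0 n1 => q; rewrite mx2E => q0 [q1 q2].
by split => //; exists a, b.
Qed.

Lemma Omega_diag x : I x -> Omega (x, x).
Proof.
move=> Ix; have [a [b [xab gab abI]]] := good_square_exists I_open I_interval data Ix.
split; last by exists a, b.
have [_ _ _ _ u0] := good_square_sol gab.
rewrite /nondeg /c1 /c2 /coefc1 /coefc2 /= /u u0// oppr0 expR0 !mulr1.
have h := nondegenerate I_open I_interval F_smooth F_det F_nut rho0 rho1 rhoN1 Ix (nut_free Ix).
exact: h.
Qed.

Lemma Omega_sub : Omega `<=` I `*` I.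
Proof. by move=> [x y] [_ [a [b [gab xab yab]]]]; split => /=; exact: goodI gab _. Qed.

Definition Hm (p : R * R) (l : R[i]) := Hminus g1 g2 u l^-1 p.1 p.2.
Definition Hp (p : R * R) (l : R[i]) := Hplus b1 b2 u l p.1 p.2.

Lemma factorization p l : Omega p -> l != 0 -> X p.1 l *m (Hm p l *m Hp p l) = X p.2 l.
Proof.
move=> [_ [a [b [gab xab yab]]]] l0.
have [[_ _ [hs0 hb1 hb2 hg1 hg2] _] _] := gab.
have [uCL sCL ux sy u0] := good_square_sol gab.1.
apply: (birkhoff_square hs0 hb1 hb2 hg1 hg2 uCL sCL ux sy u0 _ l0) => //.
- by move=> x _; exact: sg_velocity_diag.
- by move=> t tab; apply: dX => //; exact: goodI gab tab.
Qed.

Lemma Omega_loops p : Omega p ->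
  [/\ loop_group_minus (Hm p), loop_group_plus (Hp p),
      forall l, \det (Hm p l) = 1 & forall l, \det (Hp p l) = 1].
Proof.
move=> [_ [a [b [gab xab yab]]]].
have [[_ _ [hs0 hb1 hb2 hg1 hg2] _] _] := gab.
have [uCL sCL ux sy u0] := good_square_sol gab.1.
split.
- exact: (Hminus_loop hg1 hg2 uCL xab yab).
- exact: (Hplus_loop hb1 hb2 uCL xab yab).
- by move=> l; exact: (det_Hminus hg1 hg2 uCL _ xab yab).
- by move=> l; exact: (det_Hplus hb1 hb2 uCL _ xab yab).
Qed.

Lemma unitmx_det1 (A : 'M[R[i]]_2) : \det A = 1 -> A \in unitmx.
Proof. by move=> d; rewrite unitmxE d unitr1. Qed.

Variable Y : R -> R[i] -> 'M[R[i]]_2.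
Hypothesis YX : forall l t, l != 0 -> I t -> Y t l = X t l.

Lemma birkhoff : birkhoff_factorization Omega X Y Hm Hp.
Proof.
move=> p Op; have [hm hp _ _] := Omega_loops Op.
split => // l l1.
have l0 : l != 0 by rewrite -normr_gt0 l1.
have [I1 I2] := Omega_sub Op.
by rewrite YX// -(factorization Op l0) mulKmx// unitmx_det1// X_det.
Qed.

(** The factorization holds for every [l != 0] and not only on the circle, so the branch [Y H_+^-1]
    equals [X H_-] inside the disc as well. One formula then serves at [mu], which may lie on either
    side of the circle. *)
Lemma extended_frameE p l : Omega p -> l != 0 ->
  extended_frame X Y Hm Hp p l = X p.1 l *m Hm p l.
Proof.
move=> Op l0; rewrite /extended_frame; case: ifP => // _.
have [I1 I2] := Omega_sub Op; have [_ _ _ dp] := Omega_loops Op.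
by rewrite YX// -(factorization Op l0) mulmxA mulmxK// unitmx_det1.
Qed.

Let Fr l x y := real_frame g1 g2 u X l x y.

Definition immersion (p : R * R) := surf (ft x0) (Fr mu) (Fr 1) p.1 p.2.

Definition gauss (p : R * R) := Fr 1 p.1 p.2 *m e3 R *m adj2 (Fr 1 p.1 p.2).

Section OneSquare.
Variables a b : R.
Hypothesis gab : good a b.

Lemma toC_Fr l x y : l != 0 -> a < x < b -> a < y < b ->
  toC (Fr l x y) = X x l%:C%C *m Hm (x, y) l%:C%C.
Proof.
move=> l0 xab yab.
have [[_ _ [hs0 hb1 hb2 hg1 hg2] _] _] := gab.
have [uCL sCL ux sy u0] := good_square_sol gab.1.
apply: (toC_real_frame hg1 hg2 uCL) => // t tab.
by apply: X_real => //; exact: goodI gab tab.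
Qed.

Lemma Fr_frame l : l != 0 ->
  [/\ forall x y, a < x < b -> a < y < b -> \det (Fr l x y) = 1,
      forall x y, a < x < b -> a < y < b ->
        rmder ((Fr l)^~ y) x (Fr l x y *m (mxs s x y + l *: mxb b1 b2 x)) &
      forall x y, a < x < b -> a < y < b ->
        rmder (Fr l x) y (Fr l x y *m (l^-1 *: mxc g1 g2 u x y))].
Proof.
move=> l0; have lC0 := toC_neq0 l0.
have [[_ _ [hs0 hb1 hb2 hg1 hg2] _] _] := gab.
have [uCL sCL ux sy u0] := good_square_sol gab.1.
have dX' t : a < t < b -> mcder (X^~ l%:C%C) t (X t l%:C%C *m mxalpha s0 b1 b2 g1 g2 l%:C%C t).
  by move=> tab; apply: dX => //; exact: goodI gab tab.
have Xr t : a < t < b -> map_mx (@conjc R) (X t l%:C%C) = X t l%:C%C.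
  by move=> tab; apply: X_real => //; exact: goodI gab tab.
have Xd t : a < t < b -> \det (X t l%:C%C) = 1.
  by move=> tab; apply: X_det => //; exact: goodI gab tab.
have s0s x : a < x < b -> s x x = s0 x by move=> _; exact: sg_velocity_diag.
split.
- by move=> x y xab yab; exact: (det_real_frame hg1 hg2 uCL Xr Xd).
- by move=> x y xab yab; 
  exact: (real_frame_x hs0 hb1 hb2 hg1 hg2 uCL sCL ux sy u0 s0s l0 dX' Xr xab yab).
- by move=> x y xab yab; exact: (real_frame_y hg1 hg2 uCL Xr xab yab).
Qed.

(** [V] is an explicit value of [X] at the parameter, entering through the bound that it gives; at 1
    and at [mu] it is expressed by [F] and [ft]. *)
Lemma Fr_CLm l V n : l != 0 -> (forall n, CLm a b n (fun x y => V x)) ->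
  (forall t, a < t < b -> X t l%:C%C = toC (V t)) -> CLm a b n (Fr l).
Proof.
move=> l0 VCL XV.
have [[_ _ [hs0 hb1 hb2 hg1 hg2] _] _] := gab.
have [uCL sCL ux sy u0] := good_square_sol gab.1.
have [D [D0 hD _]] := uniform_blip (VCL 0%N).
have dX' t : a < t < b -> mcder (X^~ l%:C%C) t (X t l%:C%C *m mxalpha s0 b1 b2 g1 g2 l%:C%C t).
  by move=> tab; apply: dX; [exact: toC_neq0|exact: goodI gab tab].
have Xr t : a < t < b -> map_mx (@conjc R) (X t l%:C%C) = X t l%:C%C.
  by move=> tab; apply: X_real => //; exact: goodI gab tab.
have s0s x : a < x < b -> s x x = s0 x by move=> _; exact: sg_velocity_diag.
apply: (real_frame_CLm hs0 hb1 hb2 hg1 hg2 uCL sCL ux sy u0 s0s l0 dX' Xr n (D := D)).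
by move=> x i j xab; rewrite XV// mxRe_toC; exact: (hD x xab).1 x i j xab.
Qed.

Lemma immersion_CLm n : CLm a b n (fun x y => immersion (x, y)).
Proof.
have [ab _ _ _] := gab.1; have abI := gab.2.
have sm G k : smooth1 I G -> CLm a b k (fun x y => G x) by move=> h; exact: smooth1_CLm h ab abI.
apply: surf_CLm.
- apply: (Fr_CLm n (V := fun t => adj2 (ft x0) *m ft t *m F t) mu0).
    by move=> k; apply: CLmM (sm _ _ F_smooth); apply: CLmM (sm _ _ ft_smooth); exact: CLm_cst.
  by move=> t tab; apply: X_at_mu; exact: goodI gab tab.
- apply: (Fr_CLm n (V := F) (oner_neq0 _)); first by move=> k; exact: sm.
  by move=> t tab; apply: X_at1; exact: goodI gab tab.
Qed.

End OneSquare.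

Lemma immersion_geometry p : Omega p ->
  [/\ [/\ AdS3 (immersion p),
          free [:: 'D_(ex R) immersion p; 'D_(ey R) immersion p]
        & lorentzian (first_form immersion p)],
      let N := immersion p *m gauss p in
      [/\ inner N N = 1, inner N (immersion p) = 0,
          inner N ('D_(ex R) immersion p) = 0
        & inner N ('D_(ey R) immersion p) = 0],
      [/\ IIxx immersion gauss p = 0, IIyy immersion gauss p = 0
        & lorentzian (second_form immersion gauss p)]
    & gauss_curvature immersion gauss p + 1 = rho ^+ 2].
Proof.
case: p => x y [/= nd [a [b [gab /= xab yab]]]].
have [[_ _ [hs0 hb1 hb2 hg1 hg2] _] _] := gab.
have [uCL sCL ux sy u0] := good_square_sol gab.1.
have [Dm mx my] := Fr_frame gab mu0.
have [D1 x1 y1] := Fr_frame gab (oner_neq0 R).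
have k1 := coefc1_CL hg1 uCL 1; have k2 := coefc2_CL hg2 uCL 1.
have fE v t : a < v < b -> a < t < b -> immersion (v, t) = surf (ft x0) (Fr mu) (Fr 1) v t by [].
have nE v t : a < v < b -> a < t < b -> gauss (v, t) = Fr 1 v t *m e3 R *m adj2 (Fr 1 v t) by [].
have d0 := ft_det Ix0.
split.
- exact: (surf_immersion mu0 mu1 d0 Dm D1 mx my x1 y1 fE xab yab nd).
- exact: (surf_gauss_map d0 Dm D1 mx my x1 y1 fE nE xab yab).
- exact: (surf_asymptotic mu0 mu1 rho0 rhoN1 erefl (hb1 1%N) (hb2 1%N) k1 k2 d0
     Dm D1 mx my x1 y1 fE nE xab yab nd).
- exact: (surf_gauss_curvature mu0 rhoN1 erefl (hb1 1%N) (hb2 1%N) k1 k2 d0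
     Dm D1 mx my x1 y1 fE nE xab yab nd).
Qed.


Lemma immersion_frame p : Omega p ->
  toC (immersion p) = toC (ft x0) *m extended_frame X Y Hm Hp p (real_complex R mu)
    *m invmx (extended_frame X Y Hm Hp p 1) /\
  toC (gauss p) = Ad (extended_frame X Y Hm Hp p 1) (e3 R[i]).
Proof.
move=> Op; have [_ [a [b [gab xab yab]]]] := Op.
have [Im I2] := Omega_sub Op.
rewrite !extended_frameE ?oner_neq0 ?toC_neq0//.
have e1 : X p.1 1 *m Hm p 1 = toC (Fr 1 p.1 p.2).
  by rewrite (toC_Fr gab (oner_neq0 _) xab yab) /= -surjective_pairing.
have em : X p.1 mu%:C%C *m Hm p mu%:C%C = toC (Fr mu p.1 p.2).
  by rewrite (toC_Fr gab mu0 xab yab) /= -surjective_pairing.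
have [D1 _ _] := Fr_frame gab (oner_neq0 R).
have d1 : \det (toC (Fr 1 p.1 p.2)) = 1 by rewrite det_toC D1.
rewrite em e1 /Ad invmx_adj2// -toC_adj2 -!toCM; split => //.
rewrite /gauss !toCM; congr (_ *m _ *m _).
by apply: mx2P; rewrite toCE !mx2E ?rmorphN.
Qed.

Lemma immersion_smooth : smooth2 Omega immersion.
Proof.
move=> n; apply: Ck2_local => -[x y] [_ [a [b [gab xab yab]]]].
by exists a, b, (fun x y => immersion (x, y)); split => //; exact: immersion_CLm gab n.
Qed.

Lemma immersion_diag x : I x -> immersion (x, x) = ft x /\ gauss (x, x) = nut x.
Proof.
move=> Ix; have [_ [a [b [gab xab _]]]] := Omega_diag Ix.
have [[_ _ [hs0 hb1 hb2 hg1 hg2] _] _] := gab.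
have [uCL sCL ux sy u0] := good_square_sol gab.1.
have E l : Fr l x x = mxRe (X x l%:C%C).
  by rewrite /Fr /real_frame (Hminus_diag hg1 hg2 uCL _ xab) mulmx1.
have E1 : Fr 1 x x = F x by rewrite E [_%:C%C]rmorph1 X_at1// mxRe_toC.
split; last by rewrite /gauss /= E1 F_nut.
rewrite /immersion /surf /= E1 E X_at_mu// mxRe_toC !mulmxA mulmx_adj2 ft_det// mul1mx.
by rewrite -mulmxA mulmx_adj2 F_det// mulmx1.
Qed.

End Construction.

(** The potential at [x] depends on [N1] through its value at [x] alone, so two choices of [N1] that
    agree on [I] give the same equations there. *)
Lemma dpw_potential_ext (R : realType) (N0 N1 N1' F : R -> 'M[R]_2) l x : N1 x = N1' x ->
  dpw_potential N0 N1 F l x = dpw_potential N0 N1' F l x.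
Proof. by rewrite /dpw_potential /dpw_beta /dpw_gamma => ->. Qed.

Theorem corollary4p11 (R : realType) (I : set R) (x0 : R)
  (I_open : open I) (I_interval : is_interval I) (Ix0 : I x0)
  (ft nut : R -> 'M[R]_2)
  (ft_smooth : smooth1 I ft) (nut_smooth : smooth1 I nut)
  (ft_AdS3 : forall x, I x -> AdS3 (ft x))
  (nut_S21 : forall x, I x -> S21 (nut x))
  (ft_nut : forall x, I x -> inner (invmx (ft x) *m derive1 ft x) (nut x) = 0)
  (rho : R) (rho_neq0 : rho != 0) (rho_neq1 : rho != 1) (rho_neqN1 : rho != -1) :
  let w := fun x : R => 2^-1 *: bracket (nut x) (invmx (ft x) *m derive1 ft x) in
  let N1 := fun x : R =>
    ((rho + 1) / (2 * rho)) *: (derive1 nut x + (rho - 1) *: w x) in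
  let mu := (rho - 1) / (rho + 1) in
  (forall x, I x -> free [:: derive1 nut x; w x]) ->
  forall (F : R -> 'M[R]_2) (X Y : R -> R[i] -> 'M[R[i]]_2),
  adapted_frame I nut F ->
  dpw_solution I x0 nut N1 F X ->
  dpw_solution I x0 nut N1 F Y ->
  exists (Omega : set (R * R)) (Hm Hp : R * R -> R[i] -> 'M[R[i]]_2)
         (f nu : R * R -> 'M[R]_2),
    [/\ open Omega, (forall x, I x -> Omega (x, x)) & Omega `<=` I `*` I] /\
    birkhoff_factorization Omega X Y Hm Hp /\
    let Fhat := extended_frame X Y Hm Hp in
    (forall p, Omega p ->
      toC (f p) =
        toC (ft x0) *m Fhat p (real_complex R mu) *m invmx (Fhat p 1) /\
      toC (nu p) = Ad (Fhat p 1) (e3 R[i])) /\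
    timelike_immersion Omega f /\
    gauss_map Omega f nu /\
    asymptotic_coordinates Omega f nu /\
    (forall p, Omega p -> gauss_curvature f nu p + 1 = rho ^+ 2) /\
    (forall x, I x -> f (x, x) = ft x /\ nu (x, x) = nut x).
Proof.
move=> w N1 mu w_free F X Y [F_smooth F_frame] solX solY.
have ft_det x : I x -> \det (ft x) = 1 by move=> /ft_AdS3/AdS3_det.
have F_det x : I x -> \det (F x) = 1 by move=> /F_frame[].
have F_nut x : I x -> F x *m e3 R *m adj2 (F x) = nut x.
  by move=> /F_frame[d <-]; rewrite /Ad invmx_adj2.
have velE x : I x -> invmx (ft x) *m derive1 ft x = velocity ft x.
  by move=> Ix; rewrite invmx_adj2// ft_det.
have ft_nut' x : I x -> inner (velocity ft x) (nut x) = 0.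
  by move=> Ix; rewrite -velE// ft_nut.
(* The adjugate agrees with the inverse where the determinant is 1, which is known on [I]; [w] and
   [w'], and likewise [N1] and [N1'], are therefore identified pointwise on [I]. *)
pose w' x := 2^-1 *: bracket (nut x) (velocity ft x).
have wE x : I x -> w x = w' x by move=> Ix; rewrite /w velE.
have free' x : I x -> free [:: derive1 nut x; w' x] by move=> Ix; rewrite -wE//; exact: w_free.
pose N1' x := ((rho + 1) / (2 * rho)) *: (derive1 nut x + (rho - 1) *: w' x).
have solE Z : dpw_solution I x0 nut N1 F Z -> (forall l, l != 0 -> Z x0 l = toC (F x0)) /\
    (forall l t, l != 0 -> I t -> mcder (Z^~ l) t
      (Z t l *m mxalpha (vel3 F) (off1 F N1') (off2 F N1')
        (off1 F (fun x => derive1 nut x - N1' x)) (off2 F (fun x => derive1 nut x - N1' x)) l t)).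
  move=> sol; split=> [l l0|l t l0 It]; first by have [] := sol l l0.
  have [_ /(_ t It)[d1 d2]] := sol l l0.
  have {d1 d2} := mcderP d1 d2.
  rewrite (@dpw_potential_ext _ nut N1 N1') ?dpw_potentialE ?F_det//.
  by rewrite /N1 wE.
have [X0 dX] := solE _ solX; have [Y0 dY] := solE _ solY.
(* Both solve the same Cauchy problem, so [X] can be used in both variables. *)
have YX l t : l != 0 -> I t -> Y t l = X t l.
  move=> l0 It.
  exact: (X_unique I_open I_interval Ix0 F_det X0 dX l0 (Y0 l l0) (fun t => dY l t l0) It).
exists (Omega I F ft nut rho), (Hm F ft nut rho), (Hp F ft nut rho),
  (immersion x0 F ft nut rho X), (gauss F ft nut rho X).
split; first split.
- exact: Omega_open.
- by move=> x; exact: Omega_diag.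
- exact: Omega_sub.
split; first by move=> p; exact: (birkhoff I_open I_interval Ix0 F_det X0 dX YX).
have geo := immersion_geometry I_open I_interval Ix0 F_det ft_det rho_neq0 rho_neq1 rho_neqN1 X0 dX.
split.
  by move=> p; exact: (immersion_frame I_open I_interval Ix0 F_det rho_neq1 rho_neqN1 X0 dX YX).
split.
  split; first exact: (immersion_smooth I_open I_interval Ix0 F_smooth F_det F_nut
    ft_smooth ft_det ft_nut' rho_neq0 rho_neq1 rho_neqN1 X0 dX).
  by move=> p /geo[].
split; first by move=> p /geo[].
split; first by move=> p /geo[].
split; first by move=> p /geo[].
move=> x Ix; exact: (immersion_diag I_open I_interval Ix0 F_smooth F_det F_nut
  ft_smooth ft_det ft_nut' nut_smooth rho_neq0 rho_neq1 rho_neqN1 free' X0 dX Ix).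
Qed.
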